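(* Let $f(t,x,v)=f_0(X(0;t,x,v),V(0;t,x,v))$. (i) If $f_0\in C^1_{x,v}(\overline\Omega\times\mathbb{R}^2)$ satisfies the specular reflection condition and the $C^1$ compatibility condition (see context), then the $C^1(\mathbb{R}_+\times\mathcal I)$ solution $f$ satisfies $$\|f\|_{C^1_{t,x,v}}\lesssim\|f_0\|_{C^1}\frac{|v|}{|v\cdot n(x_{\mathbf b})|^2}\langle v\rangle^2(1+|v|t).$$ (ii) If $f_0\in C^2_{x,v}(\overline\Omega\times\mathbb{R}^2)$ satisfies the specular reflection condition, the $C^1$ compatibility condition and the $C^2$ compatibility conditions (see context), then the $C^2(\mathbb{R}_+\times\mathcal I)$ solution $f$ satisfies $$\|f\|_{C^2_{t,x,v}}\lesssim\|f_0\|_{C^2}\frac{|v|^2}{|v\cdot n(x_{\mathbf b})|^4}\langle v\rangle^4(1+|v|t)^2.$$ Here $x_{\mathbf b}=x_{\mathbf b}(x,v)$, $\langle v\rangle=1+|v|$, and both bounds are pointwise at $(t,x,v)\in\mathbb{R}_+\times\mathcal I$ with $v\ne0$, with implicit constants independent of $f_0$ and $(t,x,v)$.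
   Context: $\Omega=\{x\in\mathbb{R}^2:|x|<1\}$, $n(x)=x$ on $\partial\Omega$, $R_x=I-2n(x)\otimes n(x)$ for $x\in\partial\Omega$, $\mathbb{R}_+=[0,\infty)$. Vectors are columns, gradients of scalar functions are row vectors, the derivative of a vector function is its Jacobian matrix, $a\otimes b=ab^T$. $Q$ is the counterclockwise rotation by $\pi/2$. ''$\parallel$'' means being a scalar multiple (zero allowed). On the left-hand sides, $\|f\|_{C^k_{t,x,v}}$ denotes, at a given point $(t,x,v)$, the sum of the absolute values of all partial derivatives in $(t,x,v)$ of $f$ of order at most $k$; $\|f_0\|_{C^k}$ is the usual $C^k$ norm (supremum over $\overline\Omega\times\mathbb{R}^2$). Second derivatives are $2\times2$ matrices: $(\nabla_{xx}f_0)_{ij}=\partial_{x_j}\partial_{x_i}f_0$, $(\nabla_{vv}f_0)_{ij}=\partial_{v_j}\partial_{v_i}f_0$, $(\nabla_{xv}f_0)_{ij}=\partial_{x_j}\partial_{v_i}f_0$, $(\nabla_{vx}f_0)_{ij}=\partial_{v_j}\partial_{x_i}f_0$. $\gamma_\pm=\{(x,v)\in\partial\Omega\times\mathbb{R}^2:\pm v\cdot n(x)>0\}$, $\gamma_0=\{(x,v)\in\partial\Omega\times\mathbb{R}^2:v\cdot n(x)=0\}$, $\mathcal{I}=(\overline\Omega\times\mathbb{R}^2)\setminus\gamma_0$. Backward specular characteristics: for $(x,v)\in\mathcal I$, $t_{\mathbf b}(x,v)=\sup\{s\ge0:x-sv\in\Omega\}$ (equal to $0$ if $(x,v)\in\gamma_-$;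 if $v=0$ there is no bounce) and $x_{\mathbf b}(x,v)=x-t_{\mathbf b}(x,v)v$. Put $(t^0,x^0,v^0)=(t,x,v)$ and, for $k\ge1$, $t^k=t^{k-1}-t_{\mathbf b}(x^{k-1},v^{k-1})$, $x^k=x^{k-1}-t_{\mathbf b}(x^{k-1},v^{k-1})v^{k-1}$, $v^k=R_{x^k}v^{k-1}$. For $s\in(t^{k+1},t^k]$ set $X(s;t,x,v)=x^k-(t^k-s)v^k$ and $V(s;t,x,v)=v^k$. Under the conditions below, $f$ is the unique $C^1$ (resp. $C^2$) solution of $\partial_tf+v\cdot\nabla_xf=0$ on $\mathbb{R}_+\times\mathcal I$ with $f(t,x,v)=f(t,x,R_xv)$ on $\partial\Omega$ and initial datum $f_0$. Specular reflection condition: $f_0(x,v)=f_0(x,R_xv)$ for all $x\in\partial\Omega$, $v\in\mathbb{R}^2$. $C^1$ compatibility condition: for all $(x,v)\in\gamma_-$ (with $n=n(x)$), $$\Big[\nabla_x f_0(x,v)+\nabla_v f_0(x,v)\tfrac{(Qv)\otimes(Qv)}{v\cdot n}\Big]R_x=\nabla_x f_0(x,R_xv)+\nabla_v f_0(x,R_xv)\tfrac{(QR_xv)\otimes(QR_xv)}{R_xv\cdot n}.$$ $C^2$ compatibility conditions: for all $(x,v)\in\gamma_-$, $\nabla_xf_0(x,R_xv)\parallel(R_xv)^T$, $\nabla_vf_0(x,R_xv)\parallel(R_xv)^T$, $$R_x\Big[\nabla_{xv}f_0(x,v)+\nabla_{vv}f_0(x,v)\tfrac{(Qv)\otimes(Qv)}{v\cdot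 n}\Big]R_x=\nabla_{xv}f_0(x,R_xv)+\nabla_{vv}f_0(x,R_xv)\tfrac{(QR_xv)\otimes(QR_xv)}{R_xv\cdot n}+R_x\begin{bmatrix}\nabla_vf_0(x,R_xv)\mathcal{J}_1\\ \nabla_vf_0(x,R_xv)\mathcal{J}_2\end{bmatrix}R_x,$$ $$\begin{aligned}&R_x\Big[\nabla_{xx}f_0(x,v)+\nabla_{vx}f_0(x,v)\tfrac{(Qv)\otimes(Qv)}{v\cdot n}+\tfrac{(Qv)\otimes(Qv)}{v\cdot n}\nabla_{xv}f_0(x,v)\Big]R_x\\ &=\nabla_{xx}f_0(x,R_xv)+\nabla_{vx}f_0(x,R_xv)\tfrac{(QR_xv)\otimes(QR_xv)}{R_xv\cdot n}+\tfrac{(QR_xv)\otimes(QR_xv)}{R_xv\cdot n}\nabla_{xv}f_0(x,R_xv)\\ &\quad-2R_x\begin{bmatrix}\nabla_vf_0(x,R_xv)\nabla_vA^1_{v,x}\\ \nabla_vf_0(x,R_xv)\nabla_vA^2_{v,x}\end{bmatrix}R_xA_{v,x}R_x+A_{v,x}\begin{bmatrix}\nabla_vf_0(x,R_xv)\mathcal{J}_1\\ \nabla_vf_0(x,R_xv)\mathcal{J}_2\end{bmatrix}R_x+R_x\begin{bmatrix}\nabla_vf_0(x,R_xv)\mathcal{K}_1\\ \nabla_vf_0(x,R_xv)\mathcal{K}_2\end{bmatrix}R_x,\end{aligned}$$ where a bracket of two stacked row vectors is the $2\times 2$ matrix with those rows, $A_{v,x}=\big((v\cdot n(x))I+n(x)\otimes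 v\big)\big(I-\frac{v\otimes n(x)}{v\cdot n(x)}\big)$, $A^i_{v,x}$ is its $i$-th column, $\nabla_vA^i_{v,x}$ its Jacobian in $v$ with $x$ fixed, and, with $x=(x_1,x_2)$, $v=(v_1,v_2)$, $$\mathcal{J}_1=\frac1{v\cdot x}\begin{bmatrix}-4v_2x_1x_2&4v_1x_1x_2\\-2v_2(x_2^2-x_1^2)&2v_1(x_2^2-x_1^2)\end{bmatrix},\quad \mathcal{J}_2=\frac1{v\cdot x}\begin{bmatrix}-2v_2(x_2^2-x_1^2)&2v_1(x_2^2-x_1^2)\\4v_2x_1x_2&-4v_1x_1x_2\end{bmatrix},$$ and $\mathcal{K}_m=\frac{1}{(v\cdot x)^3}(\kappa^m_{ij})_{1\le i,j\le2}$ with $\kappa^1_{11}=4v_1^2v_2^2x_1^3+2v_1v_2^3(3x_1^2x_2-x_2^3)+2v_2^4(3x_1x_2^2+x_1^3)$, $\kappa^1_{12}=-4v_1^3v_2x_1^3-2v_1^2v_2^2(3x_1^2x_2-x_2^3)-2v_1v_2^3(3x_1x_2^2+x_1^3)$, $\kappa^1_{21}=4v_2^4x_2^3+2v_1v_2^3(3x_1x_2^2-x_1^3)+2v_1^2v_2^2(3x_1^2x_2+x_2^3)$, $\kappa^1_{22}=-4v_1v_2^3x_2^3-2v_1^2v_2^2(3x_1x_2^2-x_1^3)-2v_1^3v_2(3x_1^2x_2+x_2^3)$, $\kappa^2_{11}=-4v_1^3v_2x_1^3-2v_1v_2^3(3x_1x_2^2+x_1^3)-2v_1^2v_2^2(3x_1^2x_2-x_2^3)$,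 $\kappa^2_{12}=4v_1^4x_1^3+2v_1^2v_2^2(3x_1x_2^2+x_1^3)+2v_1^3v_2(3x_1^2x_2-x_2^3)$, $\kappa^2_{21}=-4v_1v_2^3x_2^3-2v_1^3v_2(3x_1^2x_2+x_2^3)-2v_1^2v_2^2(3x_1x_2^2-x_1^3)$, $\kappa^2_{22}=4v_1^2v_2^2x_2^3+2v_1^4(3x_1^2x_2+x_2^3)+2v_1^3v_2(3x_1x_2^2-x_1^3)$. *)

(* Defs.v *)
From HB Require Import structures.
From mathcomp Require Import all_boot all_order all_algebra.
From mathcomp Require Import all_classical all_reals all_analysis.

Set Implicit Arguments.
Unset Strict Implicit.
Unset Printing Implicit Defensive.

Import Order.TTheory GRing.Theory Num.Theory.
Import numFieldNormedType.Exports.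

Local Open Scope classical_set_scope.
Local Open Scope ring_scope.

(** Partial derivatives are taken in the interior [S°], where they exist in
    the ordinary sense, and extended to the remaining points of [S] as limits
    from [S°].  [e] is the family of coordinate directions;
    [S] is meant to lie in the closure of [S°]. *)

Section Ck.
Variables (R : realType) (V : normedModType R) (J : finType) (e : J -> V).
Variable S : set V.
Implicit Types (f : V -> R) (p : V).

Definition pderiv (j : J) f p : R := lim ('D_(e j) f @ within S° (nbhs p)).

(** Convergence at every [p] of [S] says both that the partial derivative is
    continuous on [S°] ([p] itself belongs to [S°] there) and that it extends
    continuously to [S].  Without it, [pderiv] would be a default value. *)
Definition pderivable (j : J) f : Prop :=
  (forall p, S° p -> derivable f p (e j)) /\
  (forall p, S p -> cvg ('D_(e j) f @ within S° (nbhs p))).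

Fixpoint Ck_on (k : nat) f : Prop :=
  {within S, continuous f} /\
  (if k is k'.+1 then forall j, pderivable j f /\ Ck_on k' (pderiv j f)
   else True).

(** Sum of the absolute values at [p] of all the iterated partial derivatives of
    order at most [k]; a mixed derivative is counted once per order of
    differentiation. *)
Fixpoint Ck_abs (k : nat) f p : R :=
  `|f p| + (if k is k'.+1 then \sum_(j : J) Ck_abs k' (pderiv j f) p else 0).

Definition Ck_norm (k : nat) f : \bar R :=
  ereal_sup [set (Ck_abs k f p)%:E | p in S].

End Ck.

Section Disc.
Variable R : realType.
Local Notation vec := 'cV[R]_2.
Local Notation phase := ('cV[R]_2 * 'cV[R]_2)%type.
Implicit Types (x v : vec) (s t : R).

Definition dot (u w : vec) : R := (u^T *m w) 0 0.
(** The norm [`|v|] of the library on matrices is the sup norm. *)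
Definition enorm (u : vec) : R := Num.sqrt (dot u u).
Definition tens (a b : vec) : 'M[R]_2 := a *m b^T.

Definition disc : set vec := [set x | enorm x < 1].
Definition cdisc : set vec := [set x | enorm x <= 1].
Definition circle : set vec := [set x | enorm x = 1].

(** The outward normal at [x] in [circle] is [x] itself. *)
Definition reflmx x : 'M[R]_2 := 1%:M - 2 *: tens x x.

Definition mx22 (a b c d : R) : 'M[R]_2 :=
  \matrix_(i, j) (if i == 0 then (if j == 0 then a else b)
                  else (if j == 0 then c else d)).

(** Counterclockwise rotation by pi/2. *)
Definition Qmx : 'M[R]_2 := mx22 0 (- 1) 1 0.

Definition gamma_minus : set phase := [set p | circle p.1 /\ dot p.2 p.1 < 0].
Definition gamma_zero : set phase := [set p | circle p.1 /\ dot p.2 p.1 = 0].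

Definition phase_dom : set phase := [set p | cdisc p.1].
Definition phase_reg : set phase := phase_dom `\` gamma_zero.
Definition time_dom : set (R * phase) :=
  [set z | 0 <= z.1 /\ phase_reg z.2].

(** Coordinate directions: [inl i] is x_i, [inr i] is v_i, [None] is t. *)
Definition vece (i : 'I_2) : vec := delta_mx i 0.
Definition phase_dir (j : 'I_2 + 'I_2) : phase :=
  match j with inl i => (vece i, 0) | inr i => (0, vece i) end.
Definition time_dir (j : option ('I_2 + 'I_2)) : R * phase :=
  if j is Some j' then (0, phase_dir j') else (1, 0).

(** The set is empty if [(x, v)] is in [gamma_minus], and [sup set0 = 0].  For
    [v = 0] it is unbounded and [tb] is meaningless, whence the case
    distinction in [Xchar] and [Vchar]. *)
Definition tb x v : R := sup [set s | 0 <= s /\ disc (x - s *: v)].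
Definition xb x v : vec := x - tb x v *: v.

Definition bounce (z : R * phase) : R * phase :=
  let: (t, (x, v)) := z in
  (t - tb x v, (xb x v, reflmx (xb x v) *m v)).

(** [bcycle k t x v] is (t^k, (x^k, v^k)). *)
Definition bcycle (k : nat) t x v : R * phase := iter k bounce (t, (x, v)).

(** The [k] such that s is in (t^(k+1), t^k]. *)
Definition bounce_index s t x v : nat :=
  get [set k : nat | (bcycle k.+1 t x v).1 < s <= (bcycle k t x v).1].

Definition Xchar s t x v : vec :=
  if v == 0 then x else
  let: (tk, (xk, vk)) := bcycle (bounce_index s t x v) t x v in
  xk - (tk - s) *: vk.

Definition Vchar s t x v : vec :=
  if v == 0 then v else (bcycle (bounce_index s t x v) t x v).2.2.

Definition char_sol (f0 : phase -> R) (z : R * phase) : R :=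
  let: (t, (x, v)) := z in f0 (Xchar 0 t x v, Vchar 0 t x v).

Definition dt (f : R * phase -> R) : R * phase -> R :=
  pderiv time_dir time_dom None f.
Definition dx (i : 'I_2) (f : R * phase -> R) : R * phase -> R :=
  pderiv time_dir time_dom (Some (inl i)) f.

Definition Ck_solution (k : nat) (f0 : phase -> R) (f : R * phase -> R) :=
  [/\ Ck_on time_dir time_dom k f,
      forall z, time_dom z ->
        dt f z + \sum_(i < 2) z.2.2 i 0 * dx i f z = 0,
      forall t x v, time_dom (t, (x, v)) -> circle x ->
        f (t, (x, v)) = f (t, (x, reflmx x *m v)) &
      forall p, phase_reg p -> f (0, p) = f0 p].

Section Datum.
Variable f0 : phase -> R.

Definition specular : Prop :=
  forall x v, circle x -> f0 (x, v) = f0 (x, reflmx x *m v).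

Local Notation pd := (pderiv phase_dir phase_dom).

Definition grad_x x v : 'rV[R]_2 := \row_j pd (inl j) f0 (x, v).
Definition grad_v x v : 'rV[R]_2 := \row_j pd (inr j) f0 (x, v).
(** The second letter of the name is the variable of the rows (and of the inner
    derivative) for [hess_xv], whose entries are d_(x_j) d_(v_i) f0; likewise
    [hess_vx] has the entries d_(v_j) d_(x_i) f0. *)
Definition hess_xx x v : 'M[R]_2 :=
  \matrix_(i, j) pd (inl j) (pd (inl i) f0) (x, v).
Definition hess_vv x v : 'M[R]_2 :=
  \matrix_(i, j) pd (inr j) (pd (inr i) f0) (x, v).
Definition hess_xv x v : 'M[R]_2 :=
  \matrix_(i, j) pd (inl j) (pd (inr i) f0) (x, v).
Definition hess_vx x v : 'M[R]_2 :=
  \matrix_(i, j) pd (inr j) (pd (inl i) f0) (x, v).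

Definition QQ x v : 'M[R]_2 := (dot v x)^-1 *: tens (Qmx *m v) (Qmx *m v).

Definition C1_compat : Prop :=
  forall x v, gamma_minus (x, v) ->
    let w := reflmx x *m v in
    (grad_x x v + grad_v x v *m QQ x v) *m reflmx x =
    grad_x x w + grad_v x w *m QQ x w.

Definition parallel (g h : 'rV[R]_2) : Prop := exists c : R, g = c *: h.

Definition stack (r1 r2 : 'rV[R]_2) : 'M[R]_2 :=
  \matrix_(i, j) (if i == 0 then r1 0 j else r2 0 j).

Definition Amx v x : 'M[R]_2 :=
  ((dot v x)%:M + tens x v) *m (1%:M - (dot v x)^-1 *: tens v x).

Definition jac (g : vec -> vec) v : 'M[R]_2 :=
  \matrix_(i, j) 'D_(vece j) (fun u : vec => g u i 0) v.

Definition jacA (i : 'I_2) v x : 'M[R]_2 := jac (fun u => col i (Amx u x)) v.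

Definition J1 v x : 'M[R]_2 :=
  let x1 := x 0 0 in let x2 := x 1 0 in
  let v1 := v 0 0 in let v2 := v 1 0 in
  (dot v x)^-1 *:
  mx22 (- 4 * v2 * x1 * x2) (4 * v1 * x1 * x2)
       (- 2 * v2 * (x2 ^+ 2 - x1 ^+ 2)) (2 * v1 * (x2 ^+ 2 - x1 ^+ 2)).

Definition J2 v x : 'M[R]_2 :=
  let x1 := x 0 0 in let x2 := x 1 0 in
  let v1 := v 0 0 in let v2 := v 1 0 in
  (dot v x)^-1 *:
  mx22 (- 2 * v2 * (x2 ^+ 2 - x1 ^+ 2)) (2 * v1 * (x2 ^+ 2 - x1 ^+ 2))
       (4 * v2 * x1 * x2) (- 4 * v1 * x1 * x2).

Definition K1 v x : 'M[R]_2 :=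
  let x1 := x 0 0 in let x2 := x 1 0 in
  let v1 := v 0 0 in let v2 := v 1 0 in
  (dot v x ^+ 3)^-1 *:
  mx22
    (4 * v1 ^+ 2 * v2 ^+ 2 * x1 ^+ 3
     + 2 * v1 * v2 ^+ 3 * (3 * x1 ^+ 2 * x2 - x2 ^+ 3)
     + 2 * v2 ^+ 4 * (3 * x1 * x2 ^+ 2 + x1 ^+ 3))
    (- 4 * v1 ^+ 3 * v2 * x1 ^+ 3
     - 2 * v1 ^+ 2 * v2 ^+ 2 * (3 * x1 ^+ 2 * x2 - x2 ^+ 3)
     - 2 * v1 * v2 ^+ 3 * (3 * x1 * x2 ^+ 2 + x1 ^+ 3))
    (4 * v2 ^+ 4 * x2 ^+ 3
     + 2 * v1 * v2 ^+ 3 * (3 * x1 * x2 ^+ 2 - x1 ^+ 3)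
     + 2 * v1 ^+ 2 * v2 ^+ 2 * (3 * x1 ^+ 2 * x2 + x2 ^+ 3))
    (- 4 * v1 * v2 ^+ 3 * x2 ^+ 3
     - 2 * v1 ^+ 2 * v2 ^+ 2 * (3 * x1 * x2 ^+ 2 - x1 ^+ 3)
     - 2 * v1 ^+ 3 * v2 * (3 * x1 ^+ 2 * x2 + x2 ^+ 3)).

Definition K2 v x : 'M[R]_2 :=
  let x1 := x 0 0 in let x2 := x 1 0 in
  let v1 := v 0 0 in let v2 := v 1 0 in
  (dot v x ^+ 3)^-1 *:
  mx22
    (- 4 * v1 ^+ 3 * v2 * x1 ^+ 3
     - 2 * v1 * v2 ^+ 3 * (3 * x1 * x2 ^+ 2 + x1 ^+ 3)
     - 2 * v1 ^+ 2 * v2 ^+ 2 * (3 * x1 ^+ 2 * x2 - x2 ^+ 3))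
    (4 * v1 ^+ 4 * x1 ^+ 3
     + 2 * v1 ^+ 2 * v2 ^+ 2 * (3 * x1 * x2 ^+ 2 + x1 ^+ 3)
     + 2 * v1 ^+ 3 * v2 * (3 * x1 ^+ 2 * x2 - x2 ^+ 3))
    (- 4 * v1 * v2 ^+ 3 * x2 ^+ 3
     - 2 * v1 ^+ 3 * v2 * (3 * x1 ^+ 2 * x2 + x2 ^+ 3)
     - 2 * v1 ^+ 2 * v2 ^+ 2 * (3 * x1 * x2 ^+ 2 - x1 ^+ 3))
    (4 * v1 ^+ 2 * v2 ^+ 2 * x2 ^+ 3
     + 2 * v1 ^+ 4 * (3 * x1 ^+ 2 * x2 + x2 ^+ 3)
     + 2 * v1 ^+ 3 * v2 * (3 * x1 * x2 ^+ 2 - x1 ^+ 3)).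

Definition C2_compat_xv x v : Prop :=
  let w := reflmx x *m v in
  let Rx := reflmx x in
  Rx *m (hess_xv x v + hess_vv x v *m QQ x v) *m Rx =
  hess_xv x w + hess_vv x w *m QQ x w
  + Rx *m stack (grad_v x w *m J1 v x) (grad_v x w *m J2 v x) *m Rx.

Definition C2_compat_xx x v : Prop :=
  let w := reflmx x *m v in
  let Rx := reflmx x in
  Rx *m (hess_xx x v + hess_vx x v *m QQ x v + QQ x v *m hess_xv x v) *m Rx =
  hess_xx x w + hess_vx x w *m QQ x w + QQ x w *m hess_xv x w
  - 2 *: (Rx *m stack (grad_v x w *m jacA 0 v x) (grad_v x w *m jacA 1 v x)
          *m Rx *m Amx v x *m Rx)
  + Amx v x *m stack (grad_v x w *m J1 v x) (grad_v x w *m J2 v x) *m Rx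
  + Rx *m stack (grad_v x w *m K1 v x) (grad_v x w *m K2 v x) *m Rx.

Definition C2_compat : Prop :=
  forall x v, gamma_minus (x, v) ->
    let w := reflmx x *m v in
    [/\ parallel (grad_x x w) w^T, parallel (grad_v x w) w^T,
        C2_compat_xv x v & C2_compat_xx x v].

End Datum.

Definition jap v : R := 1 + enorm v.

End Disc.

(* Main.v *)
Require Import Defs.
From mathcomp Require Import all_boot all_order all_algebra.
From mathcomp Require Import all_classical all_reals all_analysis.
From mathcomp Require Import ring lra zify.

(** The backward billiard flow in the disc is explicit.  Let [w = v / |v|], let
    [beta = x_1 w_2 - x_2 w_1] be the angular momentum at unit speed and
    [phi = asin beta].  All chords of the trajectory have length [2 cos phi], and
    [|v . n(x_b)| = |v| cos phi].  After [k] bounces the velocity is [v] rotated by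
    [2 k phi] and multiplied by [(-1)^k], and the position is a similar combination
    of rotations of [w] by multiples of [phi], affine in the time.  This defines
    maps [Phi k], smooth on the open set [regular], also across the bounce times
    [jhit k], and the solution is [f0 (Phi k z)] where [k = kappa z] counts the
    bounces ([char_solE]).

    Regularity.  The function [f0 (Phi k z)] lives on the closed set where [Phi k]
    stays in the closed disc, so derivatives are taken relative to a set
    ([hasgrad]); on the closed convex phase space [f0] has them at all points
    ([hasgrad_phase]), and a relative derivative with continuous gradient is what
    [Ck_on] asks for ([C1_of_hasgrad]).  Two consecutive pieces agree on their
    common hitting surface because the bounce is a specular reflection
    ([Phi_bounce]).  This surface is a graph over [(x, v)], so the gradients of the
    pieces agree there as soon as the time derivatives do ([hasgrad_match]).
    Up to sign, the first and second time derivatives of [f0 (Phi k z)] are the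
    derivatives [v . grad_x f0] and [v . (hess_xx f0) v] along the free flow at the
    bounce point.  The compatibility conditions, applied to the outgoing velocity
    on the right, respectively on both sides, say that these two quantities do not
    change under reflection ([flow1_invariant], [flow2_invariant]): their
    singular terms and correction terms annihilate the velocity.  For the second
    order, the gradients of the time derivative are matched first, and symmetry of
    second derivatives passes the agreement on to the other gradients
    ([hess_piece_match]).

    Estimates.  With [mu = 1 / cos phi] and [<v> = 1 + |v|], one derivative of [w]
    or [beta] costs at most a multiple of [<v> / |v|], one of [phi] another factor
    [mu], and the second derivative of [phi] one more.  The number of bounces is at
    most a multiple of [mu (1 + |v| t)].  Hence one derivative of [Phi k] costs
    [mu^2 <v>^2 (1 + |v| t) / |v|], which is the factor in the first estimate, and two
    derivatives cost the square of this.  The class of formulas is closed under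
    sums, products and composition with the few functions that occur; a [jet]
    carries the derivatives, their continuity and these bounds through it. *)

Import Order.TTheory GRing.Theory Num.Theory.
Import numFieldNormedType.Exports.
Local Open Scope classical_set_scope.
Local Open Scope ring_scope.
Set Implicit Arguments.
Unset Strict Implicit.
Unset Printing Implicit Defensive.

(** * Derivatives relative to a set *)

(** Coordinate functionals dual to the directions [e] that control the norm.
    The norms of the phase space and of space-time are nested maxima; seen
    through their coordinates the two spaces can be treated alike. *)
Record coords (R : realType) (V : normedModType R) (J : finType) (e : J -> V) :=
  Coords {
    co : J -> V -> R;
    co_lin : forall j a u w, co j (a *: u + w) = a * co j u + co j w;
    co_le : forall j u, `|co j u| <= `|u|;
    norm_co : forall u M, (forall j, `|co j u| <= M) -> 0 <= M -> `|u| <= M;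
    co_e : forall i j, co i (e j) = (i == j)%:R }.

Section Coords.
Variables (R : realType) (V : normedModType R) (J : finType) (e : J -> V).
Variable c : coords e.
Implicit Types (u w : V).

Lemma co0 j : co c j 0 = 0.
Proof.
have := co_lin c j 1 0 0; rewrite scaler0 addr0 mul1r => /eqP.
by rewrite -subr_eq0 opprD addrA subrr sub0r oppr_eq0 => /eqP.
Qed.

Lemma coZ j a u : co c j (a *: u) = a * co c j u.
Proof. by rewrite -[a *: u]addr0 co_lin co0 addr0. Qed.

Lemma coD j u w : co c j (u + w) = co c j u + co c j w.
Proof. by rewrite -{1}[u]scale1r co_lin mul1r. Qed.

Lemma coN j u : co c j (- u) = - co c j u.
Proof. by rewrite -scaleN1r coZ mulN1r. Qed.

Lemma coB j u w : co c j (u - w) = co c j u - co c j w.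
Proof. by rewrite coD coN. Qed.

Lemma co_inj u w : (forall j, co c j u = co c j w) -> u = w.
Proof.
move=> h; apply/eqP; rewrite -subr_eq0 -normr_le0; apply: (norm_co (c := c)) => //.
by move=> j; rewrite coB h subrr normr0.
Qed.

Definition lin (g : J -> R) u : R := \sum_j g j * co c j u.

Lemma lin_e g j : lin g (e j) = g j.
Proof.
rewrite /lin (bigD1 j) //= co_e eqxx mulr1 big1 ?addr0 // => i /negbTE ij.
by rewrite co_e ij mulr0.
Qed.

Lemma linZ g a u : lin g (a *: u) = a * lin g u.
Proof. by rewrite /lin mulr_sumr; apply: eq_bigr => j _; rewrite coZ mulrCA. Qed.

Lemma linD g u w : lin g (u + w) = lin g u + lin g w.
Proof. by rewrite /lin -big_split; apply: eq_bigr => j _; rewrite coD mulrDr. Qed.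

Lemma linB g u w : lin g (u - w) = lin g u - lin g w.
Proof. by rewrite linD -scaleN1r linZ mulN1r. Qed.

Lemma lin_le g u : `|lin g u| <= (\sum_j `|g j|) * `|u|.
Proof.
rewrite (le_trans (ler_norm_sum _ _ _)) // mulr_suml ler_sum // => j _.
by rewrite normrM ler_wpM2l // co_le.
Qed.

(** Fréchet derivative relative to [A]: closed pieces, on whose boundary a
    function need not extend, can then be differentiated and glued. *)
Definition hasgrad (A : set V) (f : V -> R) (p : V) (g : J -> R) : Prop :=
  forall eps : R, 0 < eps ->
    \forall q \near p, A q -> `|f q - f p - lin g (q - p)| <= eps * `|q - p|.

Implicit Types (A B : set V) (f : V -> R) (p q : V) (g : J -> R).

Lemma hasgrad_near A B f p g : (\forall q \near p, B q -> A q) ->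
  hasgrad A f p g -> hasgrad B f p g.
Proof.
move=> BA h eps e0; have hA := h _ e0; near=> q => Bq.
by apply: (near hA q) => //; apply: (near BA q).
Unshelve. all: by end_near. Qed.

Lemma hasgrad_eq A f f' p g : f p = f' p ->
  (\forall q \near p, A q -> f q = f' q) -> hasgrad A f p g -> hasgrad A f' p g.
Proof.
move=> ep eA h eps e0; have hA := h _ e0; near=> q => Aq.
by rewrite -ep -(near eA q) //; apply: (near hA q).
Unshelve. all: by end_near. Qed.

Lemma hasgrad_eqg A f p g g' : (forall j, g j = g' j) ->
  hasgrad A f p g -> hasgrad A f p g'.
Proof. by move=> gg'; have -> : g = g' by apply/funext. Qed.

Lemma hasgrad_lip A f p g : hasgrad A f p g ->
  exists2 L : R, 0 <= L &
    \forall q \near p, A q -> `|f q - f p| <= L * `|q - p|.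
Proof.
move=> h; have h1 := h 1 ltr01.
exists (1 + \sum_j `|g j|); first by rewrite addr_ge0 // sumr_ge0.
near=> q => Aq.
rewrite -[f q - f p](subrK (lin g (q - p))) (le_trans (ler_normD _ _)) //.
by rewrite mulrDl lerD ?lin_le //; apply: (near h1 q).
Unshelve. all: by end_near. Qed.

Lemma near_ball_le p (k eps : R) : 0 <= k -> 0 < eps ->
  \forall q \near p, k * `|q - p| <= eps.
Proof.
move=> k0 e0.
have h : 0 < eps / (k + 1) by rewrite divr_gt0 // ltr_wpDl.
near=> q.
have : `|q - p| <= eps / (k + 1).
  rewrite distrC; near: q; apply: (@cvgr_dist_le _ _ _ (nbhs p) _ id p) => //.
rewrite ler_pdivlMr ?ltr_wpDl // => hq.
by rewrite (le_trans _ hq) // mulrC ler_wpM2l // lerDl.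
Unshelve. all: by end_near. Qed.

Lemma hasgrad_cvg A f p g : hasgrad A f p g ->
  f @ within A (nbhs p) --> f p.
Proof.
move=> /hasgrad_lip[L L0 hL]; apply/cvgrPdist_le => eps e0.
have hb := near_ball_le p L0 e0.
apply: filterS (filterI hL hb) => q [Lq bq] Aq; rewrite distrC.
by rewrite (le_trans (Lq _)).
Qed.

Lemma hasgrad_cst A a p : hasgrad A (fun=> a) p (fun=> 0).
Proof.
move=> eps e0; near=> q => _; rewrite subrr sub0r normrN /lin big1 => [|j _].
  by rewrite normr0 mulr_ge0 // ltW.
by rewrite mul0r.
Unshelve. all: by end_near. Qed.

Lemma hasgrad_co A i p : hasgrad A (co c i) p (fun j => (i == j)%:R).
Proof.
move=> eps e0; near=> q => _; rewrite -coB /lin (bigD1 i) //= eqxx mul1r.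
rewrite big1 => [|j ij]; last by rewrite eq_sym (negbTE ij) mul0r.
by rewrite addr0 subrr normr0 mulr_ge0 // ltW.
Unshelve. all: by end_near. Qed.

Lemma hasgradD A f f' p g g' : hasgrad A f p g -> hasgrad A f' p g' ->
  hasgrad A (fun q => f q + f' q) p (fun j => g j + g' j).
Proof.
move=> h h' eps e0; have e2 : 0 < eps / 2 by rewrite divr_gt0.
have {}h := h _ e2; have {}h' := h' _ e2; near=> q => Aq.
have -> : lin (fun j => g j + g' j) (q - p) = lin g (q - p) + lin g' (q - p).
  by rewrite /lin -big_split; apply: eq_bigr => j _; rewrite mulrDl.
have -> : f q + f' q - (f p + f' p) - (lin g (q - p) + lin g' (q - p)) =
  (f q - f p - lin g (q - p)) + (f' q - f' p - lin g' (q - p)) by ring.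
rewrite (le_trans (ler_normD _ _)) // [eps]splitr [X in _ <= X]mulrDl lerD //.
- exact: (near h q).
- exact: (near h' q).
Unshelve. all: by end_near. Qed.

Lemma hasgradM A f f' p g g' : hasgrad A f p g -> hasgrad A f' p g' ->
  hasgrad A (fun q => f q * f' q) p (fun j => g j * f' p + f p * g' j).
Proof.
move=> h h' eps e0.
have [L L0 hL] := hasgrad_lip h; have [L' L'0 hL'] := hasgrad_lip h'.
pose M : R := `|f p| + `|f' p| + 1.
have M0 : 0 < M by rewrite ltr_wpDl // addr_ge0.
have e2 : 0 < eps / (2 * M) by rewrite divr_gt0 // mulr_gt0.
have e3 : 0 < eps / 2 by rewrite divr_gt0.
have {}h := h _ e2; have {}h' := h' _ e2.
have hb := near_ball_le p (mulr_ge0 L0 L'0) e3.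
near=> q => Aq.
have -> : lin (fun j => g j * f' p + f p * g' j) (q - p) =
   f' p * lin g (q - p) + f p * lin g' (q - p).
  by rewrite /lin !mulr_sumr -big_split; apply: eq_bigr => j _ /=; ring.
have -> : f q * f' q - f p * f' p -
    (f' p * lin g (q - p) + f p * lin g' (q - p)) =
  f' p * (f q - f p - lin g (q - p)) + f p * (f' q - f' p - lin g' (q - p)) +
  (f q - f p) * (f' q - f' p) by ring.
have H : `|f q - f p - lin g (q - p)| <= eps / (2 * M) * `|q - p|.
  exact: (near h q).
have H' : `|f' q - f' p - lin g' (q - p)| <= eps / (2 * M) * `|q - p|.
  exact: (near h' q).
have HL : `|f q - f p| <= L * `|q - p| by exact: (near hL q).
have HL' : `|f' q - f' p| <= L' * `|q - p| by exact: (near hL' q).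
have HB : L * L' * `|q - p| <= eps / 2 by exact: (near hb q).
rewrite (le_trans (ler_normD _ _)) // [eps]splitr [X in _ <= X]mulrDl lerD //.
  rewrite (le_trans (ler_normD _ _)) // !normrM.
  rewrite (@le_trans _ _ ((`|f' p| + `|f p|) * (eps / (2 * M) * `|q - p|))) //.
    by rewrite mulrDl lerD // ler_wpM2l.
  have -> : eps / 2 * `|q - p| = M * (eps / (2 * M) * `|q - p|).
    by field; rewrite gt_eqF.
  rewrite ler_wpM2r //; first by rewrite mulr_ge0 // ltW.
  by rewrite /M [`|f' p| + _]addrC lerDl.
rewrite normrM (le_trans (ler_pM _ _ HL HL')) //.
have -> : L * `|q - p| * (L' * `|q - p|) = L * L' * `|q - p| * `|q - p| by ring.
by rewrite ler_wpM2r.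
Unshelve. all: by end_near. Qed.

Lemma hasgrad_sum A (I : finType) (F : I -> V -> R) p (G : I -> J -> R) :
  (forall i, hasgrad A (F i) p (G i)) ->
  hasgrad A (fun q => \sum_i F i q) p (fun j => \sum_i G i j).
Proof.
move=> h.
suff H (s : seq I) : hasgrad A (fun q => \sum_(i <- s) F i q) p
    (fun j => \sum_(i <- s) G i j) by exact: H.
elim: s => [|i s IH].
  apply: (@hasgrad_eq _ (fun=> 0)); first by rewrite big_nil.
    by near=> q => _; rewrite big_nil.
  by apply: hasgrad_eqg (hasgrad_cst _ _ _) => j; rewrite big_nil.
apply: (@hasgrad_eq _ (fun q => F i q + \sum_(i <- s) F i q)).
- by rewrite big_cons.
- by near=> q => _; rewrite big_cons.
- apply: hasgrad_eqg (hasgradD (h i) IH) => j; by rewrite big_cons.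
Unshelve. all: by end_near. Qed.

Lemma hasgrad_is_derive A f p g j : nbhs p A -> hasgrad A f p g ->
  is_derive p (e j) f (g j).
Proof.
move=> pA h.
suff H : (fun t : R => t^-1 *: ((f \o shift p) (t *: e j) - f p)) @ 0^' --> g j.
  apply: DeriveDef; first by apply/cvg_ex; exists (g j).
  exact/cvg_lim.
apply/cvgrPdist_le => eps e0.
have e1 : 0 < eps / (`|e j| + 1) by rewrite divr_gt0 // ltr_wpDl.
have {}h : \forall q \near p,
    `|f q - f p - lin g (q - p)| <= eps / (`|e j| + 1) * `|q - p|.
  by have {}h := h _ e1; near=> q; apply: (near h q) => //; apply: (near pA q).
have C : (fun t : R => t *: e j + p) @ 0^' --> p.
  apply: cvg_within_filter.
  have : (fun t : R => t *: e j + p) @ 0 --> 0 *: e j + p.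
    by apply: cvgD; [apply: cvgZr_tmp; exact: cvg_id|exact: cvg_cst].
  by rewrite scale0r add0r.
have {}h : \forall t \near (0 : R)^', `|f (t *: e j + p) - f p -
    lin g (t *: e j + p - p)| <= eps / (`|e j| + 1) * `|t *: e j + p - p|.
  exact: C _ h.
near=> t.
have t0 : t != 0 by near: t; exact: nbhs_dnbhs_neq.
have H : `|f (t *: e j + p) - f p - lin g (t *: e j + p - p)| <=
    eps / (`|e j| + 1) * `|t *: e j + p - p| by exact: (near h t).
rewrite addrK linZ lin_e normrZ in H.
rewrite distrC -[X in `|_ - X|](mulKf t0) -mulrBr normrM normfV.
rewrite ler_pdivrMl ?normr_gt0 // (le_trans H) //.
rewrite mulrCA ler_wpM2l // -mulrA ler_piMr ?(ltW e0) //.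
by rewrite mulrC ler_pdivrMr ?ltr_wpDl // mul1r lerDl.
Unshelve. all: by end_near. Qed.

End Coords.

Section Chain.
Variables (R : realType) (V W : normedModType R) (J I : finType).
Variables (e : J -> V) (d : I -> W) (c : coords e) (k : coords d).

(** Only points of [A] are tested, so [f] need only be differentiable relative
    to a set into which [Phi] maps [A]. *)
Lemma hasgrad_comp (A : set V) (B : set W) (Phi : V -> W) (f : W -> R) p
    (D : I -> J -> R) (g : I -> R) :
  (\forall q \near p, A q -> B (Phi q)) ->
  (forall i, hasgrad c A (fun q => co k i (Phi q)) p (D i)) ->
  hasgrad k B f (Phi p) g ->
  hasgrad c A (fun q => f (Phi q)) p (fun j => \sum_i g i * D i j).
Proof.
move=> AB hD hg.
pose Ps q := A q; pose S := \sum_i `|g i|.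
have S0 : 0 <= S by rewrite sumr_ge0.
have lip : exists2 L : R, 0 <= L &
    \forall q \near p, A q -> `|Phi q - Phi p| <= L * `|q - p|.
  have /choice[L HL] : forall i, exists L : R, 0 <= L /\ \forall q \near p, A q ->
      `|co k i (Phi q) - co k i (Phi p)| <= L * `|q - p|.
    by move=> i; have [L L0 HL] := hasgrad_lip (hD i); exists L.
  exists (\sum_i L i); first by rewrite sumr_ge0 // => i _; have [] := HL i.
  have HL' : \forall q \near p, forall i, A q ->
      `|co k i (Phi q) - co k i (Phi p)| <= L i * `|q - p|.
    by apply: filter_forall => i; have [] := HL i.
  near=> q => Aq; apply: (norm_co (c := k)) => [i|]; last first.
    by rewrite mulr_ge0 // sumr_ge0 // => i _; have [] := HL i.
  rewrite coB (le_trans (near HL' q _ i Aq)) // ler_wpM2r //.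
  by rewrite (bigD1 i) //= lerDl sumr_ge0 // => i' _; have [] := HL i'.
have [L L0 HL] := lip => eps e0.
have e1 : 0 < eps / (2 * (L + 1)) by rewrite divr_gt0 // mulr_gt0 // ltr_wpDl.
have e2 : 0 < eps / (2 * (S + 1)) by rewrite divr_gt0 // mulr_gt0 // ltr_wpDl.
have C : Phi @ within A (nbhs p) --> Phi p.
  apply/cvgrPdist_le => del del0; have hb := near_ball_le p L0 del0.
  apply: filterS (filterI HL hb) => q [Lq bq] Aq; rewrite distrC.
  by rewrite (le_trans (Lq _)).
have hg1 : \forall q \near p, A q -> B (Phi q) ->
    `|f (Phi q) - f (Phi p) - lin k g (Phi q - Phi p)|
      <= eps / (2 * (L + 1)) * `|Phi q - Phi p|.
  exact: C _ (hg _ e1).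
have hD1 : \forall q \near p, forall i, A q ->
    `|co k i (Phi q) - co k i (Phi p) - lin c (D i) (q - p)|
      <= eps / (2 * (S + 1)) * `|q - p|.
  by apply: filter_forall => i; exact: hD.
near=> q => Aq.
have H1 : `|f (Phi q) - f (Phi p) - lin k g (Phi q - Phi p)|
    <= eps / (2 * (L + 1)) * `|Phi q - Phi p|.
  by apply: (near hg1 q) => //; apply: (near AB q).
have H2 := near hD1 q _; have H3 : `|Phi q - Phi p| <= L * `|q - p|.
  exact: (near HL q).
have -> : lin c (fun j => \sum_i g i * D i j) (q - p) =
    \sum_i g i * lin c (D i) (q - p).
  rewrite /lin; under eq_bigr do rewrite mulr_suml.
  rewrite exchange_big /=; apply: eq_bigr => i _; rewrite mulr_sumr.
  by apply: eq_bigr => j _; rewrite mulrA.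
rewrite -[X in `|X|](subrKA (lin k g (Phi q - Phi p))).
rewrite (le_trans (ler_normD _ _)) // [eps]splitr [X in _ <= X]mulrDl lerD //.
  rewrite (le_trans H1) //.
  rewrite (@le_trans _ _ (eps / (2 * (L + 1)) * (L * `|q - p|))) //.
    by rewrite ler_wpM2l // ltW.
  rewrite mulrA ler_wpM2r //.
  have -> : eps / 2 = eps / (2 * (L + 1)) * (L + 1).
    by field; rewrite gt_eqF // ltr_wpDl.
  by rewrite ler_wpM2l ?(ltW e1) // lerDl.
rewrite /lin -sumrB (le_trans (ler_norm_sum _ _ _)) //.
rewrite (@le_trans _ _ (\sum_i `|g i| * (eps / (2 * (S + 1)) * `|q - p|))) //.
  apply: ler_sum => i _; rewrite -mulrBr normrM ler_wpM2l // coB.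
  exact: H2.
rewrite -mulr_suml -/S mulrA ler_wpM2r //.
have -> : eps / 2 = (S + 1) * (eps / (2 * (S + 1))).
  by field; rewrite gt_eqF // ltr_wpDl.
by rewrite ler_wpM2r ?(ltW e2) // lerDl.
Unshelve. all: by end_near. Qed.

End Chain.

(** * Mean value theorems and gradients across a graph *)

Section MeanValue.
Variables (R : realType) (V : normedModType R).
Implicit Types (f : V -> R) (p u q : V).

Lemma is_derive_line f p u (s df : R) : is_derive (p + s *: u) u f df ->
  is_derive s 1 (fun s : R => f (p + s *: u)) df.
Proof.
move=> [dv <-].
have E : (fun h : R => h^-1 *: (((fun s => f (p + s *: u)) \o shift s)
     (h *: (1 : R^o)) - f (p + s *: u))) =
  (fun h : R => h^-1 *: ((f \o shift (p + s *: u)) (h *: u) - f (p + s *: u))).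
  apply/funext => h /=; congr (_ *: (f _ - _)).
  by rewrite [h *: 1]mulr1 scalerDl addrCA.
by apply: DeriveDef; [rewrite /derivable E|rewrite /derive E].
Qed.

Lemma mean_value_line f p u (df : V -> R) (h : R) :
  (forall s, 0 <= s <= 1 ->
     is_derive (p + (s * h) *: u) u f (df (p + (s * h) *: u))) ->
  exists2 s, 0 <= s <= 1 & f (p + h *: u) - f p = h * df (p + (s * h) *: u).
Proof.
have main p0 (l : R) : 0 < l -> (forall s, 0 <= s <= 1 ->
    is_derive (p0 + (s * l) *: u) u f (df (p0 + (s * l) *: u))) ->
  exists2 s, 0 <= s <= 1 &
    f (p0 + l *: u) - f p0 = l * df (p0 + (s * l) *: u).
  move=> l0 hd.
  have hd' x : x \in `[0, l]%R ->
      is_derive x 1 (fun s : R => f (p0 + s *: u)) (df (p0 + x *: u)).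
    rewrite in_itv /= => /andP[x0 xl]; apply: is_derive_line.
    have -> : x = (x / l) * l by rewrite divfK // gt_eqF.
    by apply: hd; apply/andP; split;
      [rewrite divr_ge0 // ltW|rewrite ler_pdivrMr // mul1r].
  have cts : {within `[0, l], continuous (fun s : R => f (p0 + s *: u))}.
    apply: derivable_within_continuous => x xl.
    by have [] := hd' _ xl.
  have hd2 x : x \in `]0, l[%R ->
      is_derive x 1 (fun s : R => f (p0 + s *: u)) (df (p0 + x *: u)).
    by move=> xl; apply: hd'; apply: subset_itv_oo_cc xl.
  have [x xl E] := MVT_segment (ltW l0) hd2 cts.
  exists (x / l).
    move: xl; rewrite in_itv /= => /andP[x0 xl].
    by apply/andP; split; [rewrite divr_ge0 // ltW|rewrite ler_pdivrMr // mul1r].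
  rewrite divfK ?gt_eqF // mulrC; move: E.
  by rewrite scale0r addr0 subr0.
move=> hd; have [h0|h0|->] := ltrgtP h 0; last first.
- by exists 0; [rewrite lexx ler01|rewrite scale0r addr0 subrr mul0r].
- exact: main.
have mh : 0 < - h by rewrite oppr_gt0.
have [s|s s01 E] := main (p + h *: u) (- h) mh _.
  move=> s01; rewrite -addrA -scalerDl.
  have -> : h + s * - h = (1 - s) * h by ring.
  by apply: hd; move: s01 => /andP[? ?]; apply/andP; split; lra.
exists (1 - s); first by move: s01 => /andP[? ?]; apply/andP; split; lra.
move: E; rewrite -!addrA -!scalerDl subrr scale0r addr0.
have -> : h + s * - h = (1 - s) * h by ring.
by move/(congr1 -%R); rewrite opprB mulNr opprK.
Qed.

End MeanValue.

Section Schwarz.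
Variables (R : realType) (V : normedModType R) (f fa fb fab fba : V -> R).
Variables (p a b : V).

(** The mean value theorem is applied first to [g (q + h *: w) - g q] along [u],
    then to [ga] along [w]. *)
Lemma double_difference (g ga gab : V -> R) (u w : V) (h : R) :
  (forall s s', 0 <= s <= 1 -> 0 <= s' <= 1 ->
     let q := p + (s * h) *: u + (s' * h) *: w in
     is_derive q u g (ga q) /\ is_derive q w ga (gab q)) ->
  exists s s', [/\ 0 <= s <= 1, 0 <= s' <= 1 &
    g (p + h *: u + h *: w) - g (p + h *: u) - (g (p + h *: w) - g p) =
    h * (h * gab (p + (s * h) *: u + (s' * h) *: w))].
Proof.
move=> hd.
have [s|s s01 E] := @mean_value_line R V (fun q => g (q + h *: w) - g q) p u
  (fun q => ga (q + h *: w) - ga q) h.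
  move=> s01.
  have d1 : is_derive (p + (s * h) *: u) u g (ga (p + (s * h) *: u)).
    have := (hd s 0 s01 _).1; rewrite mul0r scale0r addr0; apply.
    by rewrite lexx ler01.
  have d2 : is_derive (p + (s * h) *: u) u (fun q => g (q + h *: w))
      (ga (p + (s * h) *: u + h *: w)).
    have := (hd s 1 s01 _).1; rewrite mul1r ler01 lexx => /(_ isT).
    move=> [dv <-].
    have E : (fun k : R => k^-1 *: (((fun q => g (q + h *: w)) \o
          shift (p + (s * h) *: u)) (k *: u) - g (p + (s * h) *: u + h *: w))) =
      (fun k : R => k^-1 *: ((g \o shift (p + (s * h) *: u + h *: w)) (k *: u)
         - g (p + (s * h) *: u + h *: w))).
      by apply/funext => k /=; rewrite !addrA.
    by apply: DeriveDef; [rewrite /derivable E|rewrite /derive E].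
  exact: is_deriveB.
have [s'|s' s'01 E'] := @mean_value_line R V ga (p + (s * h) *: u) w gab h.
  by move=> s'01; exact: (hd s s' s01 s'01).2.
by exists s, s'; split=> //; rewrite -E' -E /=; ring.
Qed.

(** The double difference is symmetric in the two directions, and equals a value
    of either mixed derivative near [p]. *)
Lemma schwarz :
  (\forall q \near p, [/\ is_derive q a f (fa q), is_derive q b f (fb q),
      is_derive q b fa (fab q) & is_derive q a fb (fba q)]) ->
  {for p, continuous fab} -> {for p, continuous fba} -> fab p = fba p.
Proof.
move=> hd cab cba; apply/eqP; rewrite -subr_eq0 -normr_le0.
apply/ler_addgt0Pr => eps e0; rewrite add0r.
have e2 : 0 < eps / 2 by rewrite divr_gt0.
have nab : \forall q \near p, `|fab p - fab q| <= eps / 2.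
  by move/cvgrPdist_le: cab; exact.
have nba : \forall q \near p, `|fba p - fba q| <= eps / 2.
  by move/cvgrPdist_le: cba; exact.
have [del /= d0 H] := iffLR (@nbhs_ballP _ V p _) (filterI hd (filterI nab nba)).
pose M := `|a| + `|b| + 1.
have M0 : 0 < M by rewrite ltr_wpDl // addr_ge0.
pose h := del / (2 * M).
have h0 : 0 < h by rewrite divr_gt0 // mulr_gt0.
have inb (u w : V) (s s' : R) : 0 <= s <= 1 -> 0 <= s' <= 1 ->
    `|u| + `|w| + 1 = M ->
    ball p del (p + (s * h) *: u + (s' * h) *: w).
  move=> /andP[s0 s1] /andP[s'0 s'1] EM; rewrite -ball_normE /ball_ /=.
  rewrite -addrA opprD addNKr normrN (le_lt_trans (ler_normD _ _)) //.
  have hs : 0 <= s * h by rewrite mulr_ge0 // ltW.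
  have hs' : 0 <= s' * h by rewrite mulr_ge0 // ltW.
  rewrite (normrZ (s * h) u) (normrZ (s' * h) w) (ger0_norm hs) (ger0_norm hs').
  rewrite (@le_lt_trans _ _ (h * `|u| + h * `|w|)) //.
    by apply: lerD; rewrite ler_wpM2r // ler_piMl // ltW.
  rewrite -mulrDr (@lt_le_trans _ _ (h * (2 * M))) //.
    rewrite ltr_pM2l // -EM.
    by have := normr_ge0 u; have := normr_ge0 w; lra.
  by rewrite /h divfK // gt_eqF // mulr_gt0.
have [s [s' [s01 s'01 E]]] := @double_difference f fa fab a b h
  (fun s s' s01 s'01 => let: And4 h1 _ h3 _ := (H _ (inb a b s s' s01 s'01 erefl)).1
     in conj h1 h3).
have EM : `|b| + `|a| + 1 = M by rewrite [`|b| + _]addrC.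
have [r [r' [r01 r'01 E']]] := @double_difference f fb fba b a h
  (fun s s' s01 s'01 => let: And4 _ h1 _ h3 := (H _ (inb b a s s' s01 s'01 EM)).1
     in conj h1 h3).
have [_ [H1 _]] := H _ (inb a b s s' s01 s'01 erefl).
have [_ [_ H2]] := H _ (inb b a r r' r01 r'01 EM).
have EE : fab (p + (s * h) *: a + (s' * h) *: b) =
    fba (p + (r * h) *: b + (r' * h) *: a).
  apply: (mulfI (lt0r_neq0 h0)); apply: (mulfI (lt0r_neq0 h0)).
  rewrite -E -E' -[p + h *: b + h *: a]addrA [h *: b + _]addrC addrA; ring.
rewrite [eps]splitr.
have -> : fab p - fba p = (fab p - fab (p + (s * h) *: a + (s' * h) *: b))
   - (fba p - fba (p + (r * h) *: b + (r' * h) *: a)) by rewrite EE; ring.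
by rewrite (le_trans (ler_normB _ _)) // lerD.
Qed.

End Schwarz.

Section Criterion.
Variables (R : realType) (V : normedModType R) (J : finType) (e : J -> V).
Variables (c : coords e) (S : set V).
Hypothesis SS : forall p, S p -> ProperFilter (within S° (nbhs p)).

Lemma within_interior_cvg (g : V -> R) p : g @ within S (nbhs p) --> g p ->
  g @ within S° (nbhs p) --> g p.
Proof.
move=> h; apply: cvg_trans h; apply: cvg_app; apply: within_subset.
exact: interior_subset.
Qed.

(** Relative differentiability with a continuous gradient is what [Ck_on]
    asks for; the limits defining [pderiv] are then the gradient. *)
Lemma C1_of_hasgrad (f : V -> R) (G : J -> V -> R) :
  (forall p, S p -> hasgrad c S f p (G^~ p)) ->
  (forall j p, S p -> G j @ within S (nbhs p) --> G j p) ->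
  Ck_on e S 1 f /\ forall j p, S p -> pderiv e S j f p = G j p.
Proof.
move=> hf hG.
have der p j : S° p -> is_derive p (e j) f (G j p).
  move=> Sp; apply: (@hasgrad_is_derive _ _ _ _ c S f p (G^~ p)) => //.
  by apply: hf; exact: interior_subset.
have cv j p : S p -> 'D_(e j) f @ within S° (nbhs p) --> G j p.
  move=> Sp; apply: cvg_trans (within_interior_cvg (hG j p Sp)).
  apply: near_eq_cvg; rewrite near_withinE; near=> q => Sq.
  by have [_ ->] := der q j Sq.
have pd j p : S p -> pderiv e S j f p = G j p.
  by move=> Sp; have := SS Sp => PF; apply/cvg_lim; [|exact: cv].
split=> //; split; first by apply/subspace_continuousP => p /hf/hasgrad_cvg.
move=> j; split; last first.
  split=> //; apply/subspace_continuousP => p Sp.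
  have := hG j p Sp; rewrite -[X in _ --> X](pd j p Sp) => h.
  apply: cvg_trans h; apply: near_eq_cvg.
  by rewrite near_withinE; near=> q => Sq; rewrite -(pd j q Sq).
split=> p Sp; first by have [] := der p j Sp.
by apply/cvg_ex; exists (G j p); exact: cv.
Unshelve. all: by end_near. Qed.

End Criterion.

Section Matching.
Variables (R : realType) (V : normedModType R) (J : finType) (e : J -> V).
Variables (c : coords e).

(** Two pieces that coincide on the graph of [T] over the remaining coordinates
    have the same derivatives along curves in this graph.  The graph is
    transversal to [e j0], so the derivative in this one direction decides
    whether the full gradients agree. *)
Lemma hasgrad_match (A B : set V) (f f' T : V -> R) p (g g' tau : J -> R) j0 :
  hasgrad c A f p g -> hasgrad c B f' p g' -> hasgrad c setT T p tau ->
  (forall q a, T (q + a *: e j0) = T q) -> co c j0 p = T p ->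
  f p = f' p ->
  (\forall q \near p, co c j0 q = T q -> [/\ A q, B q & f q = f' q]) ->
  g j0 = g' j0 -> forall j, g j = g' j.
Proof.
move=> hf hf' hT Tt Tp fp near0 g0 j.
have [->//|jj0] := eqVneq j j0.
have [L L0 HL] := hasgrad_lip hT.
pose M := `|e j| + L * `|e j| * `|e j0|.
have M0 : 0 <= M by rewrite addr_ge0 // !mulr_ge0.
(* The line in direction [e j], lifted along [e j0] to the graph; as [T] is
   Lipschitz at [p], the curve stays at distance [M * `|h|] from [p]. *)
pose cv (h : R) := p + h *: e j + (T (p + h *: e j) - T p) *: e j0.
have line : (fun h : R => p + h *: e j) @ 0 --> p.
  have : (fun h : R => p + h *: e j) @ 0 --> p + 0 *: e j.
    by apply: cvgD; [exact: cvg_cst|apply: cvgZr_tmp; exact: cvg_id].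
  by rewrite scale0r addr0.
have cvB h : cv h - p = h *: e j + (T (p + h *: e j) - T p) *: e j0.
  by rewrite /cv addrC addrA addKr.
have cvM : \forall h \near (0 : R), `|cv h - p| <= M * `|h|.
  have HL' : \forall h \near (0 : R), setT (p + h *: e j) ->
     `|T (p + h *: e j) - T p| <= L * `|p + h *: e j - p| := line _ HL.
  apply: filterS HL' => h /(_ I) HT.
  rewrite cvB (le_trans (ler_normD _ _)) // mulrDl lerD //.
    by rewrite normrZ mulrC.
  rewrite normrZ mulrAC ler_wpM2r // -mulrA [`|e j| * _]mulrC -normrZ.
  by rewrite [p + _]addrC addrK in HT *.
have cvp : cv @ 0 --> p.
  apply/cvgrPdist_le => eps e0.
  have hb := near_ball_le (0 : R) M0 e0.
  apply: filterS (filterI cvM hb) => h [H1]; rewrite subr0 => H2.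
  by rewrite distrC (le_trans H1).
apply/eqP; rewrite -subr_eq0 -normr_le0; apply/ler_addgt0Pr => eps e0.
rewrite add0r.
have e1 : 0 < eps / (2 * (M + 1)) by rewrite divr_gt0 // mulr_gt0 // ltr_wpDl.
have Tcv h : co c j0 (cv h) = T (cv h).
  rewrite /cv Tt coD coD !coZ !co_e eqxx mulr1 eq_sym (negbTE jj0) mulr0 addr0.
  by rewrite Tp addrC subrK.
have n1 : \forall h \near (0 : R), co c j0 (cv h) = T (cv h) ->
  [/\ A (cv h), B (cv h) & f (cv h) = f' (cv h)] := cvp _ near0.
have n2 : \forall h \near (0 : R), A (cv h) ->
  `|f (cv h) - f p - lin c g (cv h - p)| <= eps / (2 * (M + 1)) * `|cv h - p|
  := cvp _ (hf _ e1).
have n3 : \forall h \near (0 : R), B (cv h) ->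
  `|f' (cv h) - f' p - lin c g' (cv h - p)| <= eps / (2 * (M + 1)) * `|cv h - p|
  := cvp _ (hf' _ e1).
have [h [hn0 cM ff' H1 H2]] : exists h, [/\ h != 0,
   `|cv h - p| <= M * `|h|, f (cv h) = f' (cv h),
    `|f (cv h) - f p - lin c g (cv h - p)| <=
       eps / (2 * (M + 1)) * `|cv h - p| &
    `|f' (cv h) - f' p - lin c g' (cv h - p)| <=
       eps / (2 * (M + 1)) * `|cv h - p|].
  apply: (@filter_ex _ (0 : R)^').
  apply: filterS (filterI (nbhs_dnbhs_neq (0 : R))
    (nbhs_dnbhs (filterI cvM (filterI n1 (filterI n2 n3))))).
  move=> h [hn0 [cM [/(_ (Tcv h))[Ah Bh fh] [n2h n3h]]]].
  by split=> //; [exact: n2h|exact: n3h].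
have E : lin c g (cv h - p) - lin c g' (cv h - p) = h * (g j - g' j).
  by rewrite cvB !linD !linZ !lin_e g0; ring.
have E2 : h * (g j - g' j) = (f' (cv h) - f' p - lin c g' (cv h - p)) -
    (f (cv h) - f p - lin c g (cv h - p)) by rewrite -E ff' fp; ring.
have : `|h| * `|g j - g' j| <= `|h| * eps.
  rewrite -normrM E2 (le_trans (ler_normB _ _)) // (le_trans (lerD H2 H1)) //.
  rewrite -mulrDl (le_trans (ler_wpM2l _ cM)) ?addr_ge0 ?(ltW e1) //.
  have -> : (eps / (2 * (M + 1)) + eps / (2 * (M + 1))) * (M * `|h|) =
     (`|h| * eps) * (M / (M + 1)) by field; rewrite gt_eqF // ltr_wpDl.
  rewrite ler_piMr ?mulr_ge0 ?(ltW e0) //.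
  by rewrite ler_pdivrMr ?ltr_wpDl // mul1r lerDl.
by rewrite ler_pM2l // normr_gt0.
Unshelve. all: by end_near. Qed.

End Matching.

(** * Calculus on the closed phase space *)

Section PhaseCoordinates.
Variable R : realType.
Local Notation vec := 'cV[R]_2.
Local Notation phase := ('cV[R]_2 * 'cV[R]_2)%type.
Implicit Types (x v u w : vec) (p q : phase).

Lemma sum2 (V : nmodType) (F : 'I_2 -> V) : \sum_(i < 2) F i = F 0 + F 1.
Proof. by rewrite big_ord_recl big_ord_recl big_ord0 addr0; congr (_ + F _); apply/val_inj. Qed.

Lemma ord2 (i : 'I_2) : i = 0 \/ i = 1.
Proof.
by case: i => [[|[|//]] ?]; [left|right]; apply/val_inj.
Qed.

Lemma vec_eq u w : u 0 0 = w 0 0 -> u 1 0 = w 1 0 -> u = w.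
Proof.
by move=> h0 h1; apply/matrixP => i j; rewrite ord1; have [->|->] := ord2 i.
Qed.

Lemma dotE u w : dot u w = u 0 0 * w 0 0 + u 1 0 * w 1 0.
Proof. by rewrite /dot !mxE sum2 !mxE. Qed.

Lemma dotC u w : dot u w = dot w u.
Proof. by rewrite !dotE; ring. Qed.

Lemma dot_ge0 u : 0 <= dot u u.
Proof. by rewrite dotE addr_ge0 // -expr2 sqr_ge0. Qed.

Lemma enorm2 u : enorm u ^+ 2 = dot u u.
Proof. by rewrite sqr_sqrtr // dot_ge0. Qed.

Lemma enorm_ge0 u : 0 <= enorm u.
Proof. exact: sqrtr_ge0. Qed.

Lemma dot_eq0 u : (dot u u == 0) = (u == 0).
Proof.
apply/idP/eqP => [|->]; last by rewrite dotE !mxE !mul0r addr0.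
rewrite dotE paddr_eq0 -?expr2 ?sqr_ge0 // !sqrf_eq0 => /andP[/eqP h0 /eqP h1].
by apply: vec_eq; rewrite !mxE.
Qed.

Lemma enorm_gt0 u : (0 < enorm u) = (u != 0).
Proof. by rewrite sqrtr_gt0 lt_def dot_ge0 andbT dot_eq0. Qed.

Lemma discE x : disc x = (dot x x < 1) :> Prop.
Proof. by rewrite /disc /= /enorm -{1}sqrtr1 ltr_sqrt. Qed.

Lemma cdiscE x : cdisc x = (dot x x <= 1) :> Prop.
Proof. by rewrite /cdisc /= /enorm -{1}sqrtr1 ler_sqrt // ler01. Qed.

Lemma circleE x : circle x <-> dot x x = 1.
Proof.
rewrite /circle /= /enorm; split=> [h|->]; last exact: sqrtr1.
by rewrite -enorm2 /enorm h expr1n.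
Qed.

Lemma vec_norm_le u i : `|u i 0| <= `|u|.
Proof.
rewrite [leRHS]/Num.norm /= mx_normrE.
exact: (@le_bigmax _ _ _ _ (fun ij : 'I_2 * 'I_1 => `|u ij.1 ij.2|) (i, 0)).
Qed.

Lemma norm_vec_le u (M : R) : 0 <= M -> (forall i, `|u i 0| <= M) -> `|u| <= M.
Proof.
move=> M0 h; rewrite [leLHS]/Num.norm /= mx_normrE; apply/bigmax_leP; split=> //.
by move=> [i j] _ /=; rewrite ord1.
Qed.

Definition cophase (j : 'I_2 + 'I_2) p : R :=
  match j with inl i => p.1 i 0 | inr i => p.2 i 0 end.

Fact cophase_lin j a p q : cophase j (a *: p + q) = a * cophase j p + cophase j q.
Proof. by case: j => i; rewrite /= !mxE. Qed.

Fact cophase_le j p : `|cophase j p| <= `|p|.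
Proof.
rewrite prod_normE; case: j => i /=; rewrite le_max vec_norm_le ?orbT //.
Qed.

Fact norm_cophase p (M : R) : (forall j, `|cophase j p| <= M) -> 0 <= M -> `|p| <= M.
Proof.
move=> h M0; rewrite prod_normE ge_max !norm_vec_le // => i.
- exact: (h (inr i)).
- exact: (h (inl i)).
Qed.

Fact cophase_e i j : cophase i (phase_dir R j) = (i == j)%:R.
Proof. by case: i j => [i|i] [j|j]; rewrite /= ?mxE ?eqxx ?andbT. Qed.

Definition phase_coords : coords (@phase_dir R) :=
  Coords cophase_lin cophase_le norm_cophase cophase_e.

Definition cotime (j : option ('I_2 + 'I_2)) (z : R * phase) : R :=
  if j is Some j' then cophase j' z.2 else z.1.

Fact cotime_lin j a z y : cotime j (a *: z + y) = a * cotime j z + cotime j y.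
Proof. by case: j => [j|] //=; rewrite cophase_lin. Qed.

Fact cotime_le j z : `|cotime j z| <= `|z|.
Proof.
rewrite prod_normE le_max; case: j => [j|] /=; last by rewrite lexx.
by rewrite cophase_le orbT.
Qed.

Fact norm_cotime z (M : R) : (forall j, `|cotime j z| <= M) -> 0 <= M -> `|z| <= M.
Proof.
move=> h M0; rewrite prod_normE ge_max (h None) norm_cophase // => j.
exact: (h (Some j)).
Qed.

Fact cotime_e i j : cotime i (time_dir R j) = (i == j)%:R.
Proof.
case: i j => [i|] [j|] //=; first by rewrite cophase_e.
by case: i => i; rewrite /= mxE.
Qed.

Definition time_coords : coords (@time_dir R) :=
  Coords cotime_lin cotime_le norm_cotime cotime_e.

Lemma disc_near p : disc p.1 -> \forall q \near p, disc q.1.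
Proof.
rewrite discE dotE => h.
have hg i := hasgrad_co phase_coords setT i p.
have := hasgrad_cvg (hasgradD (hasgradM (hg (inl 0)) (hg (inl 0)))
                              (hasgradM (hg (inl 1)) (hg (inl 1)))).
rewrite withinET => /cvgr_lt /(_ _ h); apply: filterS => q /=.
by rewrite discE dotE.
Qed.

Lemma disc_interior p : disc p.1 -> (@phase_dom R)° p.
Proof.
move=> /disc_near; apply: filterS => q.
by rewrite discE /phase_dom /= cdiscE; exact: ltW.
Qed.

Lemma disc_conv x y (s : R) : 0 <= s <= 1 -> disc x -> disc (x + y) ->
  disc (x + s *: y).
Proof.
rewrite !discE !dotE !mxE => /andP[s0 s1] h h'.
have [->|sn1] := eqVneq s 1; first by rewrite !mul1r.
have t0 : 0 < 1 - s by rewrite subr_gt0 lt_neqAle sn1.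
have := mulr_ge0 (mulr_ge0 s0 (ltW t0))
  (addr_ge0 (sqr_ge0 (y 0 0)) (sqr_ge0 (y 1 0))).
have := mulr_gt0 t0 (_ : 0 < 1 - (x 0 0 * x 0 0 + x 1 0 * x 1 0)).
rewrite subr_gt0 => /(_ h).
have := mulr_ge0 s0 (_ : 0 <= 1 - ((x 0 0 + y 0 0) * (x 0 0 + y 0 0) +
  (x 1 0 + y 1 0) * (x 1 0 + y 1 0))).
rewrite subr_ge0 => /(_ (ltW h')).
lra.
Qed.

(** Contraction towards the centre of the disc: it moves the closed phase space
    into its interior. *)
Definition shrink (s : R) p : phase := (s *: p.1, p.2).

Lemma shrink_disc (s : R) p : 0 <= s < 1 -> phase_dom p -> disc (shrink s p).1.
Proof.
rewrite discE /phase_dom /= cdiscE !dotE !mxE => /andP[s0 s1] h.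
have := sqr_ge0 (p.1 0 0); have := sqr_ge0 (p.1 1 0).
have := mulr_ge0 s0 s0; have : s * s < 1 by nra.
move=> *; nra.
Qed.

Lemma shrink_cvg p : shrink^~ p @ (1 : R)^'- --> p.
Proof.
apply: cvg_trans (_ : shrink^~ p @ (1 : R) --> p).
  by apply: cvg_app; exact: cvg_within.
have h1 : (fun s => s *: p.1) @ (1 : R) --> p.1.
  rewrite -[X in _ --> X]scale1r; apply: cvgZr_tmp; exact: cvg_id.
have h2 : (fun=> p.2) @ (1 : R) --> p.2 by exact: cvg_cst.
by case: p h1 h2 => x v h1 h2; exact: cvg_pair h1 h2.
Qed.

Lemma near1_itv : \forall s \near (1 : R)^'-, 0 <= s < 1.
Proof.
near=> s; apply/andP; split; last by near: s; exact: nbhs_left_lt.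
by near: s; apply: nbhs_left_ge; exact: ltr01.
Unshelve. all: by end_near. Qed.

Lemma cvg_to_within (T : Type) (U : topologicalType) (F : set_system T)
    {FF : Filter F} (h : T -> U) (D : set U) (a : U) :
  h @ F --> a -> (\forall s \near F, D (h s)) -> h @ F --> within D (nbhs a).
Proof.
move=> ha hD P hP; have {}hP : \forall s \near F, D (h s) -> P (h s) := ha _ hP.
suff : \forall s \near F, P (h s) by [].
by apply: filterS2 hD hP => s; auto.
Qed.

Lemma shrink_cvg_within p : phase_dom p ->
  shrink^~ p @ (1 : R)^'- --> within (@phase_dom R) (nbhs p).
Proof.
move=> hp; apply: cvg_to_within; first exact: shrink_cvg.
apply: filterS near1_itv => s hs; have := shrink_disc hs hp.
by rewrite discE /phase_dom /= cdiscE => /ltW.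
Qed.

Lemma shrink_cvg_interior p : phase_dom p ->
  shrink^~ p @ (1 : R)^'- --> within (@phase_dom R)° (nbhs p).
Proof.
move=> hp; apply: cvg_to_within; first exact: shrink_cvg.
by apply: filterS near1_itv => s hs; apply/disc_interior/shrink_disc.
Qed.

Lemma phase_dom_proper p : phase_dom p ->
  ProperFilter (within (@phase_dom R)° (nbhs p)).
Proof.
move=> hp; have h := shrink_cvg_interior hp.
split; last exact: within_filter.
move=> h0; have := h _ h0.
exact: (@filter_not_empty _ (1 : R)^'-).
Qed.

End PhaseCoordinates.

Section Datum.
Variable R : realType.
Local Notation phase := ('cV[R]_2 * 'cV[R]_2)%type.
Local Notation cc := (phase_coords R).
Local Notation co := (co cc).
Local Notation pd := (pderiv (@phase_dir R) (@phase_dom R)).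
Implicit Types (p q : phase) (f : phase -> R).

Section MeanValuePhase.
Variables (f : phase -> R) (p : phase) (g : 'I_2 + 'I_2 -> R) (del eps : R).
Let U := [set q : phase | disc q.1 /\ `|q - p| <= del].
Hypothesis derU : forall q, U q -> forall j, exists2 d : R,
  is_derive q (phase_dir R j) f d & `|d - g j| <= eps.

(** The error of the linear approximation of [f] with frozen gradient [g] is
    additive along polygonal paths. *)
Let inc (q q' : phase) (b : R) := `|f q' - f q - lin cc g (q' - q)| <= b.

Lemma inc_trans q q' q'' b b' : inc q q' b -> inc q' q'' b' -> inc q q'' (b + b').
Proof.
rewrite /inc => h h'.
have -> : f q'' - f q - lin cc g (q'' - q) =
   (f q'' - f q' - lin cc g (q'' - q')) + (f q' - f q - lin cc g (q' - q)).
  by rewrite !linB; ring.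
by rewrite (le_trans (ler_normD _ _)) // addrC lerD.
Qed.

Lemma U_conv q (u : phase) (s : R) : 0 <= s <= 1 -> U q -> U (q + u) ->
  U (q + s *: u).
Proof.
move=> s01 [dq nq] [du nu]; split; first exact: disc_conv.
have -> : q + s *: u - p = (1 - s) *: (q - p) + s *: (q + u - p).
  apply: (@co_inj _ _ _ _ cc) => j.
  by rewrite !(coD, coN, coZ, coB); ring.
have /andP[s0 s1] := s01.
rewrite (le_trans (ler_normD _ _)) // !normrZ ger0_norm ?subr_ge0 //.
by rewrite (ger0_norm s0); nra.
Qed.

Lemma axis_move q j (h : R) : U q -> U (q + h *: phase_dir R j) ->
  inc q (q + h *: phase_dir R j) (eps * `|h|).
Proof.
move=> Uq Uq'.
have Us s : 0 <= s <= 1 -> U (q + (s * h) *: phase_dir R j).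
  by move=> s01; rewrite -scalerA; exact: U_conv.
have /choice[df hdf] : forall y : phase, exists d : R,
   U y -> is_derive y (phase_dir R j) f d /\ `|d - g j| <= eps.
  move=> y; case: (pselect (U y)) => [Uy|nUy]; last by exists 0.
  by have [d ? ?] := derU Uy j; exists d.
have [s|s s01 E] := @mean_value_line R _ f q (phase_dir R j) df h.
  by move=> s01; exact: (hdf _ (Us s s01)).1.
rewrite /inc E [q + _]addrC addrK linZ lin_e -mulrBr normrM mulrC.
by rewrite ler_wpM2r // (hdf _ (Us s s01)).2.
Qed.

Let upd q j (a : R) : phase := q + (a - co j q) *: phase_dir R j.

Lemma co_upd i q j a : co i (upd q j a) = if i == j then a else co i q.
Proof.
rewrite coD coZ co_e; case: eqVneq => [->|_]; first by rewrite mulr1 addrC subrK.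
by rewrite mulr0 addr0.
Qed.

Lemma upd_x q i a : (upd q (inr i) a).1 = q.1.
Proof. by rewrite /upd /= scaler0 addr0. Qed.

(** Partial derivatives are integrated along axis-parallel segments, which must
    not leave the disc; in the plane it suffices that the corner of the path
    from [q] to [q'] lies in it. *)
Lemma inc_corner q q' (a b : 'I_2) : a != b -> U q -> U q' ->
  disc (upd q (inl a) (co (inl a) q')).1 -> inc q q' (4 * eps * `|q' - q|).
Proof.
move=> ab Uq Uq' dw.
have ord_ab i : i = a \/ i = b.
  by move: ab; have [->|->] := ord2 i; have [->|->] := ord2 a;
    have [->|->] := ord2 b; rewrite ?eqxx //; auto.
have del0 : 0 <= del by exact: le_trans (normr_ge0 _) Uq.2.
pose w1 := upd q (inl a) (co (inl a) q').
pose w2 := upd w1 (inl b) (co (inl b) q').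
pose w3 := upd w2 (inr 0) (co (inr 0) q').
pose w4 := upd w3 (inr 1) (co (inr 1) q').
have cq j : `|co j (q - p)| <= del by rewrite (le_trans (co_le _ _ _)) // Uq.2.
have cq' j : `|co j (q' - p)| <= del by rewrite (le_trans (co_le _ _ _)) // Uq'.2.
have Uupd w j : U w -> disc (upd w j (co j q')).1 -> U (upd w j (co j q')).
  move=> [dw' nw] d; split=> //; apply: (norm_co (c := cc)) => // i.
  rewrite coB co_upd; case: eqVneq => [->|_]; first by rewrite -coB.
  by rewrite -coB (le_trans (co_le _ _ _)).
have x12 : w2.1 = q'.1.
  have h i : co (inl i) w2 = co (inl i) q'.
    rewrite /w2 /w1 !co_upd; case: eqVneq => [->//|].
    by have [->|->] := ord_ab i; rewrite ?eqxx.
  by apply: vec_eq; [exact: (h 0)|exact: (h 1)].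
have x3 : w3.1 = w2.1 by exact: upd_x.
have x4 : w4.1 = w3.1 by exact: upd_x.
have w4q : w4 = q'.
  apply: (@co_inj _ _ _ _ cc) => -[i|i].
    suff : w4.1 i 0 = q'.1 i 0 by [].
    by rewrite x4 x3 x12.
  rewrite /w4 /w3 !co_upd; case: eqVneq => [->//|].
  by have [->|->] := ord2 i; rewrite ?eqxx.
have U1 : U w1 by exact: Uupd.
have U2 : U w2 by apply: Uupd => //; rewrite -/w2 x12; exact: Uq'.1.
have U3 : U w3 by apply: Uupd => //; rewrite -/w3 x3 x12; exact: Uq'.1.
have eps0 : 0 <= eps.
  by have [d _ h] := derU Uq (inl 0); exact: le_trans (normr_ge0 _) h.
have step w j : U w -> U (upd w j (co j q')) -> co j w = co j q ->
    inc w (upd w j (co j q')) (eps * `|q' - q|).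
  move=> Uw Uw' E; apply: le_trans (axis_move Uw Uw') _.
  by rewrite E -coB ler_wpM2l // co_le.
have -> : 4 * eps * `|q' - q| = eps * `|q' - q| + eps * `|q' - q| +
    (eps * `|q' - q| + eps * `|q' - q|) by ring.
apply: (@inc_trans _ w2); [apply: (@inc_trans _ w1)|apply: (@inc_trans _ w3)].
- exact: step.
- by apply: step => //; rewrite /w1 co_upd; case: eqP => // -[ba]; rewrite ba eqxx in ab.
- by apply: step => //; rewrite /w2 /w1 !co_upd.
- rewrite -w4q; have : inc w3 (upd w3 (inr 1) (co (inr 1) q')) (eps * `|q' - q|).
    apply: step => //; first by rewrite -/w4 w4q.
    by rewrite /w3 /w2 /w1 !co_upd.
  by rewrite -/w4 w4q.
Qed.

Lemma mean_value_phase q q' : U q -> U q' ->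
  `|f q' - f q - lin cc g (q' - q)| <= 4 * eps * `|q' - q|.
Proof.
move=> Uq Uq'.
(* One of the two corners lies in the disc: the squares of their norms add up
   to those of [q] and [q']. *)
have /orP[h|h] : (q'.1 0 0 * q'.1 0 0 + q.1 1 0 * q.1 1 0 < 1) ||
    (q.1 0 0 * q.1 0 0 + q'.1 1 0 * q'.1 1 0 < 1).
  have := Uq.1; have := Uq'.1; rewrite !discE !dotE => h h'.
  by rewrite -implyNb -leNgt; apply/implyP => ?; lra.
- apply: (@inc_corner q q' 0 1) => //; rewrite discE dotE.
  have E i := co_upd (inl i) q (inl 0) (co (inl 0) q').
  by have := E 0; have := E 1; rewrite /= => -> ->.
- apply: (@inc_corner q q' 1 0) => //; rewrite discE dotE.
  have E i := co_upd (inl i) q (inl 1) (co (inl 1) q').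
  by have := E 0; have := E 1; rewrite /= => -> ->.
Qed.

End MeanValuePhase.

Lemma C1_continuous k f p : Ck_on (@phase_dir R) (@phase_dom R) k f ->
  phase_dom p -> f @ within (@phase_dom R) (nbhs p) --> f p.
Proof. by case: k => [|k] [/subspace_continuousP + _]; exact. Qed.

Lemma lin_cvg (T : Type) (F : set_system T) {FF : Filter F} (h : T -> phase)
    (g : 'I_2 + 'I_2 -> R) p : h @ F --> p ->
  (fun s => lin cc g (h s)) @ F --> lin cc g p.
Proof.
move=> hp; apply: cvg_comp hp _.
have : hasgrad cc setT (fun q => lin cc g q) p g.
  move=> e e0; near=> q => _; rewrite -linB subrr normr0.
  by rewrite mulr_ge0 // ltW.
by move=> /hasgrad_cvg; rewrite withinET.
Unshelve. all: by end_near. Qed.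

(** Inside the disc this is the mean value inequality.  At boundary points both
    arguments are contracted into the disc, and the inequality passes to the
    limit. *)
Lemma hasgrad_phase f : Ck_on (@phase_dir R) (@phase_dom R) 1 f ->
  forall p, phase_dom p -> hasgrad cc (@phase_dom R) f p (fun j => pd j f p).
Proof.
move=> C1f p hp eps e0.
have e8 : 0 < eps / 4 by rewrite divr_gt0.
have nearD : \forall q \near p, disc q.1 -> forall j, exists2 d : R,
  is_derive q (phase_dir R j) f d & `|d - pd j f p| <= eps / 4.
  have H j : \forall q \near p, (@phase_dom R)° q ->
      `|pd j f p - 'D_(phase_dir R j) f q| <= eps / 4.
    have [[_ cv] _] := C1f.2 j; have := cv _ hp.
    have := phase_dom_proper hp => PF.
    by move=> /cvg_lim => H; have /cvgrPdist_le/(_ _ e8) := cv _ hp.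
  have {}H : \forall q \near p, forall j, (@phase_dom R)° q ->
      `|pd j f p - 'D_(phase_dir R j) f q| <= eps / 4.
    exact: (@filter_forall phase ('I_2 + 'I_2)%type
      (fun j q => (@phase_dom R)° q ->
        `|pd j f p - 'D_(phase_dir R j) f q| <= eps / 4) _ (nbhs_filter p) H).
  apply: filterS H => q H dq j; exists ('D_(phase_dir R j) f q).
    apply: DeriveDef => //; have [[dj _] _] := C1f.2 j.
    by apply: dj; exact: disc_interior.
  by rewrite distrC; apply: H; exact: disc_interior.
have [del /= d0 HD] := iffLR (@nbhs_ballP _ _ p _) nearD.
have d2 : 0 < del / 2 by rewrite divr_gt0.
have derU q : disc q.1 /\ `|q - p| <= del / 2 -> forall j, exists2 d : R,
    is_derive q (phase_dir R j) f d & `|d - pd j f p| <= eps / 4.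
  move=> [dq nq]; apply: HD => //; rewrite -ball_normE /ball_ /= distrC.
  by rewrite (le_lt_trans nq) // ltr_pdivrMr // ltr_pMr // ltr1n.
have n4 : \forall q \near p, `|q - p| < del / 2.
  near=> q; rewrite distrC; near: q; exact: cvgr_dist_lt.
near=> q => hq.
have nq : `|q - p| < del / 2 by exact: (near n4 q).
have sub (s : R) : shrink s q - shrink s p = shrink s (q - p).
  by rewrite /shrink /= scalerBr.
have shr_le (s : R) (y : phase) : 0 <= s < 1 -> `|shrink s y| <= `|y|.
  move=> /andP[s0 s1]; rewrite !prod_normE /= normrZ (ger0_norm s0).
  by rewrite ge_max !le_max lexx orbT andbT ler_piMl // ltW.
have nsq (y : phase) : phase_dom y -> `|y - p| < del / 2 ->
   \forall s \near (1 : R)^'-, disc (shrink s y).1 /\ `|shrink s y - p| <= del / 2.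
  move=> hy ny; near=> s; split.
    by apply: shrink_disc => //; near: s; exact: near1_itv.
  apply: ltW; near: s.
  have : (fun s => `|shrink s y - p|) @ (1 : R)^'- --> `|y - p|.
    by apply: cvg_norm; apply: cvgB; [exact: shrink_cvg|exact: cvg_cst].
  by move=> /cvgr_lt; apply.
have np : `|p - p| < del / 2 by rewrite subrr normr0.
pose D (s : R) := `|f (shrink s q) - f (shrink s p) -
   lin cc (fun j => pd j f p) (shrink s q - shrink s p)|.
have Dcvg : D s @[s --> (1 : R)^'-] -->
    `|f q - f p - lin cc (fun j => pd j f p) (q - p)|.
  have fc y : phase_dom y -> (fun s => f (shrink s y)) @ (1 : R)^'- --> f y.
    move=> hy; apply: cvg_comp (C1_continuous C1f hy).
    exact: shrink_cvg_within.
  apply: cvg_norm; apply: cvgB; first by apply: cvgB; exact: fc.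
  by apply: lin_cvg; apply: cvgB; exact: shrink_cvg.
apply: (@cvgr_to_le _ _ _ _ _ _ _ Dcvg).
near=> s.
have s01 : 0 <= s < 1 by near: s; exact: near1_itv.
rewrite /D (le_trans (mean_value_phase derU _ _)) //.
- by near: s; exact: nsq.
- by near: s; exact: nsq.
- rewrite mulrCA divff // mulr1 ler_wpM2l ?(ltW e0) // sub.
  exact: shr_le.
Unshelve. all: by end_near. Qed.

(** Schwarz inside the disc, and limits from the inside on its boundary. *)
Lemma pderiv_symm f : Ck_on (@phase_dir R) (@phase_dom R) 2 f ->
  forall i j p, phase_dom p -> pd i (pd j f) p = pd j (pd i f) p.
Proof.
move=> C2f i j.
have C1f : Ck_on (@phase_dir R) (@phase_dom R) 1 f.
  split=> [|k]; first exact: C2f.1.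
  have [pk ck] := C2f.2 k; split=> //; split=> //; exact: ck.1.
have C1pd k := (C2f.2 k).2.
have C0 k l p : phase_dom p ->
    pd k (pd l f) @ within (@phase_dom R) (nbhs p) --> pd k (pd l f) p.
  by move=> hp; exact: (C1_continuous (k := 0%N) ((C1pd l).2 k).2 hp).
have int p : disc p.1 -> pd i (pd j f) p = pd j (pd i f) p.
  move=> dp.
  have dom (y : phase) : disc y.1 -> phase_dom y.
    by rewrite discE /phase_dom /= cdiscE => /ltW.
  have der (h : phase -> R) y k : Ck_on (@phase_dir R) (@phase_dom R) 1 h ->
      disc y.1 -> is_derive y (phase_dir R k) h (pd k h y).
    move=> C1h dy.
    apply: (@hasgrad_is_derive _ _ _ _ cc (@phase_dom R) h y
      (fun j => pd j h y)); first exact: disc_interior.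
    by apply: hasgrad_phase => //; exact: dom.
  have cont k l : {for p, continuous (pd k (pd l f))}.
    have := C0 k l p (dom _ dp).
    by rewrite within_interior //; exact: disc_interior.
  apply: (@schwarz R phase f (pd j f) (pd i f) (pd i (pd j f)) (pd j (pd i f)) p
    (phase_dir R j) (phase_dir R i) _ (cont i j) (cont j i)).
  apply: filterS (disc_near dp) => y dy; split.
  - exact: (der f y j C1f dy).
  - exact: (der f y i C1f dy).
  - exact: (der (pd j f) y i (C1pd j) dy).
  - exact: (der (pd i f) y j (C1pd i) dy).
move=> p hp.
have cv k l : (fun s => pd k (pd l f) (shrink s p)) @ (1 : R)^'- -->
    pd k (pd l f) p.
  by apply: cvg_comp (C0 k l p hp); exact: shrink_cvg_within.
have : (fun s => pd i (pd j f) (shrink s p)) @ (1 : R)^'- --> pd j (pd i f) p.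
  apply: cvg_trans (cv j i); apply: near_eq_cvg.
  near=> s; have hs : 0 <= s < 1 by near: s; exact: near1_itv.
  by rewrite int //; exact: shrink_disc.
by apply: cvg_unique (cv i j).
Unshelve. all: by end_near. Qed.

End Datum.

(** * Two-jets *)

Section ScalarChain.
Variables (R : realType) (V : normedModType R) (J : finType) (e : J -> V).
Variable c : coords e.

Fact real_co_lin (j : unit) (a : R) (u w : R^o) : a *: u + w = a * u + w.
Proof. by []. Qed.

Fact real_norm_co (u : R^o) (M : R) : (forall j : unit, `|u| <= M) -> 0 <= M ->
  `|u| <= M.
Proof. by move=> /(_ tt). Qed.

Fact real_co_e (i j : unit) : 1 = (i == j)%:R :> R.
Proof. by case: i j => [] []. Qed.

Definition real_coords : coords (fun _ : unit => 1 : R^o) :=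
  @Coords R R^o unit (fun=> 1) (fun _ u => u) real_co_lin (fun _ _ => lexx _)
    real_norm_co real_co_e.

Lemma sum_unit (F : unit -> R) : \sum_j F j = F tt.
Proof. by rewrite (bigD1 tt) //= big1 ?addr0 // => -[]. Qed.

Lemma is_derive_hasgrad (g : R -> R) (y dg : R) : is_derive y 1 g dg ->
  hasgrad real_coords setT g y (fun=> dg).
Proof.
move=> [dv E] eps e0.
have C : (fun h : R => h^-1 *: ((g \o shift y) (h *: (1 : R^o)) - g y)) @ 0^' --> dg.
  by rewrite -E; exact: dv.
have {}C : \forall h \near (0 : R), h != 0 ->
    `|dg - h^-1 *: ((g \o shift y) (h *: (1 : R^o)) - g y)| <= eps.
  by move/cvgrPdist_le: C => /(_ _ e0); rewrite near_withinE.
have S : (fun q : R => q - y) @ y --> (0 : R).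
  by rewrite -(subrr y); apply: cvgB; [exact: cvg_id|exact: cvg_cst].
have {}C : \forall q \near y, q - y != 0 ->
    `|dg - (q - y)^-1 *: ((g \o shift y) ((q - y) *: (1 : R^o)) - g y)| <= eps.
  exact: S _ C.
apply: filterS C => q Hq _; rewrite /lin sum_unit /=.
have [->|nq] := eqVneq q y; first by rewrite !subrr mulr0 subrr normr0 mulr0.
have {}nq : q - y != 0 by rewrite subr_eq0.
have := Hq nq; rewrite /= [_ *: 1]mulr1 subrK => H.
have -> : g q - g y - dg * (q - y) =
   - ((q - y) * (dg - (q - y)^-1 *: (g q - g y))).
  rewrite -[_ *: _]/((q - y)^-1 * (g q - g y)); by field.
by rewrite normrN normrM mulrC ler_wpM2r.
Qed.

Lemma hasgrad_comp1 (A : set V) (f : V -> R) (g : R -> R) p df dg :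
  hasgrad c A f p df -> is_derive (f p) 1 g dg ->
  hasgrad c A (fun q => g (f q)) p (fun j => dg * df j).
Proof.
move=> hf /is_derive_hasgrad hg.
have := @hasgrad_comp R V R^o J unit e (fun=> 1) c real_coords A setT f g p
   (fun=> df) (fun=> dg) _ (fun=> hf) hg.
move=> H; apply: hasgrad_eqg (H _) => [j|].
  by rewrite sum_unit.
by near=> q.
Unshelve. all: by end_near. Qed.

End ScalarChain.

Section Jets.
Variables (R : realType) (V : normedModType R) (J : finType) (e : J -> V).
Variable c : coords e.

(** A function together with candidates for its first and second partial
    derivatives, so that chain rules, symmetry and size estimates of a long
    explicit formula follow its syntax. *)
Record jet := Jet { jv : V -> R; j1 : J -> V -> R; j2 : J -> J -> V -> R }.
Implicit Types (F G : jet) (p : V).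

Definition jet_ok F p := [/\ hasgrad c setT (jv F) p (j1 F ^~ p),
  forall j, hasgrad c setT (j1 F j) p (j2 F j ^~ p),
  forall j l, j2 F j l @ p --> j2 F j l p &
  forall j l, j2 F j l p = j2 F l j p].

Lemma jet_ok_cvg F p : jet_ok F p -> jv F @ p --> jv F p.
Proof. by move=> [/hasgrad_cvg + _ _ _]; rewrite withinET. Qed.

Lemma jet_ok_cvg1 F p j : jet_ok F p -> j1 F j @ p --> j1 F j p.
Proof. by move=> [_ /(_ j)/hasgrad_cvg + _ _]; rewrite withinET. Qed.

Definition jco i := Jet (co c i) (fun j _ => (i == j)%:R) (fun _ _ _ => 0).

Lemma jco_ok i p : jet_ok (jco i) p.
Proof.
split=> // [|j|j l]; [exact: hasgrad_co|exact: hasgrad_cst|exact: cvg_cst].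
Qed.

Definition jadd F G := Jet (fun q => jv F q + jv G q)
  (fun j q => j1 F j q + j1 G j q) (fun j l q => j2 F j l q + j2 G j l q).

Lemma jadd_ok F G p : jet_ok F p -> jet_ok G p -> jet_ok (jadd F G) p.
Proof.
move=> [F0 F1 F2 Fs] [G0 G1 G2 Gs]; split=> /= [|j|j l|j l].
- exact: hasgradD.
- exact: hasgradD.
- by apply: cvgD; [exact: F2|exact: G2].
- by rewrite Fs Gs.
Qed.

Definition jmul F G := Jet (fun q => jv F q * jv G q)
  (fun j q => j1 F j q * jv G q + jv F q * j1 G j q)
  (fun j l q => (j2 F j l q * jv G q + j1 F j q * j1 G l q) +
                (j1 F l q * j1 G j q + jv F q * j2 G j l q)).

Lemma jmul_ok F G p : jet_ok F p -> jet_ok G p -> jet_ok (jmul F G) p.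
Proof.
move=> Fok Gok; have [F0 F1 F2 Fs] := Fok; have [G0 G1 G2 Gs] := Gok.
have Fv := jet_ok_cvg Fok; have Gv := jet_ok_cvg Gok.
have Fv1 j := jet_ok_cvg1 (j := j) Fok; have Gv1 j := jet_ok_cvg1 (j := j) Gok.
split=> /= [|j|j l|j l].
- exact: hasgradM.
- by apply: hasgradD; exact: hasgradM.
- by apply: cvgD; apply: cvgD; apply: cvgM.
- by rewrite Fs Gs; ring.
Qed.

Definition jscale a F := Jet (fun q => a * jv F q) (fun j q => a * j1 F j q)
  (fun j l q => a * j2 F j l q).

Lemma jscale_ok a F p : jet_ok F p -> jet_ok (jscale a F) p.
Proof.
move=> [F0 F1 F2 Fs].
have H f g : hasgrad c setT f p g ->
    hasgrad c setT (fun q => a * f q) p (fun j => a * g j).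
  move=> h; apply: hasgrad_eqg (hasgradM (hasgrad_cst c setT a p) h) => j.
  by rewrite mul0r add0r.
split=> /= [|j|j l|j l]; [exact: H|exact: H| |by rewrite Fs].
by apply: cvgM; [exact: cvg_cst|exact: F2].
Qed.

Definition jcomp (g g1 g2 : R -> R) F := Jet (fun q => g (jv F q))
  (fun j q => g1 (jv F q) * j1 F j q)
  (fun j l q => g2 (jv F q) * j1 F l q * j1 F j q + g1 (jv F q) * j2 F j l q).

Lemma jcomp_ok g g1 g2 F p : jet_ok F p ->
  is_derive (jv F p) 1 g (g1 (jv F p)) -> is_derive (jv F p) 1 g1 (g2 (jv F p)) ->
  {for jv F p, continuous g2} -> jet_ok (jcomp g g1 g2 F) p.
Proof.
move=> Fok dg dg1 cg2; have [F0 F1 F2 Fs] := Fok.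
have Fv := jet_ok_cvg Fok; have Fv1 j := jet_ok_cvg1 (j := j) Fok.
have cg1 : {for jv F p, continuous g1}.
  by apply: differentiable_continuous; apply/derivable1_diffP; case: dg1.
split=> /= [|j|j l|j l].
- exact: hasgrad_comp1.
- by apply: hasgradM => //; exact: hasgrad_comp1.
- apply: cvgD; last by apply: cvgM; [exact: cvg_comp Fv cg1|exact: F2].
  by apply: cvgM => //; apply: cvgM => //; exact: cvg_comp Fv cg2.
- by rewrite Fs; ring.
Qed.

Section Bounds.
Variables (p : V) (a w : R).

(** The sizes [a] and [w] of one and two derivatives depend on the point, [s] is
    a numerical factor.  The value is left out, as the time has no bound of
    this form. *)
Definition jder_le s F := (forall j, `|j1 F j p| <= s * a) /\
  (forall j l, `|j2 F j l p| <= s * w).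

Definition jet_le s F := `|jv F p| <= s /\ jder_le s F.

Lemma jder_le_add s s' F G : jder_le s F -> jder_le s' G ->
  jder_le (s + s') (jadd F G).
Proof.
move=> [F1 F2] [G1 G2]; split=> [j|j l] /=;
  by rewrite (le_trans (ler_normD _ _)) // mulrDl lerD.
Qed.

Lemma jder_le_scale s k F : jder_le s F -> jder_le (`|k| * s) (jscale k F).
Proof.
move=> [F1 F2]; split=> [j|j l] /=; by rewrite normrM -mulrA ler_wpM2l.
Qed.

Lemma jet_le_add s s' F G : jet_le s F -> jet_le s' G ->
  jet_le (s + s') (jadd F G).
Proof.
move=> [F0 Fd] [G0 Gd]; split; last exact: jder_le_add.
by rewrite (le_trans (ler_normD _ _)) // lerD.
Qed.

Lemma jet_le_scale s k F : jet_le s F -> jet_le (`|k| * s) (jscale k F).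
Proof.
by move=> [F0 Fd]; split; [rewrite normrM ler_wpM2l|exact: jder_le_scale].
Qed.

Hypothesis aw : a ^+ 2 <= w.
Hypothesis a0 : 0 <= a.

(** The factor 4 counts the terms of the Leibniz rule, in which [a ^+ 2 <= w]
    absorbs the products of two first derivatives. *)
Lemma jet_le_mul s s' F G : jet_le s F -> jet_le s' G ->
  jet_le (4 * (s * s')) (jmul F G).
Proof.
move=> [F0 [F1 F2]] [G0 [G1 G2]].
have s0 : 0 <= s by exact: le_trans F0.
have s'0 : 0 <= s' by exact: le_trans G0.
have ss0 : 0 <= s * s' by exact: mulr_ge0.
have w0 : 0 <= w by rewrite (le_trans _ aw) // sqr_ge0.
have M x y m n : `|x| <= m -> `|y| <= n -> `|x * y| <= m * n :> R.
  by move=> h h'; rewrite normrM ler_pM.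
split; [|split=> [j|j l]] => /=.
- by rewrite (le_trans (M _ _ _ _ F0 G0)) // ler_peMl // ler1n.
- rewrite (le_trans (ler_normD _ _)) //.
  rewrite (le_trans (lerD (M _ _ _ _ (F1 j) G0) (M _ _ _ _ F0 (G1 j)))) //.
  by have := mulr_ge0 ss0 a0; lra.
- rewrite (le_trans (ler_normD _ _)) //.
  have h1 := M _ _ _ _ (F2 j l) G0; have h2 := M _ _ _ _ (F1 j) (G1 l).
  have h3 := M _ _ _ _ (F1 l) (G1 j); have h4 := M _ _ _ _ F0 (G2 j l).
  have h5 := ler_normD (j2 F j l p * jv G p) (j1 F j p * j1 G l p).
  have h6 := ler_normD (j1 F l p * j1 G j p) (jv F p * j2 G j l p).
  have h7 : s * s' * a ^+ 2 <= s * s' * w by rewrite ler_wpM2l.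
  by rewrite expr2 in h7; lra.
Qed.

End Bounds.

Lemma jder_le_mono p a w a' w' s s' F : 0 <= s -> 0 <= a' -> 0 <= w' ->
  a <= a' -> w <= w' -> s <= s' -> jder_le p a w s F -> jder_le p a' w' s' F.
Proof.
move=> s0 a0 w0 aa ww ss [F1 F2]; split=> [j|j l].
  by rewrite (le_trans (F1 j)) // (@le_trans _ _ (s * a')) ?ler_wpM2l ?ler_wpM2r.
by rewrite (le_trans (F2 j l)) // (@le_trans _ _ (s * w')) ?ler_wpM2l ?ler_wpM2r.
Qed.

Lemma jet_le_mono p a w a' w' s s' F : 0 <= a' -> 0 <= w' ->
  a <= a' -> w <= w' -> s <= s' -> jet_le p a w s F -> jet_le p a' w' s' F.
Proof.
move=> a0 w0 aa ww ss [F0 Fd]; split; first exact: le_trans ss.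
by apply: jder_le_mono Fd => //; exact: le_trans F0.
Qed.

End Jets.

(** * The pieces of the billiard flow *)

Section RealFunctions.
Variable R : realType.
Implicit Types y : R.

Lemma is_derive_continuous (g : R -> R) y d :
  is_derive y 1 g d -> {for y, continuous g}.
Proof.
by move=> [h _]; apply: differentiable_continuous; apply/derivable1_diffP.
Qed.

Lemma is_deriveMr (f g : R -> R) y a b : is_derive y 1 f a ->
  is_derive y 1 g b -> is_derive y 1 (fun q => f q * g q) (f y * b + g y * a).
Proof. by move=> hf hg; exact: is_deriveM. Qed.

Definition sqrt1 y := (2 * Num.sqrt y)^-1.
Definition sqrt2 y := - (2 * (sqrt1 y * sqrt1 y * sqrt1 y)).

Lemma is_derive_sqrt1 y : 0 < y -> is_derive y 1 sqrt1 (sqrt2 y).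
Proof.
move=> y0; have s0 : 0 < Num.sqrt y by rewrite sqrtr_gt0.
have h : is_derive y 1 (fun y => 2 * Num.sqrt y) (2 * (2 * Num.sqrt y)^-1).
  by apply: is_deriveZ; exact: is_derive1_sqrt.
apply: is_derive_eq; first by apply: is_deriveV h; rewrite mulf_neq0 ?gt_eqF.
rewrite /sqrt2 /sqrt1 -[_ *: _]/(- (2 * Num.sqrt y) ^- 2 * _).
by field; rewrite gt_eqF.
Qed.

Lemma sqrt2_continuous y : 0 < y -> {for y, continuous sqrt2}.
Proof.
move=> /is_derive_sqrt1 h.
have h3 := is_deriveMr (is_deriveMr h h) h.
exact: is_derive_continuous (is_deriveN (is_deriveZ 2 h3)).
Qed.

Definition inv1 y := - (y^-1 * y^-1).
Definition inv2 y := 2 * (y^-1 * y^-1 * y^-1).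

Lemma is_derive_inv y : y != 0 -> is_derive y 1 (fun y => y^-1) (inv1 y).
Proof.
move=> y0; apply: is_derive_eq; first by apply: is_deriveV; first exact: y0.
by rewrite /inv1 [_ *: 1]mulr1 -expr2 exprVn.
Qed.

Lemma is_derive_inv1 y : y != 0 -> is_derive y 1 inv1 (inv2 y).
Proof.
move=> y0; have h := is_derive_inv y0.
have h2 : is_derive y 1 (fun q => - (q^-1 * q^-1))
    (- (y^-1 * inv1 y + y^-1 * inv1 y)) := is_deriveN (is_deriveMr h h).
by apply: is_derive_eq h2 _; rewrite /inv1 /inv2; ring.
Qed.

Lemma inv2_continuous y : y != 0 -> {for y, continuous inv2}.
Proof.
move=> /is_derive_inv h.
have h3 := is_deriveMr (is_deriveMr h h) h.
exact: is_derive_continuous (is_deriveZ 2 h3).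
Qed.

Definition asin1 y := (Num.sqrt (1 - y ^+ 2))^-1.
Definition asin2 y := y * (asin1 y * asin1 y * asin1 y).

Lemma sqr_lt1 y : y ^+ 2 < 1 -> -1 < y < 1.
Proof. by move=> h; apply/andP; split; nra. Qed.

Lemma is_derive_asin y : y ^+ 2 < 1 -> is_derive y 1 asin (asin1 y).
Proof. by move=> /sqr_lt1 h; exact: is_derive1_asin. Qed.

Lemma is_derive_asin1 y : y ^+ 2 < 1 -> is_derive y 1 asin1 (asin2 y).
Proof.
move=> y1; have p0 : 0 < 1 - y ^+ 2 by rewrite subr_gt0.
have s0 : 0 < Num.sqrt (1 - y ^+ 2) by rewrite sqrtr_gt0.
have h1 : is_derive y 1 (fun y => 1 - y ^+ 2) (- (2 * y)).
  have h : is_derive y 1 (fun y : R => 1 - y * y) (0 - (y * 1 + y * 1)).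
    apply: is_deriveB; exact: is_deriveMr.
  have -> : (fun y : R => 1 - y ^+ 2) = (fun y => 1 - y * y).
    by apply/funext => q; rewrite expr2.
  by apply: is_derive_eq h _; ring.
have h2 : is_derive y 1 (fun y => Num.sqrt (1 - y ^+ 2))
    ((2 * Num.sqrt (1 - y ^+ 2))^-1 * (- (2 * y))).
  apply: (@is_derive1_comp R Num.sqrt (fun y => 1 - y ^+ 2)) h1.
  exact: is_derive1_sqrt.
apply: is_derive_eq; first by apply: is_deriveV h2; rewrite gt_eqF.
rewrite /asin2 /asin1 -[_ *: _]/(- Num.sqrt (1 - y ^+ 2) ^- 2 * _).
by field; rewrite gt_eqF.
Qed.

Lemma asin2_continuous y : y ^+ 2 < 1 -> {for y, continuous asin2}.
Proof.
move=> /is_derive_asin1 h.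
have h3 := is_deriveMr (is_deriveMr h h) h.
exact: is_derive_continuous (is_deriveMr (is_derive_id _ _) h3).
Qed.

End RealFunctions.

Section BilliardJets.
Variable R : realType.
Local Notation phase := ('cV[R]_2 * 'cV[R]_2)%type.
Local Notation tc := (time_coords R).
Local Notation J := (option ('I_2 + 'I_2)).
Local Notation jet := (jet (R * phase)%type J).
Implicit Types (z : R * phase) (i : 'I_2) (j l : J) (n : R) (k : nat).

Definition jT : jet := jco tc None.
Definition jX i : jet := jco tc (Some (inl i)).
Definition jV i : jet := jco tc (Some (inr i)).

Definition jsub (F G : jet) : jet := jadd F (jscale (-1) G).

Lemma jsub_ok (F G : jet) z : jet_ok tc F z -> jet_ok tc G z ->
  jet_ok tc (jsub F G) z.
Proof. by move=> hF hG; apply: jadd_ok => //; exact: jscale_ok. Qed.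

Definition jspeed : jet := jcomp Num.sqrt (@sqrt1 R) (@sqrt2 R)
  (jadd (jmul (jV 0) (jV 0)) (jmul (jV 1) (jV 1))).
Definition jispeed : jet := jcomp (fun y => y^-1) (@inv1 R) (@inv2 R) jspeed.
(** The unit direction of the velocity. *)
Definition jw i : jet := jmul (jV i) jispeed.
(** The angular momentum at unit speed, preserved by all bounces. *)
Definition jbeta : jet := jsub (jmul (jX 0) (jw 1)) (jmul (jX 1) (jw 0)).
Definition jalong : jet := jadd (jmul (jX 0) (jw 0)) (jmul (jX 1) (jw 1)).
(** Each bounce rotates the velocity by [2 * phi] and changes its sign. *)
Definition jphi : jet := jcomp asin (@asin1 R) (@asin2 R) jbeta.
Definition jcos n : jet :=
  jcomp cos (fun y => - sin y) (fun y => - cos y) (jscale n jphi).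
Definition jsin n : jet :=
  jcomp sin cos (fun y => - sin y) (jscale n jphi).
(** The direction of the velocity rotated by [n * phi]. *)
Definition jU n i : jet :=
  if i == 0 then jsub (jmul (jcos n) (jw 0)) (jmul (jsin n) (jw 1))
  else jadd (jmul (jsin n) (jw 0)) (jmul (jcos n) (jw 1)).
(** The distance travelled since the [k]-th backward bounce. *)
Definition jsigma k : jet :=
  jsub (jsub (jmul jT jspeed) jalong) (jscale (2 * k%:R - 1) (jcos 1)).
Definition jpos k i : jet := jscale ((-1) ^+ k)
  (jsub (jU (2 * k%:R - 1) i) (jmul (jsigma k) (jU (2 * k%:R) i))).
Definition jvel k i : jet :=
  jscale ((-1) ^+ k) (jmul jspeed (jU (2 * k%:R) i)).
(** Before the first bounce the trajectory is a straight line, also at zero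
    velocity, where the angular variables make no sense. *)
Definition jPhi k (m : 'I_2 + 'I_2) : jet :=
  match m, k with
  | inl i, 0%N => jsub (jX i) (jmul jT (jV i))
  | inr i, 0%N => jV i
  | inl i, _ => jpos k i
  | inr i, _ => jvel k i
  end.

(** The open set on which all pieces are smooth: the velocity does not vanish
    and the line of motion meets the open disc. *)
Definition regular : set (R * phase) :=
  [set z | z.2.2 != 0 /\ jv jbeta z ^+ 2 < 1].

Lemma jspeedE z : jv jspeed z = enorm z.2.2.
Proof. by rewrite /enorm dotE. Qed.

Lemma jspeed_ok z : z.2.2 != 0 -> jet_ok tc jspeed z.
Proof.
move=> v0; have h : 0 < jv (jadd (jmul (jV 0) (jV 0)) (jmul (jV 1) (jV 1))) z.
  by have := jspeedE z; rewrite -sqrtr_gt0 /= => ->; rewrite enorm_gt0.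
apply: jcomp_ok.
- by apply: jadd_ok; apply: jmul_ok; exact: jco_ok.
- exact: is_derive1_sqrt.
- exact: is_derive_sqrt1.
- exact: sqrt2_continuous.
Qed.

Lemma jispeed_ok z : z.2.2 != 0 -> jet_ok tc jispeed z.
Proof.
move=> v0; have h : jv jspeed z != 0 by rewrite jspeedE gt_eqF ?enorm_gt0.
apply: jcomp_ok; first exact: jspeed_ok.
- exact: is_derive_inv.
- exact: is_derive_inv1.
- exact: inv2_continuous.
Qed.

Lemma jw_ok i z : z.2.2 != 0 -> jet_ok tc (jw i) z.
Proof. by move=> v0; apply: jmul_ok; [exact: jco_ok|exact: jispeed_ok]. Qed.

Lemma jbeta_ok z : z.2.2 != 0 -> jet_ok tc jbeta z.
Proof.
move=> v0.
exact: jsub_ok (jmul_ok (jco_ok _ _ _) (jw_ok _ v0))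
  (jmul_ok (jco_ok _ _ _) (jw_ok _ v0)).
Qed.

Lemma jalong_ok z : z.2.2 != 0 -> jet_ok tc jalong z.
Proof.
move=> v0.
exact: jadd_ok (jmul_ok (jco_ok _ _ _) (jw_ok _ v0))
  (jmul_ok (jco_ok _ _ _) (jw_ok _ v0)).
Qed.

Lemma jphi_ok z : regular z -> jet_ok tc jphi z.
Proof.
move=> [v0 b1]; apply: jcomp_ok; first exact: jbeta_ok.
- exact: is_derive_asin.
- exact: is_derive_asin1.
- exact: asin2_continuous.
Qed.

Lemma jcos_ok n z : regular z -> jet_ok tc (jcos n) z.
Proof.
move=> rz; apply: jcomp_ok; first by apply: jscale_ok; exact: jphi_ok.
exact: is_derive_continuous (is_deriveN (is_derive_cos _)).
Qed.

Lemma jsin_ok n z : regular z -> jet_ok tc (jsin n) z.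
Proof.
move=> rz; apply: jcomp_ok; first by apply: jscale_ok; exact: jphi_ok.
exact: is_derive_continuous (is_deriveN (is_derive_sin _)).
Qed.

Lemma jU_ok n i z : regular z -> jet_ok tc (jU n i) z.
Proof.
move=> rz; have [v0 _] := rz; rewrite /jU; case: ifP => _.
  exact: jsub_ok (jmul_ok (jcos_ok n rz) (jw_ok 0 v0))
    (jmul_ok (jsin_ok n rz) (jw_ok 1 v0)).
exact: jadd_ok (jmul_ok (jsin_ok n rz) (jw_ok 0 v0))
  (jmul_ok (jcos_ok n rz) (jw_ok 1 v0)).
Qed.

Lemma jsigma_ok k z : regular z -> jet_ok tc (jsigma k) z.
Proof.
move=> rz; have [v0 _] := rz; apply: jsub_ok; last first.
  by apply: jscale_ok; exact: jcos_ok.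
apply: jsub_ok; last exact: jalong_ok.
by apply: jmul_ok; [exact: jco_ok|exact: jspeed_ok].
Qed.

Lemma jPhi_ok k m z : (k = 0)%N \/ regular z -> jet_ok tc (jPhi k m) z.
Proof.
case: k m => [|k] [i|i] h; rewrite /jPhi.
- by apply: jsub_ok; [|apply: jmul_ok]; exact: jco_ok.
- exact: jco_ok.
- case: h => // rz; apply: jscale_ok; apply: jsub_ok; first exact: jU_ok.
  by apply: jmul_ok; [exact: jsigma_ok|exact: jU_ok].
- case: h => // rz; have [v0 _] := rz; apply: jscale_ok.
  by apply: jmul_ok; [exact: jspeed_ok|exact: jU_ok].
Qed.

End BilliardJets.

(** * Geometry of the chords *)

Section Geometry.
Variable R : realType.
Local Notation vec := 'cV[R]_2.
Local Notation phase := ('cV[R]_2 * 'cV[R]_2)%type.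
Local Notation tc := (time_coords R).
Implicit Types (z : R * phase) (x v : vec) (i : 'I_2) (n : R) (k : nat).

Lemma reflmxE x v i : (reflmx x *m v) i 0 = v i 0 - 2 * dot x v * x i 0.
Proof.
rewrite /reflmx /tens mulmxBl mul1mx !mxE sum2 !mxE !big_ord1 !mxE dotE; ring.
Qed.

Local Notation rr := (jv (jspeed R)).
Local Notation ww i := (jv (jw R i)).
Local Notation bb := (jv (jbeta R)).
Local Notation dd := (jv (jalong R)).
Local Notation pp := (jv (jphi R)).
Local Notation UU n i := (jv (jU n i)).

(** Half the length of the chords of the trajectory; at a bounce, the normal
    component of the unit velocity up to sign. *)
Definition cphi z : R := cos (pp z).

Lemma rr_gt0 z : z.2.2 != 0 -> 0 < rr z.
Proof. by rewrite jspeedE enorm_gt0. Qed.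

Lemma rr_sqr z : rr z ^+ 2 = z.2.2 0 0 ^+ 2 + z.2.2 1 0 ^+ 2.
Proof. by rewrite jspeedE enorm2 dotE !expr2. Qed.

Lemma wwE z i : ww i z = z.2.2 i 0 / rr z.
Proof. by []. Qed.

Lemma v_rw z i : z.2.2 != 0 -> z.2.2 i 0 = rr z * ww i z.
Proof. by move=> /rr_gt0 r0; rewrite wwE mulrCA divff ?mulr1 ?gt_eqF. Qed.

Lemma ww_unit z : z.2.2 != 0 -> ww 0 z ^+ 2 + ww 1 z ^+ 2 = 1.
Proof.
move=> /rr_gt0 r0; rewrite !wwE !expr_div_n -mulrDl -rr_sqr divff //.
by rewrite expf_neq0 ?gt_eqF.
Qed.

Lemma bbE z : bb z = z.2.1 0 0 * ww 1 z - z.2.1 1 0 * ww 0 z.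
Proof.
rewrite -[LHS]/(z.2.1 0 0 * ww 1 z + -1 * (z.2.1 1 0 * ww 0 z)).
by rewrite mulN1r.
Qed.

Lemma ddE z : dd z = z.2.1 0 0 * ww 0 z + z.2.1 1 0 * ww 1 z.
Proof. by []. Qed.

Lemma x_db0 z : z.2.2 != 0 -> z.2.1 0 0 = dd z * ww 0 z + bb z * ww 1 z.
Proof.
move=> /ww_unit; rewrite ddE bbE; move: (ww 0 z) (ww 1 z) => a b u.
rewrite -[LHS]mulr1 -u; ring.
Qed.

Lemma x_db1 z : z.2.2 != 0 -> z.2.1 1 0 = dd z * ww 1 z - bb z * ww 0 z.
Proof.
move=> /ww_unit; rewrite ddE bbE; move: (ww 0 z) (ww 1 z) => a b u.
rewrite -[LHS]mulr1 -u; ring.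
Qed.

Lemma dot_xx z : z.2.2 != 0 -> dot z.2.1 z.2.1 = dd z ^+ 2 + bb z ^+ 2.
Proof.
move=> /ww_unit; rewrite ddE bbE dotE; move: (ww 0 z) (ww 1 z) => a b u.
rewrite -[LHS]mulr1 -u; ring.
Qed.

Lemma bb_itv z : regular z -> -1 <= bb z <= 1.
Proof.
by move=> [_] /sqr_lt1/andP[h1 h2]; rewrite !ltW.
Qed.

Lemma sin_phi z : regular z -> sin (pp z) = bb z.
Proof. by move=> /bb_itv h; apply: asinK; rewrite in_itv. Qed.

Lemma cphi_gt0 z : regular z -> 0 < cphi z.
Proof.
move=> rz; have [_ b1] := rz.
by rewrite /cphi cos_asin ?bb_itv // sqrtr_gt0 subr_gt0.
Qed.

Lemma cphi_le1 z : cphi z <= 1.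
Proof. exact: cos_le1. Qed.

Lemma cphi_sqr z : regular z -> cphi z ^+ 2 = 1 - bb z ^+ 2.
Proof. by move=> rz; rewrite -sin_phi // /cphi -cos2sin2. Qed.

Lemma asin1_phi z : regular z -> asin1 (bb z) = (cphi z)^-1.
Proof. by move=> rz; rewrite /cphi cos_asin ?bb_itv. Qed.

Lemma UU0 z n : UU n 0 z = cos (n * pp z) * ww 0 z - sin (n * pp z) * ww 1 z.
Proof.
rewrite -[LHS]/(cos (n * pp z) * ww 0 z + -1 * (sin (n * pp z) * ww 1 z)).
by rewrite mulN1r.
Qed.

Lemma UU1 z n : UU n 1 z = sin (n * pp z) * ww 0 z + cos (n * pp z) * ww 1 z.
Proof. by []. Qed.

Lemma UU_zero z i : UU 0 i z = ww i z.
Proof.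
by have [->|->] := ord2 i; rewrite ?UU0 ?UU1 mul0r cos0 sin0 !mul0r !mul1r
  ?subr0 ?add0r.
Qed.

Lemma UU_dot z n m : z.2.2 != 0 ->
  UU n 0 z * UU m 0 z + UU n 1 z * UU m 1 z = cos ((n - m) * pp z).
Proof.
move=> /ww_unit; rewrite mulrBl cosB !UU0 !UU1.
move: (ww 0 z) (ww 1 z) (cos (n * pp z)) (sin (n * pp z)) (cos (m * pp z))
  (sin (m * pp z)) => a b c s c' s' u.
rewrite -[RHS]mulr1 -u; ring.
Qed.

Lemma UU_unit z n : z.2.2 != 0 -> UU n 0 z ^+ 2 + UU n 1 z ^+ 2 = 1.
Proof. by move=> v0; rewrite !expr2 UU_dot // subrr mul0r cos0. Qed.

(** The three-term recursion of the trigonometric functions. *)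
Lemma UU_next z n i : UU (n + 1) i z = 2 * cphi z * UU n i z - UU (n - 1) i z.
Proof.
have [->|->] := ord2 i; rewrite /cphi ?UU0 ?UU1 !mulrDl mulN1r !mul1r
  !(cosD, sinD) cosN sinN;
  move: (ww 0 z) (ww 1 z) (cos (n * pp z)) (sin (n * pp z)) (cos (pp z))
  (sin (pp z)) => a b c s c' s'; ring.
Qed.

(** Time since the start of the backward motion of the [k]-th bounce; for
    [k = 0] this is the (nonpositive) bounce time of the straight line ahead. *)
Definition jhit k : jet (R * phase)%type (option ('I_2 + 'I_2)) :=
  jmul (jadd (jalong R) (jscale (2 * k%:R - 1) (jcos (1 : R)))) (jispeed R).
Local Notation hit k := (jv (jhit k)).

Lemma jhit_ok k z : regular z -> jet_ok tc (jhit k) z.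
Proof.
move=> rz; have [v0 _] := rz.
apply: jmul_ok; last exact: jispeed_ok.
apply: jadd_ok; first exact: jalong_ok.
by apply: jscale_ok; exact: jcos_ok.
Qed.

Lemma hitE k z : hit k z = (dd z + (2 * k%:R - 1) * cphi z) / rr z.
Proof.
rewrite -[LHS]/((dd z + (2 * k%:R - 1) * cos (1 * pp z)) / rr z).
by rewrite mul1r.
Qed.

Lemma hit_succ k z : hit k.+1 z = hit k z + 2 * cphi z / rr z.
Proof. rewrite !hitE mulrS; ring. Qed.

Lemma hit_lt k z : regular z -> hit k z < hit k.+1 z.
Proof.
move=> rz; rewrite hit_succ ltrDl divr_gt0 ?rr_gt0 ?mulr_gt0 ?cphi_gt0 //.
by case: rz.
Qed.

Lemma hit_le k k' z : regular z -> (k <= k')%N -> hit k z <= hit k' z.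
Proof.
move=> rz; elim: k' => [|k' IH]; first by rewrite leqn0 => /eqP->.
rewrite leq_eqVlt ltnS => /orP[/eqP->//|/IH h].
by rewrite (le_trans h) // ltW // hit_lt.
Qed.

Lemma sigmaE k z : z.2.2 != 0 -> jv (jsigma R k) z = rr z * (z.1 - hit k z).
Proof.
move=> /rr_gt0 r0; rewrite hitE.
rewrite -[LHS]/(z.1 * rr z + -1 * dd z +
  -1 * ((2 * k%:R - 1) * cos (1 * pp z))) mul1r -/(cphi z).
move: (rr z) (dd z) (cphi z) r0 => r d c r0.
by field; rewrite gt_eqF.
Qed.

Lemma jposE k i z : jv (jpos R k i) z = (-1) ^+ k *
  (UU (2 * k%:R - 1) i z - jv (jsigma R k) z * UU (2 * k%:R) i z).
Proof.
rewrite -[LHS]/((-1) ^+ k * (UU (2 * k%:R - 1) i z +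
  -1 * (jv (jsigma R k) z * UU (2 * k%:R) i z))).
by rewrite mulN1r.
Qed.

Lemma jvelE k i z : jv (jvel R k i) z = (-1) ^+ k * (rr z * UU (2 * k%:R) i z).
Proof. by []. Qed.

Lemma Phi0_pos z i : regular z -> jv (jPhi R 0 (inl i)) z = jv (jpos R 0 i) z.
Proof.
move=> rz; have [v0 _] := rz; have r0 := rr_gt0 v0.
have -> : jv (jPhi R 0 (inl i)) z = z.2.1 i 0 - z.1 * (rr z * ww i z).
  by rewrite -v_rw //= mulN1r.
rewrite jposE sigmaE // hitE expr0 mul1r mulr0 UU_zero sub0r.
have -> : rr z * (z.1 - (dd z + -1 * cphi z) / rr z) =
    rr z * z.1 - dd z + cphi z by field; rewrite gt_eqF.
have [->|->] := ord2 i; rewrite ?UU0 ?UU1 mulN1r cosN sinN -/(cphi z) sin_phi //.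
  rewrite x_db0 //.
  by move: (ww 0 z) (ww 1 z) (bb z) (dd z) (rr z) (cphi z) => *; ring.
rewrite x_db1 //.
by move: (ww 0 z) (ww 1 z) (bb z) (dd z) (rr z) (cphi z) => *; ring.
Qed.

Lemma Phi0_vel z i : regular z -> jv (jPhi R 0 (inr i)) z = jv (jvel R 0 i) z.
Proof.
by move=> [v0 _]; rewrite jvelE expr0 mul1r mulr0 UU_zero -v_rw.
Qed.

Definition Phi k z : phase := (\col_i jv (jPhi R k (inl i)) z,
                               \col_i jv (jPhi R k (inr i)) z).

Lemma Phi_pos k i z : regular z -> (Phi k z).1 i 0 = jv (jpos R k i) z.
Proof. by rewrite mxE; case: k => // rz; exact: Phi0_pos. Qed.

Lemma Phi_vel k i z : regular z -> (Phi k z).2 i 0 = jv (jvel R k i) z.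
Proof. by rewrite mxE; case: k => // rz; exact: Phi0_vel. Qed.

Lemma sign_sqr k : (-1) ^+ k * (-1) ^+ k = 1 :> R.
Proof. by rewrite -expr2 sqrr_sign. Qed.

(** The power, with respect to the circle, of the point at distance [jsigma] from
    the end of a chord of length [2 * cphi z]. *)
Lemma dot_Phi k z : regular z -> dot (Phi k z).1 (Phi k z).1 =
  1 - jv (jsigma R k) z * (2 * cphi z - jv (jsigma R k) z).
Proof.
move=> rz; have [v0 _] := rz; rewrite dotE !Phi_pos // !jposE.
set n := 2 * k%:R.
have E1 := UU_dot (n - 1) n v0; have E2 := UU_unit n v0.
have E3 := UU_unit (n - 1) v0.
have E : n - 1 - n = - 1 by ring.
rewrite E mulN1r cosN -/(cphi z) in E1.
have := sign_sqr k; move: E1 E2 E3.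
move: (UU (n - 1) 0 z) (UU (n - 1) 1 z) (UU n 0 z) (UU n 1 z) (cphi z)
  (jv (jsigma R k) z) ((-1) ^+ k) => a b a' b' c s g E1 E2 E3 E4.
transitivity ((g * g) * ((a ^+ 2 + b ^+ 2) - 2 * s * (a * a' + b * b') +
   s ^+ 2 * (a' ^+ 2 + b' ^+ 2))); first by ring.
by rewrite E1 E2 E3 E4; ring.
Qed.

Lemma Phi_dom k z : regular z -> hit k z <= z.1 <= hit k.+1 z ->
  phase_dom (Phi k z).
Proof.
move=> rz /andP[h1 h2]; have [v0 _] := rz; have r0 := rr_gt0 v0.
rewrite /phase_dom /= cdiscE dot_Phi // gerBl sigmaE // mulr_ge0 //.
  by rewrite mulr_ge0 ?(ltW r0) // subr_ge0.
rewrite subr_ge0 mulrC -ler_pdivlMr //.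
by move: h2; rewrite hit_succ lerBlDl.
Qed.

(** At the end of a chord [jsigma] equals the chord length, and [UU_next] turns
    the difference of consecutive pieces into a reflection. *)
Lemma Phi_bounce k z : regular z -> z.1 = hit k.+1 z ->
  [/\ circle (Phi k z).1, dot (Phi k z).2 (Phi k z).1 = - (rr z * cphi z) &
      Phi k.+1 z = ((Phi k z).1, reflmx (Phi k z).1 *m (Phi k z).2)].
Proof.
move=> rz hz; have [v0 _] := rz; have r0 := rr_gt0 v0.
have s1 : jv (jsigma R k.+1) z = 0 by rewrite sigmaE // hz subrr mulr0.
have s0 : jv (jsigma R k) z = 2 * cphi z.
  by rewrite sigmaE // hz hit_succ; field; rewrite gt_eqF.
set n := 2 * k%:R : R.
have n1 : 2 * k.+1%:R = n + 1 + 1 :> R by rewrite /n mulrS; ring.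
have X i : (Phi k z).1 i 0 = - ((-1) ^+ k * UU (n + 1) i z).
  by rewrite Phi_pos // jposE s0 -/n UU_next; ring.
have W i : (Phi k z).2 i 0 = (-1) ^+ k * (rr z * UU n i z).
  by rewrite Phi_vel // jvelE.
have sg := sign_sqr k.
have D : dot (Phi k z).1 (Phi k z).2 = - (rr z * cphi z).
  have E := UU_dot (n + 1) n v0.
  have E' : n + 1 - n = 1 by ring.
  rewrite E' mul1r -/(cphi z) in E.
  rewrite dotE !X !W; move: E sg.
  move: (UU (n + 1) 0 z) (UU (n + 1) 1 z) (UU n 0 z) (UU n 1 z) (cphi z)
    (rr z) ((-1) ^+ k) => a b a' b' c r g E sg.
  transitivity (- ((g * g) * (r * (a * a' + b * b')))); first by ring.
  by rewrite sg E mul1r.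
split.
- apply/circleE; rewrite dotE !X.
  have := UU_unit (n + 1) v0; move: sg.
  move: (UU (n + 1) 0 z) (UU (n + 1) 1 z) ((-1) ^+ k) => a b g sg E.
  transitivity ((g * g) * (a ^+ 2 + b ^+ 2)); first by ring.
  by rewrite sg E mul1r.
- by rewrite dotC.
- congr (_, _); apply/matrixP => i j; rewrite ord1.
    rewrite -[LHS]/((Phi k.+1 z).1 i 0) Phi_pos // jposE s1 mul0r subr0 n1 X.
    by rewrite exprS addrK mulN1r mulNr.
  rewrite -[LHS]/((Phi k.+1 z).2 i 0) Phi_vel // jvelE reflmxE D X W n1 UU_next.
  rewrite addrK exprS.
  move: (UU (n + 1) i z) (UU n i z) (cphi z) (rr z) ((-1) ^+ k) => a a' c r g.
  ring.
Qed.

Lemma hit0_le0 z : regular z -> cdisc z.2.1 -> hit 0 z <= 0.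
Proof.
move=> rz; have [v0 _] := rz; rewrite cdiscE dot_xx // => h.
rewrite hitE pmulr_lle0 ?invr_gt0 ?rr_gt0 //.
have := cphi_gt0 rz; have := cphi_sqr rz; nra.
Qed.

Lemma hit1_ge0 z : regular z -> cdisc z.2.1 -> 0 <= hit 1 z.
Proof.
move=> rz; have [v0 _] := rz; rewrite cdiscE dot_xx // => h.
rewrite hitE divr_ge0 ?(ltW (rr_gt0 _)) //.
have := cphi_gt0 rz; have := cphi_sqr rz; nra.
Qed.

(** A line that does not meet the open disc meets the closed one only in a
    grazing point. *)
Lemma phase_reg_regular t x v : phase_reg (x, v) -> v != 0 ->
  regular (t, (x, v)).
Proof.
move=> [/= xd ng] v0.
have [z zE] : exists z, z = (t, (x, v)) by exists (t, (x, v)).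
suff H : bb z ^+ 2 < 1 by split; [exact: v0|rewrite -zE; exact: H].
have xE : z.2.1 = x by rewrite zE.
have vE : z.2.2 = v by rewrite zE.
have E : dot x x = dd z ^+ 2 + bb z ^+ 2.
  by rewrite -xE (dot_xx (z := z)) // vE.
have {}xd : cdisc x := xd.
rewrite cdiscE E in xd.
have d0 := sqr_ge0 (dd z).
rewrite lt_neqAle; apply/andP; split; last by lra.
apply/eqP => b1.
have d2 : dd z ^+ 2 = 0 by apply/eqP; rewrite eq_le d0 andbT; lra.
apply: ng; split=> /=; first by apply/circleE; rewrite E b1 d2 add0r.
have {}d0 : dd z = 0 by apply/eqP; rewrite -sqrf_eq0 d2.
have r0 : 0 < rr z by apply: rr_gt0; rewrite vE.
move: d0; rewrite ddE !wwE xE vE => d0.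
rewrite dotE; move: (rr z) r0 d0 => r r0 d0.
transitivity ((x 0 0 * (v 0 0 / r) + x 1 0 * (v 1 0 / r)) * r).
  by field; rewrite gt_eqF.
by rewrite d0 mul0r.
Qed.

Lemma dot_line z s : z.2.2 != 0 ->
  dot (z.2.1 - s *: z.2.2) (z.2.1 - s *: z.2.2) =
  bb z ^+ 2 + (rr z * s - dd z) ^+ 2.
Proof.
move=> v0; rewrite dotE !mxE !(v_rw _ v0) x_db0 // x_db1 //.
have := ww_unit v0.
move: (ww 0 z) (ww 1 z) (bb z) (dd z) (rr z) => a b c d r u.
transitivity ((c ^+ 2 + (r * s - d) ^+ 2) * (a ^+ 2 + b ^+ 2)); first by ring.
by rewrite u mulr1.
Qed.

Lemma line_in_disc z s : regular z ->
  disc (z.2.1 - s *: z.2.2) <-> hit 0 z < s < hit 1 z.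
Proof.
move=> rz; have [v0 _] := rz; have r0 := rr_gt0 v0; have c0 := cphi_gt0 rz.
rewrite discE dot_line // !hitE ltr_pdivrMr // ltr_pdivlMr // mulr0 mulr1.
have := cphi_sqr rz => c2; split=> [h|/andP[h1 h2]]; last by nra.
by apply/andP; split; nra.
Qed.

(** This covers incoming boundary points, for which the set in the definition of
    [tb] is empty and [hit 1 z = 0]. *)
Lemma tbE z : regular z -> cdisc z.2.1 -> tb z.2.1 z.2.2 = hit 1 z.
Proof.
move=> rz xd; have h1 := hit1_ge0 rz xd; have h0 := hit0_le0 rz xd.
rewrite /tb; set A := [set s | _].
have AE s : A s <-> 0 <= s /\ hit 0 z < s < hit 1 z.
  by split=> -[s0 h]; split=> //; exact/(line_in_disc s rz).
have ubA : ubound A (hit 1 z) by move=> s /AE[_ /andP[_ /ltW]].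
apply/eqP; rewrite eq_le; apply/andP; split.
  have [->|/set0P A0] := eqVneq A set0; first by rewrite sup0.
  exact: ge_sup.
rewrite leNgt; apply/negP => lt1.
pose m := Num.max (Num.max 0 (hit 0 z)) (sup A).
have [m1|m1] := ltP m (hit 1 z).
  have [h2 h3] : m < (m + hit 1 z) / 2 /\ (m + hit 1 z) / 2 < hit 1 z.
    by split; lra.
  have As : A ((m + hit 1 z) / 2).
    have : 0 <= m by rewrite /m !le_max lexx.
    have : hit 0 z <= m by rewrite /m !le_max lexx orbT.
    move=> ? ?; apply/AE; split; first by lra.
    by apply/andP; split=> //; lra.
  have : (m + hit 1 z) / 2 <= sup A by apply: ub_le_sup => //; exists (hit 1 z).
  have : sup A <= m by rewrite /m le_max lexx orbT.
  by lra.
have {}h1 : hit 1 z = 0.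
  apply/eqP; rewrite eq_le h1 andbT.
  have h01 := hit_lt 0 rz.
  by move: m1; rewrite /m !le_max => /orP[/orP[//|]|]; lra.
move: lt1; rewrite (_ : A = set0) ?sup0 ?h1 ?ltxx //.
by apply/seteqP; split=> s // /AE[s0 /andP[_]]; rewrite h1 ltNge s0.
Qed.

End Geometry.

(** * Transport along the pieces *)

Section Transport.
Variable R : realType.
Local Notation phase := ('cV[R]_2 * 'cV[R]_2)%type.
Local Notation J := (option ('I_2 + 'I_2)).
Local Notation jet := (jet (R * phase)%type J).
Implicit Types (z : R * phase) (i : 'I_2) (n : R) (k : nat) (F G : jet).

(** The free transport operator; it is a derivation. *)
Definition jtr F z : R := j1 F None z + \sum_i z.2.2 i 0 * j1 F (Some (inl i)) z.

Lemma jtr_add F G z : jtr (jadd F G) z = jtr F z + jtr G z.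
Proof. by rewrite /jtr !sum2 /=; ring. Qed.

Lemma jtr_scale a F z : jtr (jscale a F) z = a * jtr F z.
Proof. by rewrite /jtr !sum2 /=; ring. Qed.

Lemma jtr_sub F G z : jtr (jsub F G) z = jtr F z - jtr G z.
Proof. by rewrite jtr_add jtr_scale mulN1r. Qed.

Lemma jtr_mul F G z : jtr (jmul F G) z = jtr F z * jv G z + jv F z * jtr G z.
Proof. by rewrite /jtr !sum2 /=; ring. Qed.

Lemma jtr_mul0 F G z : jtr F z = 0 -> jtr G z = 0 -> jtr (jmul F G) z = 0.
Proof. by move=> hF hG; rewrite jtr_mul hF hG mul0r mulr0 addr0. Qed.

Lemma jtr_comp g g1 g2 F z : jtr (jcomp g g1 g2 F) z = g1 (jv F z) * jtr F z.
Proof. by rewrite /jtr !sum2 /=; ring. Qed.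

Lemma jtr_T z : jtr (jT R) z = 1.
Proof. by rewrite /jtr sum2 /= !mulr0 !addr0. Qed.

Lemma jtr_X i z : jtr (jX R i) z = z.2.2 i 0.
Proof.
rewrite /jtr sum2 /=; have [->|->] := ord2 i; rewrite add0r.
  by rewrite mulr1 mulr0 addr0.
by rewrite mulr1 mulr0 add0r.
Qed.

Lemma jtr_V i z : jtr (jV R i) z = 0.
Proof. by rewrite /jtr sum2 /= !mulr0 !addr0. Qed.

Lemma jtr_speed z : jtr (jspeed R) z = 0.
Proof. by rewrite jtr_comp jtr_add !jtr_mul !jtr_V !(mul0r, mulr0, addr0). Qed.

Lemma jtr_ispeed z : jtr (jispeed R) z = 0.
Proof. by rewrite jtr_comp jtr_speed mulr0. Qed.

Lemma jtr_w i z : jtr (jw R i) z = 0.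
Proof. by rewrite jtr_mul jtr_ispeed jtr_V mulr0 mul0r addr0. Qed.

Lemma jtr_beta z : jtr (jbeta R) z = 0.
Proof.
rewrite jtr_sub (jtr_mul (jX R 0)) (jtr_mul (jX R 1)) !jtr_w !jtr_X !wwE.
by rewrite !mulr0 !addr0 mulrCA mulrA subrr.
Qed.

Lemma jtr_along z : z.2.2 != 0 -> jtr (jalong R) z = jv (jspeed R) z.
Proof.
move=> v0; rewrite jtr_add (jtr_mul (jX R 0)) (jtr_mul (jX R 1)) !jtr_w !jtr_X.
rewrite !mulr0 !addr0 !wwE !mulrA -mulrDl -!expr2 -rr_sqr expr2 -mulrA.
by rewrite divff ?mulr1 // gt_eqF // rr_gt0.
Qed.

Lemma jtr_phi z : jtr (jphi R) z = 0.
Proof. by rewrite jtr_comp jtr_beta mulr0. Qed.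

Lemma jtr_cos n z : jtr (jcos n) z = 0.
Proof. by rewrite jtr_comp jtr_scale jtr_phi !mulr0. Qed.

Lemma jtr_sin n z : jtr (jsin n) z = 0.
Proof. by rewrite jtr_comp jtr_scale jtr_phi !mulr0. Qed.

Lemma jtr_U n i z : jtr (jU n i) z = 0.
Proof.
have hC i' := jtr_mul0 (jtr_cos n z) (jtr_w i' z).
have hS i' := jtr_mul0 (jtr_sin n z) (jtr_w i' z).
by rewrite /jU; case: ifP => _; rewrite ?jtr_sub ?jtr_add hC hS ?subrr ?addr0.
Qed.

Lemma jtr_sigma k z : z.2.2 != 0 -> jtr (jsigma R k) z = 0.
Proof.
move=> v0; rewrite 2!jtr_sub (jtr_mul (jT R)) jtr_scale jtr_cos jtr_along //.
by rewrite jtr_T jtr_speed !mulr0 addr0 mul1r subrr subr0.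
Qed.

(** Angles and speed are constant along the free flow, and [jsigma] is transported
    because time and position along the velocity grow together. *)
Lemma jtr_Phi k m z : (k = 0)%N \/ z.2.2 != 0 -> jtr (jPhi R k m) z = 0.
Proof.
case: k m => [|k] [i|i] h; rewrite /jPhi.
- by rewrite jtr_sub (jtr_mul (jT R)) jtr_X jtr_T jtr_V mulr0 addr0 mul1r subrr.
- exact: jtr_V.
- case: h => // v0; rewrite jtr_scale jtr_sub jtr_U jtr_mul0 ?subrr ?mulr0 //.
    exact: jtr_sigma.
  exact: jtr_U.
- by rewrite jtr_scale jtr_mul0 ?mulr0 //; [exact: jtr_speed|exact: jtr_U].
Qed.

(** All ingredients but the time itself and [jsigma] are stationary. *)
Definition stationary F := forall z, j1 F None z = 0.

Lemma stationary_add F G : stationary F -> stationary G -> stationary (jadd F G).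
Proof.
move=> hF hG z; rewrite -[LHS]/(j1 F None z + j1 G None z).
by rewrite hF hG addr0.
Qed.

Lemma stationary_scale a F : stationary F -> stationary (jscale a F).
Proof. by move=> hF z; rewrite -[LHS]/(a * j1 F None z) hF mulr0. Qed.

Lemma stationary_mul F G : stationary F -> stationary G -> stationary (jmul F G).
Proof.
move=> hF hG z; rewrite -[LHS]/(j1 F None z * jv G z + jv F z * j1 G None z).
by rewrite hF hG mul0r mulr0 addr0.
Qed.

Lemma stationary_comp g g1 g2 F : stationary F -> stationary (jcomp g g1 g2 F).
Proof.
by move=> hF z; rewrite -[LHS]/(g1 (jv F z) * j1 F None z) hF mulr0.
Qed.

Lemma stationary_X i : stationary (jX R i). Proof. by []. Qed.
Lemma stationary_V i : stationary (jV R i). Proof. by []. Qed.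

Lemma stationary_speed : stationary (jspeed R).
Proof.
by apply/stationary_comp/stationary_add; apply: stationary_mul.
Qed.

Lemma stationary_w i : stationary (jw R i).
Proof.
by apply: stationary_mul; [|apply: stationary_comp; exact: stationary_speed].
Qed.

Lemma stationary_along : stationary (jalong R).
Proof.
apply: stationary_add; apply: stationary_mul; try exact: stationary_X;
  exact: stationary_w.
Qed.

Lemma stationary_phi : stationary (jphi R).
Proof.
apply/stationary_comp/stationary_add; last apply: stationary_scale;
  apply: stationary_mul; try exact: stationary_X; exact: stationary_w.
Qed.

Lemma stationary_cos n : stationary (jcos n).
Proof. apply/stationary_comp/stationary_scale; exact: stationary_phi. Qed.

Lemma stationary_sin n : stationary (jsin n).
Proof. apply/stationary_comp/stationary_scale; exact: stationary_phi. Qed.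

Lemma stationary_U n i : stationary (jU n i).
Proof.
rewrite /jU; case: ifP => _; apply: stationary_add; try apply: stationary_scale;
apply: stationary_mul; try exact: stationary_w;
  (exact: stationary_cos || exact: stationary_sin).
Qed.

Lemma dt_sigma k z : j1 (jsigma R k) None z = jv (jspeed R) z.
Proof.
rewrite -[LHS]/(1 * jv (jspeed R) z + z.1 * j1 (jspeed R) None z +
  -1 * j1 (jalong R) None z +
  -1 * j1 (jscale (2 * k%:R - 1) (jcos 1)) None z).
rewrite stationary_speed stationary_along stationary_scale; last first.
  exact: stationary_cos.
by rewrite !mulr0 !addr0 mul1r.
Qed.

Lemma dt_Phi_pos k i z : j1 (jPhi R k (inl i)) None z = - jv (jPhi R k (inr i)) z.
Proof.
case: k => [|k]; rewrite /jPhi.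
  by rewrite /= mulr0 addr0 mul1r mulN1r add0r.
rewrite -[LHS]/((-1) ^+ k.+1 * (j1 (jU (2 * k.+1%:R - 1) i) None z +
   -1 * (j1 (jsigma R k.+1) None z * jv (jU (2 * k.+1%:R) i) z +
         jv (jsigma R k.+1) z * j1 (jU (2 * k.+1%:R) i) None z))).
rewrite !stationary_U dt_sigma mulr0 addr0 add0r mulN1r mulrN.
by rewrite jvelE.
Qed.

Lemma dt_Phi_vel k i z : j1 (jPhi R k (inr i)) None z = 0.
Proof.
case: k => [|k]; rewrite /jPhi; first exact: stationary_V.
apply/stationary_scale/stationary_mul; [exact: stationary_speed|].
exact: stationary_U.
Qed.

End Transport.

(** * The bounce cycle *)

Section Cycle.
Variable R : realType.
Local Notation vec := 'cV[R]_2.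
Local Notation phase := ('cV[R]_2 * 'cV[R]_2)%type.
Local Notation tc := (time_coords R).
Implicit Types (z : R * phase) (p q : phase) (x v : vec) (i : 'I_2) (n t : R) (k : nat).
Local Notation rr := (jv (jspeed R)).
Local Notation ww i := (jv (jw R i)).
Local Notation bb := (jv (jbeta R)).
Local Notation dd := (jv (jalong R)).
Local Notation pp := (jv (jphi R)).
Local Notation UU n i := (jv (jU n i)).
Local Notation hit k := (jv (jhit R k)).

Lemma regular_time t t' p : regular (t, p) -> regular (t', p).
Proof. by move=> [v0 b1]; split. Qed.

Lemma UU_time n i z z' : z.2 = z'.2 -> UU n i z = UU n i z'.
Proof.
case: z => t p; case: z' => t' p' /= ->.
by rewrite /jU; case: ifP.
Qed.

Lemma Phi_hit k z : regular z -> z.1 = hit k z ->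
  (forall i, (Phi k z).1 i 0 = (-1) ^+ k * UU (2 * k%:R - 1) i z) /\
  (forall i, (Phi k z).2 i 0 = (-1) ^+ k * (rr z * UU (2 * k%:R) i z)).
Proof.
move=> rz hz; have [v0 _] := rz; split=> i; last by rewrite Phi_vel.
by rewrite Phi_pos // jposE (sigmaE k v0) hz subrr mulr0 mul0r subr0.
Qed.

Lemma bounceE z : regular z -> cdisc z.2.1 ->
  bounce z = (z.1 - hit 1 z, Phi 1 (hit 1 z, z.2)).
Proof.
case: z => t [x v] rz xd; rewrite /bounce -(tbE rz xd) /=.
set s := tb x v; have hs : s = hit 1 (s, (x, v)) by rewrite /s (tbE rz xd).
have rs : regular (s, (x, v)) by exact: regular_time rz.
have [_ _ ->] := Phi_bounce (k := 0) rs hs.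
have E : Phi 0 (s, (x, v)) = (xb x v, v).
  congr (_, _); apply/matrixP => i j; rewrite ord1 !mxE //=.
  by rewrite mulN1r.
by rewrite E.
Qed.

Lemma UU_cross z n m : z.2.2 != 0 ->
  UU n 0 z * UU m 1 z - UU n 1 z * UU m 0 z = sin ((m - n) * pp z).
Proof.
move=> /ww_unit; rewrite mulrBl sinB !UU0 !UU1.
move: (ww 0 z) (ww 1 z) (cos (n * pp z)) (sin (n * pp z)) (cos (m * pp z))
  (sin (m * pp z)) => a b c s c' s' u.
rewrite -[RHS]mulr1 -u; ring.
Qed.

(** Angle and speed are constants of the motion; this makes the explicit formula
    for the bounces iterable. *)
Lemma Phi_hit_angles k z t : regular z -> z.1 = hit k z ->
  let y := (t, Phi k z) in
  [/\ regular y, circle y.2.1, rr y = rr z, pp y = pp z & dd y = cphi z] /\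
  forall n i, UU n i y = (-1) ^+ k * UU (n + 2 * k%:R) i z.
Proof.
move=> rz hz y; have [v0 b1] := rz; have r0 := rr_gt0 v0.
have [HX HV] := Phi_hit rz hz; set m := 2 * k%:R in HX HV *.
have sg := sign_sqr R k; set g := (-1) ^+ k in HX HV sg *.
have u1 := UU_unit m v0; have u2 := UU_unit (m - 1) v0.
have r2 : rr y ^+ 2 = rr z ^+ 2.
  rewrite rr_sqr !HV.
  transitivity (g * g * (rr z ^+ 2) * (UU m 0 z ^+ 2 + UU m 1 z ^+ 2)).
    by move: (UU m 0 z) (UU m 1 z) (rr z) => *; ring.
  by rewrite sg u1 mul1r mulr1.
have v'0 : y.2.2 != 0.
  rewrite -enorm_gt0 -jspeedE lt_def jspeedE enorm_ge0 andbT -jspeedE.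
  by rewrite -sqrf_eq0 r2 sqrf_eq0 gt_eqF.
have ry : rr y = rr z.
  apply/eqP; rewrite -(eqrXn2 (n := 2)) ?r2 //; last exact: ltW.
  by rewrite jspeedE enorm_ge0.
have wy i : ww i y = g * UU m i z.
  rewrite wwE HV ry; move: (UU m i z) (rr z) r0 => u r r0.
  by field; rewrite gt_eqF.
have by' : bb y = bb z.
  rewrite bbE !HX !wy.
  transitivity (g * g * (UU (m - 1) 0 z * UU m 1 z - UU (m - 1) 1 z * UU m 0 z)).
    by move: (UU m 0 z) (UU m 1 z) (UU (m - 1) 0 z) (UU (m - 1) 1 z) => *; ring.
  have E : m - (m - 1) = 1 by ring.
  by rewrite UU_cross // sg mul1r E mul1r sin_phi.
have py : pp y = pp z by rewrite -[LHS]/(asin (bb y)) by'.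
have dy : dd y = cphi z.
  rewrite ddE !HX !wy.
  transitivity (g * g * (UU (m - 1) 0 z * UU m 0 z + UU (m - 1) 1 z * UU m 1 z)).
    by move: (UU m 0 z) (UU m 1 z) (UU (m - 1) 0 z) (UU (m - 1) 1 z) => *; ring.
  have E : m - 1 - m = - 1 by ring.
  by rewrite UU_dot // sg mul1r E mulN1r cosN.
split.
  split=> //; first by split=> //; rewrite by'.
  apply/circleE; rewrite dotE !HX.
  transitivity (g * g * (UU (m - 1) 0 z ^+ 2 + UU (m - 1) 1 z ^+ 2)).
    by move: (UU (m - 1) 0 z) (UU (m - 1) 1 z) => *; ring.
  by rewrite sg u2 mul1r.
move=> n i; have [->|->] := ord2 i; rewrite ?UU0 ?UU1 !wy ?UU0 ?UU1 py mulrDl.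
  rewrite cosD sinD; move: (ww 0 z) (ww 1 z) (cos (n * pp z)) (sin (n * pp z))
    (cos (m * pp z)) (sin (m * pp z)) => *; ring.
rewrite cosD sinD; move: (ww 0 z) (ww 1 z) (cos (n * pp z)) (sin (n * pp z))
    (cos (m * pp z)) (sin (m * pp z)) => *; ring.
Qed.

(** Each further bounce adds the duration of one full chord and a rotation by
    twice the angle. *)
Lemma bcycleE k z : regular z -> cdisc z.2.1 ->
  bcycle k.+1 z.1 z.2.1 z.2.2 =
  (z.1 - hit k.+1 z, Phi k.+1 (hit k.+1 z, z.2)).
Proof.
case: z => t p rz xd; elim: k => [|k IH].
  have E : (t, p) = (t, (p.1, p.2)) by rewrite -surjective_pairing.
  by rewrite -[LHS]/(bounce (t, (p.1, p.2))) -E bounceE.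
rewrite /bcycle iterS -/(bcycle k.+1 t p.1 p.2) {}IH.
set s := hit k.+1 (t, p); set s' := hit k.+2 (t, p).
have rs : regular (s, p) by exact: regular_time rz.
have rs' : regular (s', p) by exact: regular_time rz.
have [[ry cy ry' py dy] Uy] := Phi_hit_angles (t - s) rs erefl.
set y := (t - s, _) in ry cy ry' py dy Uy *.
have cd : cdisc y.2.1 by rewrite cdiscE; move/circleE: cy => ->.
rewrite bounceE //; have cphy : cphi y = cphi (s, p) by rewrite /cphi py.
have h1 : hit 1 y = 2 * cphi (s, p) / rr (s, p).
  by rewrite hitE dy cphy ry' mulr1; congr (_ / _); ring.
have E1 : s' = s + hit 1 y by rewrite /s' hit_succ h1.
congr (_, _); first by rewrite E1 opprD addrA.
have rh : regular (hit 1 y, y.2) by exact: regular_time ry.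
have [A1 A2] := Phi_hit rh erefl.
have [B1 B2] := Phi_hit rs' erefl.
have n1 : 2 * k.+2%:R = 2 + 2 * k.+1%:R :> R by rewrite [k.+2%:R]mulrS; ring.
have U' n i : UU n i (hit 1 y, y.2) = (-1) ^+ k.+1 * UU (n + 2 * k.+1%:R) i (s, p).
  by rewrite (@UU_time n i _ y) //; exact: Uy.
have U'' n i : UU n i (s', p) = UU n i (s, p) by exact: UU_time.
apply: (@co_inj _ _ _ _ (phase_coords R)) => -[i|i].
  rewrite -[LHS]/((Phi 1 (hit 1 y, y.2)).1 i 0) -[RHS]/((Phi k.+2 (s', p)).1 i 0).
  rewrite A1 B1 U' U'' n1 [(-1) ^+ k.+2]exprS expr1 mulrA.
  by congr (_ * UU _ i _); ring.
rewrite -[LHS]/((Phi 1 (hit 1 y, y.2)).2 i 0) -[RHS]/((Phi k.+2 (s', p)).2 i 0).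
have rE : rr (hit 1 y, y.2) = rr (s', p) by rewrite -[LHS]/(rr y) ry'.
rewrite A2 B2 U' U'' n1 rE [(-1) ^+ k.+2]exprS expr1 mulr1.
by rewrite -!mulrA; congr (_ * _); rewrite mulrCA.
Qed.

(** The initial piece has no lower time bound: [hit 0 z] is not positive if [z] is
    in the closed disc. *)
Definition in_piece k z : bool :=
  ((k == 0%N) || (hit k z <= z.1)) && (z.1 < hit k.+1 z).

(** Without velocity there is no bounce, and the cycle is meaningless. *)
Definition kappa z : nat :=
  if z.2.2 == 0 then 0%N else bounce_index 0 z.1 z.2.1 z.2.2.

Lemma in_piece_uniq k k' z : regular z -> in_piece k z -> in_piece k' z -> k = k'.
Proof.
move=> rz.
suff H j j' : in_piece j z -> in_piece j' z -> (j <= j')%N.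
  by move=> h h'; apply/eqP; rewrite eqn_leq !H.
move=> /andP[a _] /andP[_ b]; case: leqP => // lt.
case: j a lt => //= j; rewrite leNgt => /negP a lt.
by case: a; rewrite (lt_le_trans b) // hit_le.
Qed.

Lemma in_piece_ex z : regular z -> 0 <= z.1 -> exists k, in_piece k z.
Proof.
move=> rz t0; have [v0 _] := rz; have r0 := rr_gt0 v0; have c0 := cphi_gt0 rz.
have ex : exists k, z.1 < hit k.+1 z.
  pose B := (rr z * z.1 - dd z) / (2 * cphi z).
  exists (Num.trunc `|B|).+1; have := truncnS_gt `|B|; set N := Num.trunc _ => h.
  have {}h : B < N.+1%:R by rewrite (le_lt_trans (ler_norm _)).
  rewrite hitE ltr_pdivlMr // mulrC.
  move: h; rewrite /B ltr_pdivrMr ?mulr_gt0 // [N.+2%:R]mulrS.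
  move: (N.+1%:R : R) (z.1) (rr z) (dd z) (cphi z) c0 => n t r d c c0.
  nra.
have [k hk mk] := ex_minnP ex; exists k; rewrite /in_piece hk andbT.
case: k hk mk => //= k _ mk; rewrite leNgt; apply/negP => /mk.
by rewrite ltnn.
Qed.

Lemma bcycle_piece k z : regular z -> cdisc z.2.1 -> 0 <= z.1 ->
  (bcycle k.+1 z.1 z.2.1 z.2.2).1 < 0 <= (bcycle k z.1 z.2.1 z.2.2).1
    = in_piece k z.
Proof.
move=> rz xd t0; rewrite bcycleE // /in_piece /= subr_lt0 andbC; congr (_ && _).
by case: k => [|k]; rewrite ?t0 // bcycleE //= subr_ge0.
Qed.

Lemma bounce_indexE k z : regular z -> cdisc z.2.1 -> 0 <= z.1 -> in_piece k z ->
  bounce_index 0 z.1 z.2.1 z.2.2 = k.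
Proof.
move=> rz xd t0 kz; rewrite /bounce_index; set P := [set _ | _].
have Pk : P k by rewrite /P /= bcycle_piece.
have := getI Pk; rewrite /P /= bcycle_piece // => h.
exact: in_piece_uniq rz h kz.
Qed.

Lemma kappaE k z : regular z -> cdisc z.2.1 -> 0 <= z.1 -> in_piece k z ->
  kappa z = k.
Proof.
move=> rz; have [v0 _] := rz => xd t0 kz; rewrite /kappa (negbTE v0).
exact: bounce_indexE.
Qed.

Lemma time_dom_regular z : time_dom z -> z.2.2 != 0 -> regular z.
Proof. by case: z => t [x v] [_ h] v0; exact: phase_reg_regular. Qed.

Lemma time_dom_cdisc z : time_dom z -> cdisc z.2.1.
Proof. by move=> [_ []]. Qed.

Lemma time_dom_kappa z : time_dom z -> z.2.2 != 0 -> in_piece (kappa z) z.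
Proof.
move=> dz v0; have rz := time_dom_regular dz v0.
have [k kz] := in_piece_ex rz dz.1.
by rewrite (kappaE rz (time_dom_cdisc dz) dz.1 kz).
Qed.

Lemma kappa_in_piece k z : time_dom z -> regular z -> in_piece k z ->
  kappa z = k.
Proof. by move=> dz rz; apply: kappaE => //; [exact: time_dom_cdisc|exact: dz.1]. Qed.

Lemma time_dom_v0 z : time_dom z -> z.2.2 = 0 -> disc z.2.1.
Proof.
move=> [_ [h ng]] v0; rewrite discE lt_neqAle.
have {}h : cdisc z.2.1 := h; rewrite cdiscE in h; rewrite h andbT.
apply/eqP => E; apply: ng; split=> /=; first exact/circleE.
by rewrite v0 dotE !mxE !mul0r addr0.
Qed.

Lemma Phi0E z : Phi 0 z = (z.2.1 - z.1 *: z.2.2, z.2.2).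
Proof.
by congr (_, _); apply/matrixP => i j; rewrite ord1 !mxE //= mulN1r.
Qed.

(** Each piece continues the straight motion from the last bounce point. *)
Lemma char_solE (f0 : phase -> R) z : time_dom z ->
  char_sol f0 z = f0 (Phi (kappa z) z).
Proof.
move=> dz; have [v0|v0] := eqVneq z.2.2 0.
  move: v0 {dz}; rewrite /kappa; case: z => t [x v] /= ->.
  by rewrite eqxx Phi0E /= /Xchar /Vchar eqxx scaler0 subr0.
have rz := time_dom_regular dz v0; have xd := time_dom_cdisc dz.
have kz := time_dom_kappa dz v0; have iE := bounce_indexE rz xd dz.1 kz.
move: kz iE; rewrite {1}/char_sol; move: (kappa z) => k kz iE.
rewrite (_ : (let: (t, (x, v)) := z in f0 (Xchar 0 t x v, Vchar 0 t x v)) =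
  f0 (Xchar 0 z.1 z.2.1 z.2.2, Vchar 0 z.1 z.2.1 z.2.2)); last by case: (z) => ? [].
congr f0; rewrite /Xchar /Vchar (negbTE v0) iE {kz iE}.
set Y := bcycle k _ _ _.
have -> : (let: (tk, (xk, vk)) := Y in xk - (tk - 0) *: vk) =
    Y.2.1 - (Y.1 - 0) *: Y.2.2 by case: (Y) => ? [].
rewrite {}/Y; case: k => [|k]; first by rewrite Phi0E /bcycle /= subr0.
rewrite bcycleE // subr0.
have rs : regular (hit k.+1 z, z.2) by apply: (@regular_time z.1); case: (z) rz.
have [A1 A2] := Phi_hit (k := k.+1) rs erefl.
apply: (@co_inj _ _ _ _ (phase_coords R)) => -[i|i].
  rewrite -[RHS]/((Phi k.+1 z).1 i 0) Phi_pos // jposE (sigmaE k.+1 v0).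
  transitivity ((Phi k.+1 (hit k.+1 z, z.2)).1 i 0 - (z.1 - hit k.+1 z) *
    (Phi k.+1 (hit k.+1 z, z.2)).2 i 0).
    move: (Phi k.+1 (hit k.+1 z, z.2)) (z.1 - hit k.+1 z) => P s.
    by rewrite /= !mxE.
  rewrite A1 A2.
  have E1 n : UU n i (hit k.+1 z, z.2) = UU n i z by exact: UU_time.
  have E2 : rr (hit k.+1 z, z.2) = rr z by [].
  rewrite !E1 E2; move: (UU (2 * k.+1%:R - 1) i z) (UU (2 * k.+1%:R) i z)
    ((-1) ^+ k.+1) (rr z) (hit k.+1 z) => a b g r h.
  ring.
rewrite -[RHS]/((Phi k.+1 z).2 i 0) Phi_vel // jvelE.
rewrite -[LHS]/((Phi k.+1 (hit k.+1 z, z.2)).2 i 0) A2.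
by rewrite (@UU_time _ i _ z).
Qed.

Lemma Phi_kappa_dom z : time_dom z -> phase_dom (Phi (kappa z) z).
Proof.
move=> dz; have [v0|v0] := eqVneq z.2.2 0.
  rewrite /kappa v0 eqxx Phi0E v0 scaler0 subr0.
  exact: time_dom_cdisc dz.
have rz := time_dom_regular dz v0; have xd := time_dom_cdisc dz.
have /andP[h1 h2] := time_dom_kappa dz v0.
apply: Phi_dom => //; rewrite (ltW h2) andbT.
case/orP: h1 => // /eqP->; exact: le_trans (hit0_le0 rz xd) dz.1.
Qed.

Lemma regular_near z : regular z -> \forall y \near z, regular y.
Proof.
move=> rz; have [v0 b1] := rz.
have cb : (fun y => bb y ^+ 2) @ z --> bb z ^+ 2.
  have h := jet_ok_cvg (jbeta_ok v0).
  by rewrite expr2; under eq_fun do rewrite expr2; exact: cvgM.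
have cr := jet_ok_cvg (jspeed_ok v0).
have r0 := rr_gt0 v0.
have n1 : \forall y \near z, bb y ^+ 2 < 1 by move/cvgr_lt: cb; apply.
have n2 : \forall y \near z, 0 < rr y by move/cvgr_gt: cr; apply.
apply: filterS2 n1 n2 => y hy; rewrite jspeedE enorm_gt0 => vy.
by split.
Qed.

Lemma Phi_cvg k z : (k = 0)%N \/ regular z -> Phi k @ z --> Phi k z.
Proof.
move=> hk; apply/cvgrPdist_le => eps e0.
have : \forall y \near z, forall m, `|jv (jPhi R k m) z - jv (jPhi R k m) y| <= eps.
  apply: (@filter_forall _ ('I_2 + 'I_2)%type
    (fun m y => `|jv (jPhi R k m) z - jv (jPhi R k m) y| <= eps) _
    (nbhs_filter z)) => m.
  have := jet_ok_cvg (jPhi_ok m hk).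
  by move/cvgrPdist_le; apply.
apply: filterS => y hy.
apply: (norm_co (c := phase_coords R)); last exact: ltW.
move=> m; rewrite coB; move: (hy m).
by case: m {hy} => i; rewrite /= !mxE.
Qed.

(** The bounce times are continuous, so the pieces met near [z] are its own and,
    on a hitting surface, the preceding one.  For zero velocity the point is in
    the open disc, and slow motions do not reach the circle. *)
Lemma kappa_local z : time_dom z ->
  [/\ (kappa z = 0)%N \/ regular z &
   \forall y \near z, time_dom y -> kappa y = kappa z] \/
  exists k, [/\ kappa z = k.+1, regular z, z.1 = hit k.+1 z &
    \forall y \near z, time_dom y -> kappa y = k.+1 \/ kappa y = k].
Proof.
move=> dz; have [v0|v0] := eqVneq z.2.2 0.
  left; have k0 : kappa z = 0%N by rewrite /kappa v0 eqxx.
  split; first by left.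
  have D : disc (Phi 0 z).1 by rewrite Phi0E v0 scaler0 subr0; exact: time_dom_v0.
  have nD := Phi_cvg (k := 0) (z := z) (or_introl erefl) (disc_near D).
  have {}nD : \forall y \near z, disc (Phi 0 y).1 := nD.
  apply: filterS nD => y Dy dy; rewrite k0.
  have [w0|w0] := eqVneq y.2.2 0; first by rewrite /kappa w0 eqxx.
  have ry := time_dom_regular dy w0.
  apply: kappa_in_piece => //.
  rewrite /in_piece eqxx /=.
  by move: Dy; rewrite Phi0E /= => /(line_in_disc _ ry)/andP[].
have rz := time_dom_regular dz v0.
have /andP[h1 h2] := time_dom_kappa dz v0.
have ct : (fun y : R * phase => y.1) @ z --> z.1 by exact: cvg_fst.
have ch k : (fun y => hit k y) @ z --> hit k z.
  exact: jet_ok_cvg (jhit_ok k rz).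
have cd k : (fun y => y.1 - hit k y) @ z --> z.1 - hit k z.
  exact: cvgB.
have nlt k : z.1 < hit k z -> \forall y \near z, y.1 < hit k y.
  rewrite -subr_lt0 => h; move/cvgr_lt: (cd k) => /(_ _ h).
  by apply: filterS => y; rewrite subr_lt0.
have ngt k : hit k z < z.1 -> \forall y \near z, hit k y < y.1.
  rewrite -subr_gt0 => h; move/cvgr_gt: (cd k) => /(_ _ h).
  by apply: filterS => y; rewrite subr_gt0.
have nr := regular_near rz; have n2 := nlt _ h2.
move: h1 h2 n2; move kE : (kappa z) => k h1 h2 n2.
have [k0|k1] := eqVneq k 0%N.
  left; split; first by left.
  rewrite k0 in n2 *; apply: filterS2 nr n2 => y ry hy dy.
  exact: kappa_in_piece.
rewrite (negbTE k1) /= le_eqVlt in h1.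
case/orP: h1 => [/eqP h1|h1]; last first.
  left; split; first by right.
  apply: filterS3 nr n2 (ngt _ h1) => y ry hy hy' dy.
  apply: kappa_in_piece => //.
  by rewrite /in_piece hy (ltW hy') orbT.
right; case: k k1 kE h1 h2 n2 => // k _ kE h1 h2 n2; exists k; split=> //.
have n3 : \forall y \near z, (k == 0)%N || (hit k y <= y.1).
  case: k {kE h2 n2} h1 => [|k] h1; first by near=> y.
  have := ngt k.+1; rewrite -h1 hit_lt // => /(_ isT).
  by apply: filterS => y /ltW ->; rewrite orbT.
apply: filterS3 nr n2 n3 => y ry hy hy' dy.
have [h|h] := leP (hit k.+1 y) y.1; [left|right].
  apply: kappa_in_piece => //.
  by rewrite /in_piece h hy.
apply: kappa_in_piece => //.
by rewrite /in_piece h hy'.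
Unshelve. all: by end_near. Qed.
End Cycle.

(** * Size of the derivatives of the pieces *)

Section BilliardBounds.
Variable R : realType.
Local Notation phase := ('cV[R]_2 * 'cV[R]_2)%type.
Local Notation J := (option ('I_2 + 'I_2)).
Variables (z : R * phase) (k : nat).
Implicit Types (i : 'I_2) (j l : J) (n : R).
Local Notation r := (jv (jspeed R) z).
Local Notation hit k := (jv (jhit R k)).
Hypotheses (rz : regular z) (xd : cdisc z.2.1).
Let v0 : z.2.2 != 0 := rz.1.
Let r0 : 0 < r := rr_gt0 v0.

Lemma norm_sqr_le (a s : R) : 0 <= s -> a ^+ 2 <= s ^+ 2 -> `|a| <= s.
Proof. by move=> s0; rewrite -ler_sqrt ?sqr_ge0 // !sqrtr_sqr (ger0_norm s0). Qed.

Lemma v_le i : `|z.2.2 i 0| <= r.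
Proof.
apply: norm_sqr_le; first exact: ltW.
have [->|->] := ord2 i; rewrite rr_sqr.
  by rewrite lerDl sqr_ge0.
by rewrite lerDr sqr_ge0.
Qed.

Lemma x_le i : `|z.2.1 i 0| <= 1.
Proof.
apply: norm_sqr_le => //; move: xd; rewrite cdiscE dotE expr1n -!expr2 => h.
have := sqr_ge0 (z.2.1 0 0); have := sqr_ge0 (z.2.1 1 0).
by have [->|->] := ord2 i; lra.
Qed.

Lemma norm_delta (a b : J) : `|(a == b)%:R| <= 1 :> R.
Proof. by case: eqP => _; rewrite ?normr1 ?normr0. Qed.

Lemma jV_le i : jet_le z (2 / r) ((2 / r) ^+ 2) r (jV R i).
Proof.
split; first exact: v_le.
split=> [j|j l] /=; last by rewrite normr0 mulr_ge0 ?sqr_ge0 ?(ltW r0).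
rewrite (le_trans (norm_delta _ _)) // mulrCA divff ?gt_eqF // mulr1.
by rewrite ler1n.
Qed.

Lemma speed2_1 j : `|j1 (jadd (jmul (jV R 0) (jV R 0)) (jmul (jV R 1) (jV R 1))) j z|
  <= 2 * r.
Proof.
have H i : `|2 * z.2.2 i 0| <= 2 * r by rewrite normrM ger0_norm // ler_wpM2l // v_le.
have r2 : 0 <= 2 * r by rewrite mulr_ge0 // ltW.
case: j => [[i|i]|] /=; rewrite ?(mul0r, mulr0, addr0, normr0) //.
have [->|->] := ord2 i; rewrite /= !(mul0r, mulr0, mul1r, mulr1, addr0, add0r).
  by have := H 0; rewrite mulr_natl mulr2n.
by have := H 1; rewrite mulr_natl mulr2n.
Qed.

Lemma speed2_2 j l :
  `|j2 (jadd (jmul (jV R 0) (jV R 0)) (jmul (jV R 1) (jV R 1))) j l z| <= 2.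
Proof.
case: j l => [[i|i]|] [[i'|i']|] /=; rewrite ?(mul0r, mulr0, addr0, normr0) //.
have [->|->] := ord2 i; have [->|->] := ord2 i';
  rewrite /= ?(mul0r, mulr0, mul1r, mulr1, addr0, add0r, normr0) //;
  by rewrite ger0_norm.
Qed.

Lemma sqrt1_speed : sqrt1 (jv (jadd (jmul (jV R 0) (jV R 0)) (jmul (jV R 1) (jV R 1))) z)
  = (2 * r)^-1.
Proof. by []. Qed.

Lemma speed_1 j : `|j1 (jspeed R) j z| <= 1.
Proof.
rewrite -[j1 _ j z]/(sqrt1 (jv (jadd (jmul (jV R 0) (jV R 0)) (jmul (jV R 1) (jV R 1))) z)
   * j1 (jadd (jmul (jV R 0) (jV R 0)) (jmul (jV R 1) (jV R 1))) j z).
rewrite sqrt1_speed normrM ger0_norm ?invr_ge0 ?mulr_ge0 ?(ltW r0) //.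
by rewrite ler_pdivrMl ?mulr_gt0 // mulr1 speed2_1.
Qed.

Lemma speed_2 j l : `|j2 (jspeed R) j l z| <= 2 / r.
Proof.
set F := jadd (jmul (jV R 0) (jV R 0)) (jmul (jV R 1) (jV R 1)).
rewrite -[j2 _ j l z]/(sqrt2 (jv F z) * j1 F l z * j1 F j z +
   sqrt1 (jv F z) * j2 F j l z).
rewrite /sqrt2 sqrt1_speed.
have ir0 : 0 < (2 * r)^-1 by rewrite invr_gt0 mulr_gt0.
have h1 : `|j1 F l z * j1 F j z| <= (2 * r) * (2 * r).
  by rewrite normrM ler_pM // speed2_1.
have h2 := speed2_2 j l; rewrite -/F in h2.
rewrite -mulrA mulNr (le_trans (ler_normD _ _)) // normrN !normrM.
rewrite !(gtr0_norm ir0) (ger0_norm (_ : 0 <= 2)) //.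
rewrite normrM in h1.
have i2 : (2 * r)^-1 * (2 * r) = 1 by rewrite mulVf // gt_eqF // mulr_gt0.
rewrite (_ : 2 / r = 2 * ((2 * r)^-1 * (2 * r)^-1 * (2 * r)^-1) *
  ((2 * r) * (2 * r)) + (2 * r)^-1 * 2); last first.
  by field; rewrite gt_eqF.
by apply: lerD; apply: ler_wpM2l => //; rewrite ?mulr_ge0 ?(ltW ir0).
Qed.

Lemma ispeed_le : jet_le z (2 / r) ((2 / r) ^+ 2) r^-1 (jispeed R).
Proof.
have i0 : 0 < r^-1 by rewrite invr_gt0.
split; first by rewrite -[jv _ z]/(r^-1) gtr0_norm.
split=> [j|j l].
  rewrite -[j1 _ j z]/(- (r^-1 * r^-1) * j1 (jspeed R) j z) mulNr normrN.
  have := speed_1 j; move: (j1 (jspeed R) j z) r^-1 i0 => a p p0 ha.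
  rewrite normrM ger0_norm ?mulr_ge0 ?(ltW p0) //.
  have -> : p * (2 * p) = p * p * 2 by ring.
  rewrite ler_wpM2l ?mulr_ge0 ?(ltW p0) // (le_trans ha) //.
  by rewrite ler1n.
rewrite -[j2 _ j l z]/(2 * (r^-1 * r^-1 * r^-1) * j1 (jspeed R) l z *
   j1 (jspeed R) j z + - (r^-1 * r^-1) * j2 (jspeed R) j l z).
have := speed_1 j; have := speed_1 l; have := speed_2 j l.
move: (j1 (jspeed R) l z) (j1 (jspeed R) j z) (j2 (jspeed R) j l z).
move: r^-1 i0 => p p0 a b d hd ha hb.
have pp0 : 0 <= p * p by rewrite mulr_ge0 ?(ltW p0).
have ppp0 : 0 <= 2 * (p * p * p) by rewrite !mulr_ge0 ?(ltW p0).
have -> : p * (2 * p) ^+ 2 = 2 * (p * p * p) * 1 + p * p * (2 * p) by ring.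
rewrite (le_trans (ler_normD _ _)) // mulNr normrN; apply: lerD; last first.
  by rewrite normrM (ger0_norm pp0) ler_wpM2l.
rewrite -mulrA normrM (ger0_norm ppp0) ler_wpM2l // normrM.
by rewrite -[leRHS]mulr1 ler_pM.
Qed.

(** One derivative of the direction costs [b], one of the angle [c]; the
    latter contains the derivative [mu] of the arcsine, and the second derivative
    of the angle contains a further factor [mu].  All multiples of the angle that
    occur are at most [kap], whence [A] and [W] for one and two derivatives. *)
Variables (b c A W kap mu : R).
Hypotheses (b2 : 2 <= b) (br : 2 / r <= b) (mu1 : 1 <= mu)
  (muE : (cphi z)^-1 = mu) (cE : c = 64 * mu * b) (kap2 : 2 <= kap)
  (AE : A = kap * c) (WE : W = kap * (kap + mu) * c ^+ 2).

Let b0 : 0 <= b. Proof. by rewrite (le_trans _ b2). Qed.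
Let bc : b <= c.
Proof. by rewrite cE ler_peMl // (le_trans mu1) // ler_peMl ?ler1n // (le_trans _ mu1). Qed.
Let c0 : 0 <= c. Proof. exact: le_trans bc. Qed.
Let kap0 : 0 <= kap. Proof. by rewrite (le_trans _ kap2). Qed.
Let mu0 : 0 <= mu. Proof. by rewrite (le_trans _ mu1). Qed.
Let cA : c <= A. Proof. by rewrite AE ler_peMl // (le_trans _ kap2) // ler1n. Qed.
Let bA : b <= A. Proof. exact: le_trans bc cA. Qed.
Let A0 : 0 <= A. Proof. exact: le_trans bA. Qed.
Let AW : A ^+ 2 <= W.
Proof.
rewrite WE AE exprMn ler_wpM2r ?sqr_ge0 // expr2 ler_wpM2l //.
by rewrite lerDl.
Qed.
Let W0 : 0 <= W. Proof. by rewrite (le_trans _ AW) // sqr_ge0. Qed.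
Let bW : b ^+ 2 <= W.
Proof. by rewrite (le_trans _ AW) // lerXn2r. Qed.
Let A1 : 1 <= A. Proof. by rewrite (le_trans _ bA) // (le_trans _ b2) // ler1n. Qed.
Let W2 : 2 <= W.
Proof.
rewrite (le_trans _ bW) // (le_trans b2) // expr2 ler_peMl //.
by rewrite (le_trans _ b2) // ler1n.
Qed.

Lemma jw_le i : jet_le z b (b ^+ 2) 4 (jw R i).
Proof.
have ir : 0 <= 2 / r by rewrite divr_ge0 // ltW.
have h := jet_le_mul (lexx _) ir (jV_le i) ispeed_le.
rewrite mulfV ?gt_eqF // mulr1 in h.
apply: jet_le_mono h => //; first exact: sqr_ge0.
by rewrite lerXn2r.
Qed.

Lemma jX_le i : jet_le z b (b ^+ 2) 1 (jX R i).
Proof.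
split; first exact: x_le.
split=> [j|j l] /=; last by rewrite normr0 mul1r sqr_ge0.
by rewrite (le_trans (norm_delta _ _)) // mul1r (le_trans _ b2) // ler1n.
Qed.

Lemma jbeta_le : jet_le z b (b ^+ 2) 32 (jbeta R).
Proof.
have h i i' := jet_le_mul (lexx _) b0 (jX_le i) (jw_le i').
have := jet_le_add (h 0 1) (jet_le_scale (-1) (h 1 0)).
rewrite normrN normr1; apply: jet_le_mono => //; first exact: sqr_ge0.
by lra.
Qed.

Lemma jalong_le : jet_le z b (b ^+ 2) 32 (jalong R).
Proof.
have h i i' := jet_le_mul (lexx _) b0 (jX_le i) (jw_le i').
have := jet_le_add (h 0 0) (h 1 1).
apply: jet_le_mono => //; first exact: sqr_ge0.
by lra.
Qed.

Lemma phi_1 j : `|j1 (jphi R) j z| <= c.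
Proof.
rewrite -[j1 _ j z]/(asin1 (jv (jbeta R) z) * j1 (jbeta R) j z).
rewrite asin1_phi // muE normrM (ger0_norm mu0) cE.
have [_ [h _]] := jbeta_le.
rewrite (le_trans (ler_wpM2l mu0 (h j))) //.
by move: (mulr_ge0 mu0 b0); lra.
Qed.

Lemma phi_2 j l : `|j2 (jphi R) j l z| <= mu * c ^+ 2.
Proof.
rewrite -[j2 _ j l z]/(jv (jbeta R) z * (asin1 (jv (jbeta R) z) *
   asin1 (jv (jbeta R) z) * asin1 (jv (jbeta R) z)) * j1 (jbeta R) l z *
   j1 (jbeta R) j z + asin1 (jv (jbeta R) z) * j2 (jbeta R) j l z).
rewrite asin1_phi // muE.
have [_ [h1 h2]] := jbeta_le; have := h2 j l; have := h1 j; have := h1 l.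
have : `|jv (jbeta R) z| <= 1.
  by have := bb_itv rz; rewrite ler_norml.
move: (jv (jbeta R) z) (j1 (jbeta R) l z) (j1 (jbeta R) j z) (j2 (jbeta R) j l z).
move=> s a a' d hs ha ha' hd.
rewrite (le_trans (ler_normD _ _)) // !normrM !(ger0_norm mu0).
have mu3 : 0 <= mu * mu * mu by rewrite !mulr_ge0.
have bb0 : 0 <= b ^+ 2 by exact: sqr_ge0.
have h3 : `|s| * (mu * mu * mu) * `|a| * `|a'| <= mu * mu * mu * (32 * b * (32 * b)).
  rewrite -[leLHS]mulrA; apply: ler_pM => //.
  - by rewrite mulr_ge0.
  - by rewrite ler_piMl.
  - exact: ler_pM.
have h4 : mu * `|d| <= mu * (32 * b ^+ 2) by rewrite ler_wpM2l.
have h5 : mu * (32 * b ^+ 2) <= mu * mu * mu * (32 * b ^+ 2).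
  by rewrite ler_wpM2r ?mulr_ge0 // -[leLHS]mul1r ler_wpM2r // mulr_ege1.
have h6 : 0 <= mu * mu * mu * b ^+ 2 by exact: mulr_ge0.
have -> : mu * c ^+ 2 = 4096 * (mu * mu * mu * b ^+ 2) by rewrite cE; ring.
move: h3 h4 h5 h6; have -> : mu * mu * mu * (32 * b * (32 * b)) =
  1024 * (mu * mu * mu * b ^+ 2) by ring.
have -> : mu * mu * mu * (32 * b ^+ 2) = 32 * (mu * mu * mu * b ^+ 2) by ring.
by lra.
Qed.

Let trig_le n s s' : `|n| <= kap -> `|s| <= 1 -> `|s'| <= 1 ->
  (forall j, `|s * (n * j1 (jphi R) j z)| <= A) /\
  (forall j l, `|s' * (n * j1 (jphi R) l z) * (n * j1 (jphi R) j z) +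
     s * (n * j2 (jphi R) j l z)| <= W).
Proof.
move=> hn hs hs'.
have F1 j : `|n * j1 (jphi R) j z| <= kap * c.
  by rewrite normrM; apply: ler_pM => //; exact: phi_1.
have F2 j l : `|n * j2 (jphi R) j l z| <= kap * (mu * c ^+ 2).
  by rewrite normrM; apply: ler_pM => //; exact: phi_2.
have kc : 0 <= kap * c by exact: mulr_ge0.
split=> [j|j l].
  by rewrite normrM AE -[leRHS]mul1r; apply: ler_pM.
rewrite (le_trans (ler_normD _ _)) // -mulrA.
have -> : W = 1 * ((kap * c) * (kap * c)) + 1 * (kap * (mu * c ^+ 2)).
  by rewrite WE; ring.
apply: lerD; rewrite normrM; apply: ler_pM => //.
by rewrite normrM; apply: ler_pM.
Qed.

Lemma jcos_le n : `|n| <= kap -> jet_le z A W 1 (jcos n).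
Proof.
move=> hn; have h x : `|cos x| <= 1 :> R by rewrite ler_norml cos_geN1 cos_le1.
have h' x : `|- sin x| <= 1 :> R by rewrite normrN ler_norml sin_geN1 sin_le1.
split; first exact: h.
have h'' x : `|- cos x| <= 1 :> R by rewrite normrN.
have [t1 t2] := trig_le hn (h' (n * jv (jphi R) z)) (h'' (n * jv (jphi R) z)).
by split=> [j|j l]; rewrite mul1r; [exact: t1|exact: t2].
Qed.

Lemma jsin_le n : `|n| <= kap -> jet_le z A W 1 (jsin n).
Proof.
move=> hn; have h x : `|cos x| <= 1 :> R by rewrite ler_norml cos_geN1 cos_le1.
have h' x : `|sin x| <= 1 :> R by rewrite ler_norml sin_geN1 sin_le1.
split; first exact: h'.
have h'' x : `|- sin x| <= 1 :> R by rewrite normrN.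
have [t1 t2] := trig_le hn (h (n * jv (jphi R) z)) (h'' (n * jv (jphi R) z)).
by split=> [j|j l]; rewrite mul1r; [exact: t1|exact: t2].
Qed.

Lemma jU_le n i : `|n| <= kap -> jet_le z A W 32 (jU n i).
Proof.
move=> hn.
have hw i' : jet_le z A W 4 (jw R i') by apply: jet_le_mono (jw_le i').
have hC i' := jet_le_mul AW A0 (jcos_le hn) (hw i').
have hS i' := jet_le_mul AW A0 (jsin_le hn) (hw i').
rewrite /jU; case: ifP => _.
  have := jet_le_add (hC 0) (jet_le_scale (-1) (hS 1)).
  by rewrite normrN normr1; apply: jet_le_mono => //; lra.
have := jet_le_add (hS 0) (hC 1).
by apply: jet_le_mono => //; lra.
Qed.

Variable jp : R.
Hypotheses (jp1 : 1 <= jp) (rjp : r <= jp).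
Hypotheses (t0 : 0 <= z.1) (tr : z.1 <= kap / r).

Let jp0 : 0 <= jp. Proof. exact: le_trans jp1. Qed.
Let t_le : z.1 <= A.
Proof.
rewrite (le_trans tr) // (@le_trans _ _ (kap * (2 / r))) //.
  by rewrite mulrA ler_wpM2r ?invr_ge0 ?(ltW r0) // ler_peMr // ler1n.
by rewrite AE ler_wpM2l // (le_trans br).
Qed.

Let t2_le : z.1 * (2 / r) <= W.
Proof.
rewrite (le_trans _ AW) // expr2; apply: ler_pM => //.
  by rewrite divr_ge0 // ltW.
by rewrite (le_trans br).
Qed.

Lemma jTspeed_le : jder_le z A W (3 * jp) (jmul (jT R) (jspeed R)).
Proof.
split=> [j|j l].
  rewrite -[j1 _ j z]/((None == j)%:R * r + z.1 * j1 (jspeed R) j z).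
  rewrite (le_trans (ler_normD _ _)) //.
  have h1 : `|(None == j)%:R * r| <= 1 * jp.
    by rewrite normrM (gtr0_norm r0); apply: ler_pM => //;
      [exact: ltW|exact: norm_delta].
  have h2 : `|z.1 * j1 (jspeed R) j z| <= A * 1.
    by rewrite normrM (ger0_norm t0); apply: ler_pM => //; exact: speed_1.
  have h3 : A <= jp * A by rewrite ler_peMl.
  have h4 : jp * 1 <= jp * A by rewrite ler_wpM2l.
  have h5 : 0 <= jp * A by exact: mulr_ge0.
  by lra.
rewrite -[j2 _ j l z]/((0 * r + (None == j)%:R * j1 (jspeed R) l z) +
  ((None == l)%:R * j1 (jspeed R) j z + z.1 * j2 (jspeed R) j l z)).
rewrite mul0r add0r.
have h1 : `|(None == l)%:R * j1 (jspeed R) j z| <= 1 * 1.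
  by rewrite normrM; apply: ler_pM => //; [exact: norm_delta|exact: speed_1].
have h2 : `|(None == j)%:R * j1 (jspeed R) l z| <= 1 * 1.
  by rewrite normrM; apply: ler_pM => //; [exact: norm_delta|exact: speed_1].
have h3 : `|z.1 * j2 (jspeed R) j l z| <= W.
  rewrite normrM (ger0_norm t0) (le_trans _ t2_le) //.
  by rewrite ler_wpM2l // speed_2.
rewrite (le_trans (ler_normD _ _)) // (le_trans (lerD (lexx _) (ler_normD _ _))) //.
have h5 : W <= jp * W by rewrite ler_peMl.
by have := W2; lra.
Qed.

(** During its own piece the travelled distance is at most a chord, although
    time and speed are unbounded. *)
Lemma jsigma_le : `|2 * k%:R - 1| <= kap -> z.1 <= hit k.+1 z -> hit k z <= z.1 ->
  jet_le z A W (36 * jp) (jsigma R k).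
Proof.
move=> hn h2 h1; split.
  rewrite (sigmaE k v0) ger0_norm; last by rewrite mulr_ge0 ?(ltW r0) // subr_ge0.
  rewrite mulrC -ler_pdivlMr //.
  have : 2 * cphi z / r <= 36 * jp / r.
    rewrite ler_wpM2r ?invr_ge0 ?(ltW r0) //.
    by have := cphi_le1 z; move: jp1; lra.
  by move: h2; rewrite hit_succ; lra.
have hd : jder_le z A W 32 (jalong R).
  by have [_ h] := jalong_le; apply: jder_le_mono h.
have hc : jder_le z A W 1 (jscale (2 * k%:R - 1) (jcos (1 : R))).
  have s1 : `|- sin (1 * jv (jphi R) z)| <= 1.
    by rewrite normrN ler_norml sin_geN1 sin_le1.
  have s2 : `|- cos (1 * jv (jphi R) z)| <= 1.
    by rewrite normrN ler_norml cos_geN1 cos_le1.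
  have n0 : 0 <= `|2 * k%:R - 1 : R| by [].
  have p1 := phi_1; have p2 := phi_2.
  split=> [j|j l]; rewrite mul1r.
    rewrite -[j1 _ j z]/((2 * k%:R - 1) * (- sin (1 * jv (jphi R) z) *
      (1 * j1 (jphi R) j z))).
    rewrite [1 * j1 _ _ _]mul1r normrM AE; apply: ler_pM => //.
    by rewrite normrM -[leRHS]mul1r; apply: ler_pM.
  rewrite -[j2 _ j l z]/((2 * k%:R - 1) * (- cos (1 * jv (jphi R) z) *
      (1 * j1 (jphi R) l z) * (1 * j1 (jphi R) j z) +
      - sin (1 * jv (jphi R) z) * (1 * j2 (jphi R) j l z))).
  rewrite !mul1r in s1 s2 *.
  rewrite normrM WE -[kap * _ * _]mulrA; apply: ler_pM => //.
  rewrite -[X in `|X + _|]mulrA (le_trans (ler_normD _ _)) //.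
  have h3 : `|- cos (jv (jphi R) z) * (j1 (jphi R) l z * j1 (jphi R) j z)|
      <= 1 * (c * c).
    by rewrite normrM; apply: ler_pM => //; rewrite normrM; exact: ler_pM.
  have h4 : `|- sin (jv (jphi R) z) * j2 (jphi R) j l z| <= 1 * (mu * c ^+ 2).
    by rewrite normrM; apply: ler_pM.
  have h5 : c ^+ 2 <= kap * c ^+ 2.
    by rewrite ler_peMl ?sqr_ge0 // (le_trans _ kap2) // ler1n.
  rewrite mulrDl; apply: le_trans (lerD h3 h4) _.
  by rewrite !mul1r -expr2 lerD2r.
have := jder_le_add (jder_le_add jTspeed_le (jder_le_scale (-1) hd))
  (jder_le_scale (-1) hc).
rewrite normrN normr1 !mul1r; apply: jder_le_mono => //.
  by move: jp1; lra.
by move: jp1; lra.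
Qed.

Lemma jspeed_le : jet_le z A W jp (jspeed R).
Proof.
split; first by rewrite gtr0_norm.
split=> [j|j l].
  by rewrite (le_trans (speed_1 j)) // mulr_ege1.
rewrite (le_trans (speed_2 j l)) // (le_trans br) // (le_trans _ (ler_peMl W0 jp1)) //.
rewrite (le_trans _ bW) // expr2 ler_peMl //.
by rewrite (le_trans _ b2) // ler1n.
Qed.

Lemma jPhi_le m : 2 * k.+1%:R = kap -> z.1 <= hit k.+1 z ->
  (k != 0)%N -> hit k z <= z.1 -> jder_le z A W (4640 * jp) (jPhi R k m).
Proof.
move=> kE h2 k0 h1.
have hn : `|2 * k%:R - 1| <= kap.
  have : (1 : R) <= k%:R by rewrite ler1n lt0n.
  by rewrite -kE mulrS => ?; rewrite ger0_norm; lra.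
have hn' : `|2 * k%:R| <= kap.
  have : (1 : R) <= k%:R by rewrite ler1n lt0n.
  by rewrite -kE mulrS => ?; rewrite ger0_norm; lra.
have hs := jsigma_le hn h2 h1.
case: k k0 hn hn' hs {h1 h2 kE} => // k' _ hn hn' hs.
have s1 : `|(-1) ^+ k'.+1| = 1 :> R by rewrite normrX normrN normr1 expr1n.
have jj := jp1.
case: m => i; rewrite /jPhi.
  have h3 := jet_le_mul AW A0 hs (jU_le i hn').
  have [_] := jet_le_scale ((-1) ^+ k'.+1)
    (jet_le_add (jU_le i hn) (jet_le_scale (-1) h3)).
  rewrite s1 normrN normr1 !mul1r; apply: jder_le_mono => //; lra.
have [_] := jet_le_scale ((-1) ^+ k'.+1) (jet_le_mul AW A0 jspeed_le (jU_le i hn')).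
by rewrite s1 mul1r; apply: jder_le_mono => //; lra.
Qed.

Lemma jPhi0_le m : jder_le z A W (4640 * jp) (jPhi R 0 m).
Proof.
have jA : jp <= jp * A by rewrite ler_peMr.
have AA : A <= jp * A by rewrite ler_peMl.
have jW : jp <= jp * W by rewrite ler_peMr // (le_trans _ W2) // ler1n.
have WW : W <= jp * W by rewrite ler_peMl.
have jA0 : 0 <= jp * A by exact: mulr_ge0.
have jW0 : 0 <= jp * W by exact: mulr_ge0.
case: m => i; rewrite /jPhi; split=> [j|j l].
- rewrite -[j1 _ j z]/((Some (inl i) == j)%:R + -1 * ((None == j)%:R * z.2.2 i 0 +
    z.1 * (Some (inr i) == j)%:R)).
  rewrite (le_trans (ler_normD _ _)) // mulN1r normrN.
  rewrite (le_trans (lerD (norm_delta _ _) (ler_normD _ _))) //.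
  have h1 : `|(None == j)%:R * z.2.2 i 0| <= 1 * r.
    by rewrite normrM; apply: ler_pM => //; [exact: norm_delta|exact: v_le].
  have h2 : `|z.1 * (Some (inr i) == j)%:R| <= A * 1.
    by rewrite normrM (ger0_norm t0); apply: ler_pM => //; exact: norm_delta.
  by have := rjp; have := jp1; lra.
- rewrite -[j2 _ j l z]/(0 + -1 * ((0 * z.2.2 i 0 + (None == j)%:R *
    (Some (inr i) == l)%:R) + ((None == l)%:R * (Some (inr i) == j)%:R + z.1 * 0))).
  rewrite mul0r mulr0 addr0 !add0r mulN1r normrN.
  have h (j1 j2 j3 j4 : J) : `|(j1 == j2)%:R * (j3 == j4)%:R| <= 1 * 1 :> R.
    by rewrite normrM; apply: ler_pM => //; exact: norm_delta.
  rewrite (le_trans (ler_normD _ _)) // (le_trans (lerD (h _ _ _ _) (h _ _ _ _))) //.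
  by have := jp1; lra.
- rewrite -[j1 _ j z]/((Some (inr i) == j)%:R) (le_trans (norm_delta _ _)) //.
  by have := A1; lra.
- by rewrite -[j2 _ j l z]/(0 : R) normr0; lra.
Qed.

End BilliardBounds.

(** * The compatibility conditions along the flow *)

Section Compatibility.
Variable R : realType.
Local Notation vec := 'cV[R]_2.
Local Notation phase := ('cV[R]_2 * 'cV[R]_2)%type.
Local Notation pd := (pderiv (@phase_dir R) (@phase_dom R)).
Implicit Types (x v w : vec) (f : phase -> R).

(** First and second derivatives along the free flow [x + s v]. *)
Definition flow1 f (p : phase) : R := \sum_i pd (inl i) f p * p.2 i 0.
Definition flow2 f (p : phase) : R :=
  \sum_i (\sum_j pd (inl j) (pd (inl i) f) p * p.2 j 0) * p.2 i 0.

Definition reflection_invariant (h : phase -> R) : Prop :=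
  forall x v, gamma_minus (x, v) -> h (x, v) = h (x, reflmx x *m v).

Lemma reflmx_invol x : circle x -> reflmx x *m reflmx x = 1%:M.
Proof.
move=> /circleE xx.
have xx1 : x^T *m x = 1%:M by apply/matrixP => i j; rewrite !ord1 -/(dot x x) xx mxE.
rewrite /reflmx mulmxBl mul1mx mulmxBr mulmx1 -scalemxAl -scalemxAr /tens.
rewrite -(mulmxA x) (mulmxA x^T x) xx1 mul1mx scalerA.
move: (x *m x^T) => M; apply/matrixP => i j; rewrite !mxE; ring.
Qed.

Lemma reflmx_sym x : (reflmx x)^T = reflmx x.
Proof. by apply/matrixP => i j; rewrite !mxE !big_ord1 !mxE eq_sym [x j _ * _]mulrC. Qed.

Lemma tens_orth (a b c : vec) : dot b c = 0 -> tens a b *m c = 0.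
Proof.
move=> h; rewrite /tens -mulmxA.
have -> : b^T *m c = 0 by apply/matrixP => i j; rewrite !ord1 -/(dot b c) h mxE.
by rewrite mulmx0.
Qed.

Lemma dot_Q v : dot (Qmx R *m v) v = 0.
Proof. by rewrite dotE !mxE !sum2 !mxE /=; ring. Qed.

Lemma QQ_ker x v : QQ x v *m v = 0.
Proof. by rewrite /QQ -scalemxAl tens_orth ?scaler0 // dot_Q. Qed.

Lemma QQ_coker x v : v^T *m QQ x v = 0.
Proof.
apply: trmx_inj; rewrite trmx_mul trmxK trmx0 -[RHS](QQ_ker x v); congr (_ *m _).
by apply/matrixP => i j; rewrite !mxE !big_ord1 !mxE; congr (_ * _); rewrite mulrC.
Qed.

Lemma rowE (g : 'rV[R]_2) w : (g *m w) 0 0 = \sum_j g 0 j * w j 0.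
Proof. by rewrite mxE. Qed.

Lemma flow1E f x v : flow1 f (x, v) = (grad_x f x v *m v) 0 0.
Proof. by rewrite rowE; apply: eq_bigr => i _; rewrite mxE. Qed.

(** Here [w] is the outgoing velocity.  The singular matrices are built on [Q v]
    and [Q w], which are orthogonal to [v] and [w]. *)
Lemma flow1_mx (a b a' b' : 'rV[R]_2) x v w :
  (a + b *m QQ x v) *m reflmx x = a' + b' *m QQ x w -> reflmx x *m w = v ->
  a *m v = a' *m w.
Proof.
move=> E Rw; have := congr1 (mulmx^~ w) E.
rewrite -(mulmxA _ (reflmx x)) Rw !mulmxDl.
by rewrite -(mulmxA b) -(mulmxA b') !QQ_ker !mulmx0 !addr0.
Qed.

Lemma reflmx_w x v : circle x -> reflmx x *m (reflmx x *m v) = v.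
Proof. by move=> cx; rewrite mulmxA reflmx_invol // mul1mx. Qed.

Lemma flow1_invariant f : C1_compat f -> reflection_invariant (flow1 f).
Proof.
move=> h x v gm; have [cx _] := gm.
have E := h x v gm; rewrite /= in E; rewrite !flow1E.
move: (reflmx_w v cx) E; move: (reflmx x *m v) => w Rw.
move: (grad_x f x v) (grad_v f x v) (grad_x f x w) (grad_v f x w) => a b a' b' E.
by rewrite (flow1_mx E Rw).
Qed.

Lemma quadE (M : 'M[R]_2) w :
  (w^T *m M *m w) 0 0 = \sum_i (\sum_j M i j * w j 0) * w i 0.
Proof. by rewrite mxE !sum2 !mxE !sum2 !mxE; ring. Qed.

Lemma stack_ker (g : 'rV[R]_2) (M N : 'M[R]_2) v : M *m v = 0 -> N *m v = 0 ->
  stack (g *m M) (g *m N) *m v = 0.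
Proof.
move=> hM hN; apply/matrixP => i j; rewrite ord1 [RHS]mxE.
have E (P : 'M[R]_2) : P *m v = 0 -> (g *m P) 0 0 * v 0 0 + (g *m P) 0 1 * v 1 0 = 0.
  move=> hP; have := congr1 (fun M : 'cV[R]_2 => (g *m M) 0 0) hP.
  by rewrite mulmxA mulmx0 rowE sum2 [in X in _ = X]mxE.
rewrite mxE sum2 [stack _ _ _ _]mxE [stack _ _ _ 1]mxE.
by case: (ord2 i) => -> /=; apply: E.
Qed.

Lemma Amx_ker v x : dot v x != 0 -> Amx v x *m v = 0.
Proof.
move=> vx; rewrite /Amx -mulmxA mulmxBl mul1mx -scalemxAl /tens -mulmxA.
have -> : x^T *m v = (dot v x)%:M.
  by apply/matrixP => i j; rewrite !ord1 -/(dot x v) dotC mxE mulr1n.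
by rewrite mul_mx_scalar scalerA mulVf // scale1r subrr mulmx0.
Qed.

Lemma scale_ker (a : R) (M : 'M[R]_2) v : M *m v = 0 -> (a *: M) *m v = 0.
Proof. by move=> h; rewrite -scalemxAl h scaler0. Qed.

Lemma mx22_ker (a b c d : R) v : a * v 0 0 + b * v 1 0 = 0 ->
  c * v 0 0 + d * v 1 0 = 0 -> mx22 a b c d *m v = 0.
Proof.
move=> h h'; apply/matrixP => i j; rewrite ord1 mxE sum2 !mxE.
by have [->|->] := ord2 i.
Qed.

Lemma J1_ker v x : J1 v x *m v = 0.
Proof. by apply: scale_ker; apply: mx22_ker; ring. Qed.

Lemma J2_ker v x : J2 v x *m v = 0.
Proof. by apply: scale_ker; apply: mx22_ker; ring. Qed.

Lemma K1_ker v x : K1 v x *m v = 0.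
Proof. by apply: scale_ker; apply: mx22_ker; ring. Qed.

Lemma K2_ker v x : K2 v x *m v = 0.
Proof. by apply: scale_ker; apply: mx22_ker; ring. Qed.

Lemma flow2E f x v : flow2 f (x, v) = (v^T *m hess_xx f x v *m v) 0 0.
Proof.
rewrite quadE; apply: eq_bigr => i _; congr (_ * _).
by apply: eq_bigr => j _; rewrite mxE.
Qed.

(** Tested on the outgoing velocity from both sides, the compatibility condition
    for the second space derivatives loses all its correction terms: all
    matrices in them annihilate the velocity. *)
Lemma flow2_mx (a b c a' b' c' L S S' : 'M[R]_2) x v w :
  reflmx x *m (a + b *m QQ x v + QQ x v *m c) *m reflmx x =
  a' + b' *m QQ x w + QQ x w *m c' - 2 *: (L *m Amx v x *m reflmx x)
    + S *m reflmx x + S' *m reflmx x ->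
  reflmx x *m w = v -> dot v x != 0 -> S *m v = 0 -> S' *m v = 0 ->
  w^T *m a' *m w = v^T *m a *m v.
Proof.
move=> E Rw vx hS hS'.
have wR : w^T *m reflmx x = v^T by rewrite -[reflmx x]reflmx_sym -trmx_mul Rw.
have := congr1 (fun M : 'M[R]_2 => w^T *m M *m w) E => {E}.
rewrite -(mulmxA (reflmx x)) (mulmxA w^T (reflmx x)) wR.
rewrite -(mulmxA v^T) -(mulmxA _ (reflmx x) w) Rw.
have hL : (L *m Amx v x *m reflmx x) *m w = 0.
  by rewrite -(mulmxA _ (reflmx x)) Rw -(mulmxA L) Amx_ker // mulmx0.
rewrite -(mulmxA w^T) !mulmxDl mulNmx -(scalemxAl 2) hL scaler0 oppr0 addr0.
rewrite -(mulmxA S) -(mulmxA S') Rw hS hS' !addr0.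
rewrite -(mulmxA b') -(mulmxA b) !QQ_ker !mulmx0 !addr0.
rewrite !mulmxDr -(mulmxA (QQ x v)) -(mulmxA (QQ x w)).
by rewrite !(mulmxA _ (QQ _ _)) !QQ_coker !mul0mx !addr0 !mulmxA => ->.
Qed.

Lemma flow2_invariant f : C2_compat f -> reflection_invariant (flow2 f).
Proof.
move=> h x v gm; have [cx vx] := gm.
have vx0 : dot v x != 0 by rewrite lt_eqF.
rewrite !flow2E; have [_ _ _ E] := h x v gm; rewrite /C2_compat_xx /= in E.
move: (reflmx_w v cx) E; move: (reflmx x *m v) => w Rw.
move: (hess_xx f x v) (hess_vx f x v) (hess_xv f x v) (hess_xx f x w)
  (hess_vx f x w) (hess_xv f x w) (grad_v f x w) => a b c a' b' c' g E.
rewrite -(flow2_mx E Rw vx0) //.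
- by rewrite -mulmxA stack_ker ?mulmx0 ?J1_ker ?J2_ker.
- by rewrite -mulmxA stack_ker ?mulmx0 ?K1_ker ?K2_ker.
Qed.

End Compatibility.

(** * Gluing the pieces *)

Lemma cvg_sumr (R : realType) (T : Type) (F : set_system T) {FF : Filter F}
    (I : finType) (u : I -> T -> R) (a : I -> R) :
  (forall i, u i @ F --> a i) -> (fun x => \sum_i u i x) @ F --> \sum_i a i.
Proof.
move=> h; suff H (s : seq I) :
    (fun x => \sum_(i <- s) u i x) @ F --> \sum_(i <- s) a i by exact: H.
elim: s => [|i s IH].
  by rewrite big_nil; under eq_fun do rewrite big_nil; exact: cvg_cst.
by rewrite big_cons; under eq_fun do rewrite big_cons; exact: cvgD.
Qed.

Lemma hasgrad_uniq (R : realType) (V : normedModType R) (J : finType) (e : J -> V)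
    (c : coords e) f p g g' :
  hasgrad c setT f p g -> hasgrad c setT f p g' -> forall j, g j = g' j.
Proof.
move=> h h' j; have [_ <-] := hasgrad_is_derive j filterT h.
by have [_ <-] := hasgrad_is_derive j filterT h'.
Qed.

Section Pieces.
Variable R : realType.
Local Notation vec := 'cV[R]_2.
Local Notation phase := ('cV[R]_2 * 'cV[R]_2)%type.
Local Notation M := ('I_2 + 'I_2)%type.
Local Notation J := (option M).
Local Notation tc := (time_coords R).
Local Notation cc := (phase_coords R).
Local Notation pd := (pderiv (@phase_dir R) (@phase_dom R)).
Local Notation CkP := (Ck_on (@phase_dir R) (@phase_dom R)).
Local Notation hit k := (jv (jhit R k)).
Implicit Types (z p q : R * phase) (f g h : phase -> R) (k : nat) (j l : J) (m : M).

Lemma Ck_onW f : CkP 2 f -> CkP 1 f.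
Proof. by case=> c h; split=> // m; have [h1 [h2 _]] := h m. Qed.

Lemma Ck_on_pd k f m : CkP k.+1 f -> CkP k (pd m f).
Proof. by case=> _ h; have [] := h m. Qed.

(** The piece [g (Phi k z)] makes sense on this closed set. *)
Definition piece_dom k : set (R * phase) := [set z | phase_dom (Phi k z)].
Definition piece_ok k z := (k = 0)%N \/ regular z.

(** The first and second derivatives of [g (Phi k z)] by the chain rule. *)
Definition grad_piece g k j z : R := \sum_m pd m g (Phi k z) * j1 (jPhi R k m) j z.
Definition hess_piece g k j l z : R :=
  \sum_m (grad_piece (pd m g) k l z * j1 (jPhi R k m) j z
  + pd m g (Phi k z) * j2 (jPhi R k m) j l z).

Lemma co_Phi k m z : co cc m (Phi k z) = jv (jPhi R k m) z.
Proof. by case: m => i /=; rewrite mxE. Qed.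

Lemma hasgrad_Phi g k p : CkP 1 g -> piece_ok k p -> piece_dom k p ->
  hasgrad tc (piece_dom k) (fun z => g (Phi k z)) p (grad_piece g k ^~ p).
Proof.
move=> hg vp Ap.
apply: (@hasgrad_comp _ _ _ _ _ _ _ tc cc _ (@phase_dom R) (Phi k) g p
  (fun m j => j1 (jPhi R k m) j p)).
- by near=> q.
- move=> m; have [h _ _ _] := jPhi_ok m vp.
  apply: hasgrad_eq (hasgrad_near _ h).
  + by rewrite co_Phi.
  + by near=> q => _; rewrite co_Phi.
  + by near=> q.
- exact: hasgrad_phase.
Unshelve. all: by end_near. Qed.

Lemma hasgrad_grad_piece g k j p : CkP 2 g -> piece_ok k p -> piece_dom k p ->
  hasgrad tc (piece_dom k) (grad_piece g k j) p (hess_piece g k j ^~ p).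
Proof.
move=> hg vp Ap; apply: hasgrad_sum => m; apply: hasgradM.
  exact: hasgrad_Phi (Ck_on_pd m hg) vp Ap.
have [_ h _ _] := jPhi_ok m vp; apply: hasgrad_near (h j).
by near=> q.
Unshelve. all: by end_near. Qed.

Lemma cvg_Phi n g k p : CkP n g -> piece_ok k p -> piece_dom k p ->
  (fun z => g (Phi k z)) @ within (piece_dom k) (nbhs p) --> g (Phi k p).
Proof.
move=> hg vp Ap; apply: cvg_comp (C1_continuous hg Ap).
apply: cvg_to_within; first by apply: cvg_within_filter; exact: Phi_cvg.
exact: withinT.
Qed.

Lemma grad_piece_cvg n g k j p : CkP n.+1 g -> piece_ok k p -> piece_dom k p ->
  grad_piece g k j @ within (piece_dom k) (nbhs p) --> grad_piece g k j p.
Proof.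
move=> hg vp Ap; apply: cvg_sumr => m; apply: cvgM.
  exact: cvg_Phi (Ck_on_pd m hg) vp Ap.
by apply: cvg_within_filter; exact: jet_ok_cvg1 (jPhi_ok m vp).
Qed.

Lemma hess_piece_cvg g k j l p : CkP 2 g -> piece_ok k p -> piece_dom k p ->
  hess_piece g k j l @ within (piece_dom k) (nbhs p) --> hess_piece g k j l p.
Proof.
move=> hg vp Ap; apply: cvg_sumr => m; apply: cvgD; apply: cvgM.
- exact: grad_piece_cvg (Ck_on_pd m hg) vp Ap.
- by apply: cvg_within_filter; exact: jet_ok_cvg1 (jPhi_ok m vp).
- exact: cvg_Phi (Ck_on_pd m hg) vp Ap.
- by have [_ _ h _] := jPhi_ok m vp; apply: cvg_within_filter; exact: h.
Qed.

Lemma hess_piece_symm g k j l p : CkP 2 g -> piece_ok k p -> piece_dom k p ->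
  hess_piece g k j l p = hess_piece g k l j p.
Proof.
move=> hg vp Ap; rewrite /hess_piece !big_split /=; congr (_ + _); last first.
  by apply: eq_bigr => m _; have [_ _ _ ->] := jPhi_ok m vp.
rewrite /grad_piece; under eq_bigr do rewrite mulr_suml.
under [RHS]eq_bigr do rewrite mulr_suml.
rewrite exchange_big /=; apply: eq_bigr => m _; apply: eq_bigr => m' _.
by rewrite (pderiv_symm hg) //; ring.
Qed.

Lemma grad_piece_None g k z : grad_piece g k None z = - flow1 g (Phi k z).
Proof.
rewrite /grad_piece big_sumType /= [X in _ + X]big1 ?addr0 => [|i _]; last first.
  by rewrite dt_Phi_vel mulr0.
rewrite /flow1 -sumrN; apply: eq_bigr => i _.
by rewrite dt_Phi_pos mulrN mxE.
Qed.

(** The motion within a piece is uniform. *)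
Lemma dtt_Phi k m z : piece_ok k z -> j2 (jPhi R k m) None None z = 0.
Proof.
move=> vz; have [_ h _ _] := jPhi_ok m vz.
case: m h => i /(_ None) h.
  have [hv _ _ _] := jPhi_ok (inr i) vz.
  have := hasgradM (hasgrad_cst tc setT (-1) z) hv.
  move=> /(hasgrad_eq (f' := j1 (jPhi R k (inl i)) None)) h'.
  rewrite (hasgrad_uniq h (h' _ _)) ?dt_Phi_vel ?dt_Phi_pos; try ring.
  by near=> q => _; rewrite dt_Phi_pos mulN1r.
have := hasgrad_cst tc setT 0 z.
move=> /(hasgrad_eq (f' := j1 (jPhi R k (inr i)) None)) h'.
rewrite (hasgrad_uniq h (h' _ _)) ?dt_Phi_vel //.
by near=> q => _; rewrite dt_Phi_vel.
Unshelve. all: by end_near. Qed.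

Lemma hess_piece_None g k z : piece_ok k z ->
  hess_piece g k None None z = flow2 g (Phi k z).
Proof.
move=> vz; rewrite /hess_piece big_split /= [X in _ + X]big1 ?addr0 => [|m _]; last first.
  by rewrite dtt_Phi // mulr0.
rewrite big_sumType /= [X in _ + X]big1 ?addr0 => [|i _]; last first.
  by rewrite dt_Phi_vel mulr0.
apply: eq_bigr => i _; rewrite grad_piece_None dt_Phi_pos mulrNN.
by rewrite mxE.
Qed.

Section Bounce.
Variables (k : nat) (p : R * phase).

Lemma specular_invariant g : specular g -> reflection_invariant g.
Proof. by move=> h x v [cx _]; exact: h. Qed.

Lemma bounce_dom q : regular q -> q.1 = hit k.+1 q ->
  piece_dom k q /\ piece_dom k.+1 q.
Proof.
move=> rq hq; have [cx _ E] := Phi_bounce rq hq.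
by rewrite /piece_dom /= E; split; rewrite /phase_dom /cdisc /= cx.
Qed.

Lemma bounce_invariant h q : reflection_invariant h -> regular q ->
  q.1 = hit k.+1 q -> h (Phi k q) = h (Phi k.+1 q).
Proof.
move=> hh rq hq; have [cx d E] := Phi_bounce rq hq.
rewrite E -hh; first by case: (Phi k q).
split=> //=; rewrite d oppr_lt0 mulr_gt0 ?cphi_gt0 //.
by have [v0 _] := rq; exact: rr_gt0.
Qed.

Hypotheses (rp : regular p) (hp : p.1 = hit k.+1 p).

(** The hitting time depends on the phase point only, so the hitting surface is
    transversal to the time direction. *)
Lemma bounce_match u u' (G G' : J -> R) :
  hasgrad tc (piece_dom k) u p G -> hasgrad tc (piece_dom k.+1) u' p G' ->
  (forall q, regular q -> q.1 = hit k.+1 q -> u q = u' q) ->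
  G None = G' None -> forall j, G j = G' j.
Proof.
move=> hG hG' uu' GG'; have [hT _ _ _] := jhit_ok k.+1 rp.
have hitT (q : R * phase) a : hit k.+1 (q + a *: time_dir R None) = hit k.+1 q.
  case: q => t w; rewrite -[LHS]/(hit k.+1 (t + a * 1, w + a *: 0)).
  by rewrite scaler0 addr0.
apply: (hasgrad_match hG hG' hT hitT hp (uu' _ rp hp) _ GG').
apply: filterS (regular_near rp) => q rq hq.
by have [] := bounce_dom rq hq; split=> //; exact: uu'.
Qed.

End Bounce.

(** Time derivatives are minus the derivatives along the free flow, which the
    first compatibility condition makes invariant under reflection. *)
Lemma grad_piece_match g k p : CkP 1 g -> specular g -> C1_compat g ->
  regular p -> p.1 = hit k.+1 p -> forall j, grad_piece g k j p = grad_piece g k.+1 j p.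
Proof.
move=> hg sg cg rp hp; have [d d'] := bounce_dom rp hp.
apply: (bounce_match rp hp (hasgrad_Phi hg _ d) (hasgrad_Phi hg _ d')).
- by right.
- by right.
- by move=> q rq hq; exact: bounce_invariant (specular_invariant sg) rq hq.
- rewrite !grad_piece_None; congr (- _).
  exact: bounce_invariant (flow1_invariant cg) rp hp.
Qed.

(** All gradients agree once their time components do.  For the time derivative
    this is the second flow derivative; its gradient then contains, by symmetry,
    the time components of the remaining gradients. *)
Lemma hess_piece_match g k p : CkP 2 g -> specular g -> C1_compat g -> C2_compat g ->
  regular p -> p.1 = hit k.+1 p ->
  forall j l, hess_piece g k j l p = hess_piece g k.+1 j l p.
Proof.
move=> hg sg cg cg' rp hp j; have [d d'] := bounce_dom rp hp.
have v : piece_ok k p by right.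
have v' : piece_ok k.+1 p by right.
have dE i q : regular q -> q.1 = hit k.+1 q ->
    grad_piece g k i q = grad_piece g k.+1 i q.
  by move=> rq hq; exact: grad_piece_match (Ck_onW hg) sg cg rq hq i.
have H i := bounce_match rp hp (hasgrad_grad_piece i hg v d)
  (hasgrad_grad_piece i hg v' d') (dE i).
apply: (H j); rewrite (hess_piece_symm _ _ hg v d) (hess_piece_symm _ _ hg v' d').
apply: (H None); rewrite !hess_piece_None //.
exact: bounce_invariant (flow2_invariant cg') rp hp.
Qed.

Section Gluing.
Variable (E : nat -> R * phase -> Prop).

(** A property near [p] needs checking only for the pieces that occur there,
    each on its own domain. *)
Lemma near_kappa p : time_dom p ->
  (forall k, piece_ok k p -> piece_dom k p ->
     k = kappa p \/ [/\ kappa p = k.+1, regular p & p.1 = hit k.+1 p] ->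
     \forall q \near p, piece_dom k q -> E k q) ->
  \forall q \near p, time_dom q -> E (kappa q) q.
Proof.
move=> tp h; have dp := Phi_kappa_dom tp.
have [[vp n]|[k [kp rp hp n]]] := kappa_local tp.
  have {}h := h _ vp dp (or_introl erefl).
  near=> q => tq; have kq : kappa q = kappa p by exact: (near n q).
  by rewrite kq; apply: (near h q) => //; rewrite /piece_dom /= -kq; exact: Phi_kappa_dom.
have [d d'] := bounce_dom rp hp.
have h1 := h k (or_intror rp) d (or_intror (And3 kp rp hp)).
have h2 := h k.+1 (or_intror rp) d' (or_introl (esym kp)).
near=> q => tq; have dq := Phi_kappa_dom tq.
have [kq|kq] : kappa q = k.+1 \/ kappa q = k by exact: (near n q).
- by rewrite kq in dq *; apply: (near h2 q).
- by rewrite kq in dq *; apply: (near h1 q).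
Unshelve. all: by end_near. Qed.

End Gluing.

Lemma glue_cvg (u : nat -> R * phase -> R) p : time_dom p ->
  (forall k, piece_ok k p -> piece_dom k p ->
     u k @ within (piece_dom k) (nbhs p) --> u k p) ->
  (forall k, regular p -> p.1 = hit k.+1 p -> u k p = u k.+1 p) ->
  (fun z => u (kappa z) z) @ within (@time_dom R) (nbhs p) --> u (kappa p) p.
Proof.
move=> tp h hu; apply/cvgrPdist_le => eps e0.
apply: (near_kappa (E := fun k q => `|u (kappa p) p - u k q| <= eps)) tp _.
move=> k vp dp hk; have -> : u (kappa p) p = u k p.
  by case: hk => [->//|[-> rp hp]]; rewrite -hu.
by have /cvgrPdist_le /(_ _ e0) := h k vp dp.
Qed.

Lemma glue_hasgrad (u : nat -> R * phase -> R) (U : nat -> J -> R * phase -> R) p :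
  time_dom p ->
  (forall k, piece_ok k p -> piece_dom k p ->
     hasgrad tc (piece_dom k) (u k) p (U k ^~ p)) ->
  (forall k, regular p -> p.1 = hit k.+1 p -> u k p = u k.+1 p) ->
  (forall k, regular p -> p.1 = hit k.+1 p -> forall j, U k j p = U k.+1 j p) ->
  hasgrad tc (@time_dom R) (fun z => u (kappa z) z) p (fun j => U (kappa p) j p).
Proof.
move=> tp h hu hU eps e0.
apply: (near_kappa (E := fun k q =>
  `|u k q - u (kappa p) p - lin tc (fun j => U (kappa p) j p) (q - p)|
    <= eps * `|q - p|)) tp _.
move=> k vp dp hk; have [-> ->] : u (kappa p) p = u k p /\
    (fun j => U (kappa p) j p) = (fun j => U k j p).
  case: hk => [->//|[-> rp hp]]; split; first by rewrite -hu.
  by apply/funext => j; rewrite -hU.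
exact: h.
Qed.

Lemma time_interior z : 0 < z.1 -> disc z.2.1 -> (@time_dom R)° z.
Proof.
move=> t0 dz.
have n1 : \forall q \near z, 0 < q.1.
  have : (co tc None) @ z --> z.1.
    have := hasgrad_cvg (hasgrad_co tc setT None z); rewrite withinET; apply.
  by move/cvgr_gt; apply.
have n2 : \forall q \near z, disc q.2.1.
  by have := disc_near dz; apply: (@cvg_snd _ _ (nbhs z.1) (nbhs z.2)).
apply: filterS2 n1 n2 => q q0 dq; split; first exact: ltW.
split; first by rewrite /phase_dom /cdisc /= ltW.
by case=> cq _; move: dq; rewrite /disc /= cq ltxx.
Qed.

Lemma time_dom_proper p : time_dom p ->
  ProperFilter (within (@time_dom R)° (nbhs p)).
Proof.
case: p => t x [/= t0 [px _]]; split; last exact: within_filter.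
have : (fun s : R => (t + (1 - s), shrink s x)) @ (1 : R)^'- -->
    within (@time_dom R)° (nbhs (t, x)).
  apply: cvg_to_within.
    have h1 : (fun s : R => t + (1 - s)) @ (1 : R)^'- --> t.
      apply: cvg_within_filter.
      have : (fun s : R => t + (1 - s)) @ (1 : R) --> t + (1 - 1).
        by apply: cvgD; [exact: cvg_cst|apply: cvgB; [exact: cvg_cst|exact: cvg_id]].
      by rewrite subrr addr0.
    exact: cvg_pair h1 (@shrink_cvg R x).
  apply: filterS (near1_itv R) => s hs; apply: time_interior => /=.
    by have /andP[_ s1] := hs; rewrite ltr_wpDl // subr_gt0.
  exact: shrink_disc.
by move=> h h0; have := h _ h0; exact: (@filter_not_empty _ (1 : R)^'-).
Qed.

Local Notation CkT := (Ck_on (@time_dir R) (@time_dom R)).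
Local Notation pdT := (pderiv (@time_dir R) (@time_dom R)).

Lemma char_sol_C1 f : CkP 1 f -> specular f -> C1_compat f ->
  CkT 1 (char_sol f) /\
  forall j z, time_dom z -> pdT j (char_sol f) z = grad_piece f (kappa z) j z.
Proof.
move=> hf sf cf.
apply: (C1_of_hasgrad (c := tc) time_dom_proper
  (G := fun j z => grad_piece f (kappa z) j z)) => [p tp|j p tp].
- apply: (@hasgrad_eq _ _ _ _ _ _ (fun z => f (Phi (kappa z) z))).
  + by rewrite char_solE.
  + by near=> q => tq; rewrite char_solE.
  apply: (glue_hasgrad (u := fun k z => f (Phi k z)) (U := grad_piece f)) => //.
  + by move=> k vp dp; exact: hasgrad_Phi.
  + by move=> k rp hp; exact: bounce_invariant (specular_invariant sf) rp hp.
  + by move=> k rp hp j; exact: grad_piece_match.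
- apply: (glue_cvg (u := fun k => grad_piece f k j)) => // k.
  + by move=> vp dp; exact: grad_piece_cvg hf vp dp.
  + by move=> rp hp; exact: grad_piece_match.
Unshelve. all: by end_near. Qed.

Lemma char_sol_C2 f : CkP 2 f -> specular f -> C1_compat f -> C2_compat f ->
  CkT 2 (char_sol f) /\
  forall j l z, time_dom z -> pdT l (pdT j (char_sol f)) z = hess_piece f (kappa z) j l z.
Proof.
move=> hf sf cf cf'; have hf1 := Ck_onW hf.
have [[h0 h1] E] := char_sol_C1 hf1 sf cf.
have H j : CkT 1 (pdT j (char_sol f)) /\
    forall l z, time_dom z -> pdT l (pdT j (char_sol f)) z = hess_piece f (kappa z) j l z.
  apply: (C1_of_hasgrad (c := tc) time_dom_proper
    (G := fun l z => hess_piece f (kappa z) j l z)) => [p tp|l p tp].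
  - apply: (@hasgrad_eq _ _ _ _ _ _ (fun z => grad_piece f (kappa z) j z)).
    + by rewrite E.
    + by near=> q => tq; rewrite E.
    apply: (glue_hasgrad (u := fun k => grad_piece f k j)
      (U := fun k => hess_piece f k j)) => //.
    + by move=> k vp dp; exact: hasgrad_grad_piece hf vp dp.
    + by move=> k rp hp; exact: grad_piece_match hf1 sf cf rp hp j.
    + by move=> k rp hp l; exact: hess_piece_match hf sf cf cf' rp hp j l.
  - apply: (glue_cvg (u := fun k => hess_piece f k j l)) => // k.
    + by move=> vp dp; exact: hess_piece_cvg hf vp dp.
    + by move=> rp hp; exact: hess_piece_match hf sf cf cf' rp hp j l.
split; last by move=> j; exact: (H j).2.
split=> [|j]; first exact: h0.
by split; [exact: (h1 j).1|exact: (H j).1].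
Unshelve. all: by end_near. Qed.

End Pieces.

(** * The transport problem *)

Section Solution.
Variable R : realType.
Local Notation vec := 'cV[R]_2.
Local Notation phase := ('cV[R]_2 * 'cV[R]_2)%type.
Local Notation M := ('I_2 + 'I_2)%type.
Local Notation J := (option M).
Local Notation pd := (pderiv (@phase_dir R) (@phase_dom R)).
Local Notation pdT := (pderiv (@time_dir R) (@time_dom R)).
Local Notation CkP := (Ck_on (@phase_dir R) (@phase_dom R)).
Local Notation CkT := (Ck_on (@time_dir R) (@time_dom R)).
Local Notation hit k := (jv (jhit R k)).
Implicit Types (z : R * phase) (f g : phase -> R) (x v : vec) (k : nat).

Lemma grad_piece_transport g k z : (k = 0)%N \/ z.2.2 != 0 ->
  grad_piece g k None z + \sum_i z.2.2 i 0 * grad_piece g k (Some (inl i)) z = 0.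
Proof.
move=> vz; rewrite /grad_piece; under [X in _ + X]eq_bigr do rewrite mulr_sumr.
rewrite exchange_big /= -big_split /= big1 // => m _.
transitivity (pd m g (Phi k z) * jtr (jPhi R k m) z); last by rewrite jtr_Phi ?mulr0.
rewrite /jtr mulrDr mulr_sumr; congr (_ + _).
by apply: eq_bigr => i _; rewrite mulrCA.
Qed.

Lemma kappa_v0 z : (kappa z = 0)%N \/ z.2.2 != 0.
Proof. by have [v0|v0] := eqVneq z.2.2 0; [left; rewrite /kappa v0 eqxx|right]. Qed.

(** The coordinate of the point along the velocity is minus half the chord, so
    the backward bounce is immediate. *)
Lemma gamma_minus_hit t x v : gamma_minus (x, v) ->
  [/\ v != 0, regular (t, (x, v)) & hit 1 (t, (x, v)) = 0].
Proof.
move=> gm; have [cx vx] := gm; rewrite /= in cx vx.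
have v0 : v != 0.
  by apply: contraTneq vx => ->; rewrite dotE !mxE !mul0r addr0 ltxx.
have rz : regular (t, (x, v)).
  apply: phase_reg_regular v0; split; first by rewrite /phase_dom /cdisc /= cx.
  by case=> _ /= h; rewrite h ltxx in vx.
split=> //; set z := (t, (x, v)) in rz *.
have r0 : 0 < jv (jspeed R) z by exact: rr_gt0.
have c0 := cphi_gt0 rz; have c2 := cphi_sqr rz.
have E : jv (jalong R) z ^+ 2 + jv (jbeta R) z ^+ 2 = 1.
  by rewrite -dot_xx //; apply/circleE.
have d0 : jv (jalong R) z < 0.
  have -> : jv (jalong R) z = dot v x / jv (jspeed R) z.
    rewrite ddE !wwE dotE -[z.2.1]/x -[z.2.2]/v.
    by move: (jv (jspeed R) z)^-1 => a; ring.
  by rewrite pmulr_llt0 ?invr_gt0.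
rewrite hitE mulr1; move: c0 c2 E d0.
move: (cphi z) (jv (jalong R) z) (jv (jbeta R) z) => c d b c0 c2 E d0.
have -> : d + (2 - 1) * c = 0.
  have : (c - d) * (d + c) = 0 by nra.
  have cd : c - d != 0 by rewrite gt_eqF // subr_gt0 (lt_trans d0).
  by move/eqP; rewrite mulf_eq0 (negbTE cd) /= => /eqP <-; ring.
by rewrite mul0r.
Qed.

(** The immediate bounce leads to the reflected state, so the two cycles agree
    up to a shift. *)
Lemma char_sol_reflect f t x v : 0 <= t -> gamma_minus (x, v) ->
  char_sol f (t, (x, v)) = char_sol f (t, (x, reflmx x *m v)).
Proof.
move=> t0 gm; have [cx vx] := gm; have [v0 rz h1] := gamma_minus_hit t gm.
set z := (t, (x, v)) in rz h1; set w := reflmx x *m v.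
have Ev : reflmx x *m w = v by exact: reflmx_w.
have w0 : w != 0.
  by apply: contra_neq v0 => w0; rewrite -Ev w0 mulmx0.
have xd : cdisc x by rewrite /cdisc /= cx.
have wx : dot w x = - dot v x.
  have /circleE xx := cx.
  rewrite dotE !reflmxE -[_ + _]/((v 0 0 - 2 * dot x v * x 0 0) * x 0 0 +
    (v 1 0 - 2 * dot x v * x 1 0) * x 1 0) dotC.
  have -> : forall d : R, (v 0 0 - 2 * d * x 0 0) * x 0 0 +
    (v 1 0 - 2 * d * x 1 0) * x 1 0 = dot v x - 2 * d * dot x x.
    by move=> d; rewrite !dotE; ring.
  by rewrite xx; ring.
have ry : regular (t, (x, w)).
  apply: phase_reg_regular w0; split=> //.
  by case=> _ /= /eqP; rewrite wx oppr_eq0 lt_eqF.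
have rz0 : regular (0, (x, v)) by exact: regular_time rz.
have h10 : (0 : R) = hit 1 (0, (x, v)) by rewrite -[RHS]/(hit 1 z) h1.
have [_ _ E] := Phi_bounce rz0 h10.
have bz : bounce z = (t, (x, w)).
  rewrite bounceE // h1 subr0 -[(0, z.2)]/(0, (x, v)) E Phi0E /=.
  by rewrite scale0r subr0.
have cyc k : bcycle k.+1 t x v = bcycle k t x w by rewrite /bcycle iterSr bz.
have [k kz] := in_piece_ex ry t0.
have iy : bounce_index 0 t x w = k by exact: (bounce_indexE ry).
have iz : bounce_index 0 t x v = k.+1.
  apply: (bounce_indexE rz) => //.
  by rewrite -bcycle_piece // -[z.1]/t -[z.2.1]/x -[z.2.2]/v !cyc (bcycle_piece _ ry).
by rewrite /char_sol /Xchar /Vchar (negbTE v0) (negbTE w0) iy iz cyc.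
Qed.

(** At time zero at most the immediate bounce of an incoming boundary point has
    taken place. *)
Lemma char_sol_init f p : specular f -> phase_reg p -> char_sol f (0, p) = f p.
Proof.
move=> sf rp; have tp : time_dom (0, p) by split.
have P0 : Phi 0 (0, p) = p by rewrite Phi0E /= scale0r subr0; case: (p).
rewrite char_solE //; have [k0|v0] := kappa_v0 (0, p); first by rewrite k0 P0.
have rz := time_dom_regular tp v0; have h0 := hit1_ge0 rz (time_dom_cdisc tp).
have [h1|h1] := ltP 0 (hit 1 (0, p)).
  by rewrite (kappa_in_piece (k := 0) tp rz) ?P0 // /in_piece h1.
have h10 : (0, p).1 = hit 1 (0, p) by apply/eqP; rewrite eq_le h0 h1.
rewrite (kappa_in_piece (k := 1) tp rz); last first.
  by rewrite /in_piece h1 /= [X in X < _]h10 hit_lt.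
by rewrite -(bounce_invariant (specular_invariant sf) rz h10) P0.
Qed.

Lemma char_sol_solution n f : CkT n (char_sol f) -> CkP 1 f ->
  specular f -> C1_compat f -> Ck_solution n f (char_sol f).
Proof.
move=> cn hf sf cf; have [_ E] := char_sol_C1 hf sf cf; split=> //.
- move=> z tz; rewrite /dt /dx E //; under eq_bigr do rewrite E //.
  exact: grad_piece_transport (kappa_v0 z).
- move=> t x v tz cx; have [t0 [px ng]] := tz.
  have : dot v x != 0 by apply: contra_notN ng => /eqP.
  rewrite neq_lt => /orP[vx|vx]; first exact: char_sol_reflect.
  rewrite -{1}(reflmx_w v cx); apply/esym/char_sol_reflect => //; split=> //=.
  have /circleE xx := cx.
  have -> : dot (reflmx x *m v) x = - dot v x.
    rewrite dotE !reflmxE [dot x v]dotC.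
    transitivity (dot v x - 2 * dot v x * dot x x); last by rewrite xx; ring.
    by rewrite !dotE; ring.
  by rewrite oppr_lt0.
- by move=> p; exact: char_sol_init.
Qed.

End Solution.

(** * The estimates *)

Section Estimates.
Variable R : realType.
Local Notation vec := 'cV[R]_2.
Local Notation phase := ('cV[R]_2 * 'cV[R]_2)%type.
Local Notation M := ('I_2 + 'I_2)%type.
Local Notation J := (option M).
Local Notation pd := (pderiv (@phase_dir R) (@phase_dom R)).
Local Notation pdT := (pderiv (@time_dir R) (@time_dom R)).
Local Notation CkP := (Ck_on (@phase_dir R) (@phase_dom R)).
Local Notation absP := (Ck_abs (@phase_dir R) (@phase_dom R)).
Local Notation absT := (Ck_abs (@time_dir R) (@time_dom R)).
Local Notation hit k := (jv (jhit R k)).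
Local Notation rr := (jv (jspeed R)).
Implicit Types (z : R * phase) (p : phase) (f g : phase -> R) (x v : vec) (k : nat).

Lemma normal_speed z : regular z -> cdisc z.2.1 ->
  `|dot z.2.2 (xb z.2.1 z.2.2)| = rr z * cphi z.
Proof.
case: z => t [x v] rz xd; have [v0 _] := rz.
have rh := regular_time (hit 1 (t, (x, v))) rz.
have [_] := Phi_bounce (k := 0) rh erefl.
rewrite Phi0E -[(_, _).2.2]/v -[(_, _).1]/(hit 1 (t, (x, v))) -[(_, _).2.1]/x.
rewrite -[in X in X -> _](tbE rz xd) -[_ * cphi _]/(rr (t, (x, v)) * cphi (t, (x, v))).
rewrite /xb => -> _; rewrite normrN ger0_norm //.
by rewrite mulr_ge0 // ltW ?cphi_gt0 ?rr_gt0.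
Qed.

(** The factor of the first estimate; that of the second is its square. *)
Definition weight (t : R) x v : R :=
  enorm v / `|dot v (xb x v)| ^+ 2 * jap v ^+ 2 * (1 + enorm v * t).

Section RealBounds.
Variables (r c t kap : R).
Hypotheses (r0 : 0 < r) (c0 : 0 < c) (c1 : c <= 1) (t0 : 0 <= t).
Hypotheses (kap0 : 0 <= kap) (kapE : kap <= 4 * c^-1 * (1 + r * t)).
Let jp : R := 1 + r.
Let w : R := r / (r * c) ^+ 2 * jp ^+ 2 * (1 + r * t).
Let mu : R := c^-1.
Let q : R := 1 + r * t.
Let a : R := 64 * mu * (2 * jp / r).

Let mu1 : 1 <= mu. Proof. by rewrite invf_ge1. Qed.
Let q1 : 1 <= q. Proof. by rewrite lerDl mulr_ge0 // ltW. Qed.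
Let jp1 : 1 <= jp. Proof. by rewrite lerDl ltW. Qed.
Let wE : w = mu ^+ 2 * (r^-1 * jp ^+ 2) * q.
Proof. by rewrite /w /mu /q /jp; field; rewrite !gt_eqF. Qed.

Lemma weight_ge1 : 1 <= w.
Proof.
rewrite wE; apply: mulr_ege1 => //; apply: mulr_ege1.
  by rewrite expr_ge1 // (le_trans _ mu1).
rewrite mulrC ler_pdivlMr // mul1r /jp; have := r0; nra.
Qed.

Lemma first_weight : jp * (kap * a) <= 512 * w.
Proof.
have -> : jp * (kap * a) = 128 * mu * (r^-1 * jp ^+ 2) * kap by rewrite /a; ring.
have -> : 512 * w = 128 * mu * (r^-1 * jp ^+ 2) * (4 * mu * q) by rewrite wE; ring.
have m0 : 0 <= mu by exact: le_trans mu1.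
have j0 : 0 <= jp by exact: le_trans jp1.
have i0 : 0 <= r^-1 by rewrite invr_ge0 ltW.
apply: ler_wpM2l; last exact: kapE.
by rewrite !mulr_ge0.
Qed.

Lemma second_weight : jp * (kap * (kap + mu) * a ^+ 2) <= (640 * 512) * w ^+ 2.
Proof.
have m0 : 0 <= mu by exact: le_trans mu1.
have j0 : 0 <= jp by exact: le_trans jp1.
have i0 : 0 <= r^-1 by rewrite invr_ge0 ltW.
have qq0 : 0 <= q by exact: le_trans q1.
have h1 : kap + mu <= 5 * mu * q.
  have h : mu <= mu * q by rewrite ler_peMr.
  have e : 5 * mu * q = 4 * mu * q + mu * q by ring.
  by rewrite e; apply: lerD h; exact: kapE.
have -> : jp * (kap * (kap + mu) * a ^+ 2) =
  (128 * 128) * mu ^+ 2 * r^-1 ^+ 2 * (kap * (kap + mu)) * jp ^+ 3 by rewrite /a; ring.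
have -> : (640 * 512) * w ^+ 2 =
  (128 * 128) * mu ^+ 2 * r^-1 ^+ 2 * ((4 * mu * q) * (5 * mu * q)) * (jp ^+ 3 * jp).
  by rewrite wE; ring.
apply: ler_pM.
- by rewrite !mulr_ge0 ?sqr_ge0 // addr_ge0.
- exact: exprn_ge0.
- apply: ler_wpM2l; first by rewrite !mulr_ge0 ?sqr_ge0.
  by apply: ler_pM => //; rewrite addr_ge0.
- by rewrite ler_peMr // exprn_ge0.
Qed.

End RealBounds.

Definition jet_const : R := 4640 * (640 * 512).

Lemma jet_const_ge1 : 1 <= jet_const.
Proof. by rewrite !mulr_ege1 ?ler1n. Qed.

(** Chords have length [2 * cphi z], so the number of bounces up to time [t] is
    of order [(1 + |v| t) / cphi z]. *)
Lemma jets_le z m : time_dom z -> z.2.2 != 0 ->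
  let w := weight z.1 z.2.1 z.2.2 in
  1 <= w /\ jder_le z w (w ^+ 2) jet_const (jPhi R (kappa z) m).
Proof.
move=> tz v0 w; have rz := time_dom_regular tz v0; have xd := time_dom_cdisc tz.
have t0 : 0 <= z.1 by exact: tz.1.
have r0 := rr_gt0 v0; have c0 := cphi_gt0 rz; have c1 := cphi_le1 z.
have := time_dom_kappa tz v0; move: (kappa z) => k kz.
have wE : w = rr z / (rr z * cphi z) ^+ 2 * (1 + rr z) ^+ 2 * (1 + rr z * z.1).
  by rewrite /w /weight normal_speed // /jap -jspeedE.
have [h1 h2] : (k == 0)%N || (hit k z <= z.1) /\ z.1 < hit k.+1 z.
  by move: kz => /andP.
have dc : jv (jalong R) z ^+ 2 <= cphi z ^+ 2.
  have := xd; rewrite cdiscE dot_xx // cphi_sqr // => ?; lra.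
have {}dc : `|jv (jalong R) z| <= cphi z by apply: norm_sqr_le => //; exact: ltW.
move: dc; rewrite ler_norml => /andP[d1 d2].
set kap : R := 2 * k.+1%:R.
have kap2 : 2 <= kap by rewrite ler_peMr // ler1n.
have tr : z.1 <= kap / rr z.
  rewrite (le_trans (ltW h2)) // hitE ler_wpM2r ?invr_ge0 ?(ltW r0) // /kap.
  have k0 : (0 : R) <= k%:R by exact: ler0n.
  rewrite [k.+1%:R]mulrS;
  move: (k%:R : R) k0 (cphi z) (jv (jalong R) z) c1 c0 d2 => n n0 c d.
  by move=> *; nra.
have kapE : kap <= 4 * (cphi z)^-1 * (1 + rr z * z.1).
  have m1 : 1 <= (cphi z)^-1 by rewrite invf_ge1.
  have rt : 0 <= rr z * z.1 by rewrite mulr_ge0 // ltW.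
  rewrite /kap [k.+1%:R]mulrS.
  have : (k%:R - 1) * 2 * cphi z <= rr z * z.1.
    case/orP: h1 => [/eqP->|]; first by rewrite (le_trans _ rt) //; nra.
    rewrite hitE ler_pdivrMr // [z.1 * _]mulrC; apply: le_trans.
    by move: (k%:R : R) => n; lra.
  rewrite -ler_pdivlMr // mulrC.
  move: (rr z * z.1) (cphi z)^-1 (k%:R : R) rt m1 => s y n s0 y1 h.
  nra.
have kap0 : 0 <= kap by rewrite (le_trans _ kap2).
have w1 : 1 <= w by rewrite wE; exact: weight_ge1.
split=> //.
set jp := 1 + rr z; set b := 2 * jp / rr z.
have jp1 : 1 <= jp by rewrite lerDl ltW.
have rjp : rr z <= jp by rewrite lerDr.
have b2 : 2 <= b by rewrite /b -mulrA ler_peMr // ler_pdivlMr // mul1r.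
have br : 2 / rr z <= b.
  by rewrite /b -mulrA ler_wpM2l // ler_peMl // invr_ge0 ltW.
have mu1 : 1 <= (cphi z)^-1 by rewrite invf_ge1.
set c := 64 * (cphi z)^-1 * b.
have H : jder_le z (kap * c) (kap * (kap + (cphi z)^-1) * c ^+ 2) (4640 * jp)
    (jPhi R k m).
  have [k0|k0] := eqVneq k 0%N.
    by rewrite k0; apply: (jPhi0_le rz b2 br mu1 erefl kap2 erefl erefl jp1 rjp t0 tr).
  move: h1; rewrite (negbTE k0) => h1.
  apply: (jPhi_le rz xd b2 br mu1 erefl erefl kap2 erefl erefl jp1 rjp t0 tr _ erefl) => //.
  exact: ltW.
have f1 := first_weight r0 c0 c1 kapE; have f2 := second_weight r0 c0 c1 t0 kap0 kapE.
rewrite -wE in f1 f2.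
have [H1 H2] := H; have w0 : 0 <= w by exact: le_trans w1.
split=> [j|j l].
  apply: le_trans (H1 j) _; rewrite -(mulrA 4640 jp) -(mulrA 4640 _ w).
  apply: ler_wpM2l; first exact: ler0n.
  apply: le_trans f1 _; apply: ler_wpM2r w0 _ _ _.
  by apply: ler_peMl; [exact: ler0n|exact: ler1n].
apply: le_trans (H2 j l) _; rewrite -(mulrA 4640 jp) -(mulrA 4640 _ (w ^+ 2)).
by apply: ler_wpM2l f2; exact: ler0n.
Qed.

Definition grad_sum g p : R := \sum_m `|pd m g p|.

Lemma grad_piece_le g k j z (D : R) : (forall m j, `|j1 (jPhi R k m) j z| <= D) ->
  `|grad_piece g k j z| <= grad_sum g (Phi k z) * D.
Proof.
move=> h; rewrite (le_trans (ler_norm_sum _ _ _)) // mulr_suml ler_sum // => m _.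
by rewrite normrM ler_wpM2l.
Qed.

Lemma hess_piece_le g k j l z (D E : R) : (forall m j, `|j1 (jPhi R k m) j z| <= D) ->
  (forall m j l, `|j2 (jPhi R k m) j l z| <= E) -> 0 <= D ->
  `|hess_piece g k j l z| <= (\sum_m grad_sum (pd m g) (Phi k z)) * (D * D) +
    grad_sum g (Phi k z) * E.
Proof.
move=> h h' D0; rewrite (le_trans (ler_norm_sum _ _ _)) // !mulr_suml -big_split.
apply: ler_sum => m _; rewrite (le_trans (ler_normD _ _)) // !normrM lerD //.
  by rewrite mulrA; apply: ler_pM => //; exact: grad_piece_le.
by rewrite ler_wpM2l.
Qed.

Lemma sum_dir (a : R) : \sum_(j : J) a = 5 * a.
Proof. by rewrite sumr_const card_option card_sum !card_ord mulr_natl. Qed.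

Lemma grad_sum_ge0 g p : 0 <= grad_sum g p.
Proof. exact: sumr_ge0. Qed.

Lemma Ck_abs1E f p : absP 1 f p = `|f p| + grad_sum f p.
Proof. by congr (_ + _); apply: eq_bigr => m _; rewrite /= addr0. Qed.

Lemma Ck_abs2E f p :
  absP 2 f p = `|f p| + (grad_sum f p + \sum_m grad_sum (pd m f) p).
Proof.
rewrite -big_split; congr (_ + _); apply: eq_bigr => m _; exact: Ck_abs1E.
Qed.

Lemma char_sol_abs1 f z : CkP 1 f -> specular f -> C1_compat f ->
  time_dom z -> z.2.2 != 0 ->
  absT 1 (char_sol f) z <=
    6 * jet_const * absP 1 f (Phi (kappa z) z) * weight z.1 z.2.1 z.2.2.
Proof.
move=> hf sf cf tz v0; have [_ E] := char_sol_C1 hf sf cf.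
have w1 := (jets_le (inl 0) tz v0).1.
have hj m := (jets_le m tz v0).2; move: (weight _ _ _) w1 hj => w w1 hj.
have CC := jet_const_ge1.
have Cw : 1 <= jet_const * w by exact: mulr_ege1.
have h j : `|grad_piece f (kappa z) j z| <=
    grad_sum f (Phi (kappa z) z) * (jet_const * w).
  by apply: grad_piece_le => m j'; have [] := hj m.
have -> : absT 1 (char_sol f) z =
    `|f (Phi (kappa z) z)| + \sum_j `|grad_piece f (kappa z) j z|.
  rewrite -char_solE //; congr (_ + _); apply: eq_bigr => j _.
  by rewrite -[LHS]/(`|pdT j (char_sol f) z| + 0) addr0 E.
(* There are five directions; with the value itself they make up the factor 6. *)
have hs : \sum_j `|grad_piece f (kappa z) j z| <=
    5 * (grad_sum f (Phi (kappa z) z) * (jet_const * w)).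
  by rewrite -sum_dir; apply: ler_sum.
rewrite (le_trans (lerD (lexx _) hs)) // Ck_abs1E.
have := grad_sum_ge0 f (Phi (kappa z) z); have := normr_ge0 (f (Phi (kappa z) z)).
move: (grad_sum _ _) `|_| => s a a0 s0.
have -> : 6 * jet_const * (a + s) * w = 6 * (jet_const * w) * (a + s) by ring.
move: (jet_const * w) Cw => y y1; nra.
Qed.

Lemma char_sol_abs2 f z : CkP 2 f -> specular f -> C1_compat f -> C2_compat f ->
  time_dom z -> z.2.2 != 0 ->
  absT 2 (char_sol f) z <=
    56 * jet_const ^+ 2 * absP 2 f (Phi (kappa z) z) * weight z.1 z.2.1 z.2.2 ^+ 2.
Proof.
move=> hf sf cf cf' tz v0; have [_ E] := char_sol_C1 (Ck_onW hf) sf cf.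
have [_ E2] := char_sol_C2 hf sf cf cf'.
have w1 := (jets_le (inl 0) tz v0).1.
have hj m := (jets_le m tz v0).2; move: (weight _ _ _) w1 hj => w w1 hj.
have CC := jet_const_ge1.
have Cw : 1 <= jet_const * w by exact: mulr_ege1.
have D0 : 0 <= jet_const * w by exact: le_trans Cw.
have d1 m j : `|j1 (jPhi R (kappa z) m) j z| <= jet_const * w by have [] := hj m.
have d2 m j l : `|j2 (jPhi R (kappa z) m) j l z| <= jet_const * w ^+ 2 by have [] := hj m.
have h j := grad_piece_le f j d1; have h' j l := hess_piece_le f j l d1 d2 D0.
have -> : absT 2 (char_sol f) z = `|f (Phi (kappa z) z)| +
    \sum_j (`|grad_piece f (kappa z) j z| + \sum_l `|hess_piece f (kappa z) j l z|).
  rewrite -char_solE //; congr (_ + _); apply: eq_bigr => j _.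
  rewrite -E //; congr (_ + _); apply: eq_bigr => l _.
  by rewrite -[LHS]/(`|pdT l (pdT j (char_sol f)) z| + 0) addr0 E2.
move: h h'; rewrite Ck_abs2E; move: (Phi (kappa z) z) => p h h'.
set s := grad_sum f p in h h' *; set s2 := \sum_m _ in h' *.
(* The factor 56 is 1 + 5 + 25 + 25: the value, the gradient and, in the second
   derivatives, the terms with second and with first derivatives of [f]. *)
have hs : \sum_j (`|grad_piece f (kappa z) j z| + \sum_l `|hess_piece f (kappa z) j l z|) <=
    5 * (s * (jet_const * w) + 5 * (s2 * (jet_const * w * (jet_const * w)) +
      s * (jet_const * w ^+ 2))).
  rewrite -!sum_dir; apply: ler_sum => j _; apply: lerD; first exact: h.
  by apply: ler_sum => l _; exact: h'.
rewrite (le_trans (lerD (lexx _) hs)) //.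
have s0 : 0 <= s by exact: grad_sum_ge0.
have s20 : 0 <= s2 by apply: sumr_ge0 => m _; exact: grad_sum_ge0.
have a0 := normr_ge0 (f p); move: s s2 `|f p| s0 s20 a0 {h h' hs} => s s2 a s0 s20 a0.
have -> : 56 * jet_const ^+ 2 * (a + (s + s2)) * w ^+ 2 =
  56 * ((jet_const * w) * (jet_const * w)) * (a + (s + s2)) by ring.
have y2 : jet_const * w ^+ 2 <= jet_const * w * (jet_const * w).
  have -> : jet_const * w * (jet_const * w) = jet_const * (jet_const * w ^+ 2) by ring.
  by rewrite ler_peMl // mulr_ge0 ?sqr_ge0 // (le_trans _ CC).
have y1 : jet_const * w <= jet_const * w * (jet_const * w) by rewrite ler_peMl.
have y0 : 1 <= jet_const * w * (jet_const * w) by exact: le_trans y1.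
have {}y2 := ler_wpM2l s0 y2; have {}y1 := ler_wpM2l s0 y1; have {}y0 := ler_wpM2l a0 y0.
have sy := mulr_ge0 s0 (mulr_ge0 D0 D0); have s2y := mulr_ge0 s20 (mulr_ge0 D0 D0).
have ay := mulr_ge0 a0 (mulr_ge0 D0 D0).
move: (jet_const * w * (jet_const * w)) (jet_const * w) (jet_const * w ^+ 2)
  y2 y1 y0 sy s2y ay => y u v y2 y1 y0 sy s2y ay.
lra.
Qed.

Lemma ereal_bound n f p (l C w : R) : phase_dom p -> 0 <= C -> 0 <= w ->
  l <= C * absP n f p * w ->
  (l%:E <= C%:E * Ck_norm (@phase_dir R) (@phase_dom R) n f * w%:E)%E.
Proof.
move=> dp jet_const' w0 h; apply: (@le_trans _ _ (C%:E * (absP n f p)%:E * w%:E)%E).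
  by rewrite -!EFinM lee_fin.
apply: lee_wpmul2r; first by rewrite lee_fin.
apply: lee_wpmul2l; first by rewrite lee_fin.
by apply: ereal_sup_ubound; exists p.
Qed.

End Estimates.

Theorem theorem1p10 (R : realType) :
  (exists C : R, 0 < C /\
    forall f0 : 'cV[R]_2 * 'cV[R]_2 -> R,
      Ck_on (@phase_dir R) (@phase_dom R) 1 f0 ->
      specular f0 -> C1_compat f0 ->
      Ck_solution 1 f0 (char_sol f0) /\
      forall (t : R) (x v : 'cV[R]_2),
        0 <= t -> phase_reg (x, v) -> v != 0 ->
        ((Ck_abs (@time_dir R) (@time_dom R) 1 (char_sol f0) (t, (x, v)))%:E
         <= C%:E * Ck_norm (@phase_dir R) (@phase_dom R) 1 f0
            * (enorm v / `|dot v (xb x v)| ^+ 2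
               * jap v ^+ 2 * (1 + enorm v * t))%:E)%E)
  /\
  (exists C : R, 0 < C /\
    forall f0 : 'cV[R]_2 * 'cV[R]_2 -> R,
      Ck_on (@phase_dir R) (@phase_dom R) 2 f0 ->
      specular f0 -> C1_compat f0 -> C2_compat f0 ->
      Ck_solution 2 f0 (char_sol f0) /\
      forall (t : R) (x v : 'cV[R]_2),
        0 <= t -> phase_reg (x, v) -> v != 0 ->
        ((Ck_abs (@time_dir R) (@time_dom R) 2 (char_sol f0) (t, (x, v)))%:E
         <= C%:E * Ck_norm (@phase_dir R) (@phase_dom R) 2 f0
            * (enorm v ^+ 2 / `|dot v (xb x v)| ^+ 4
               * jap v ^+ 4 * (1 + enorm v * t) ^+ 2)%:E)%E).
Proof.
have c0 : 0 < jet_const R by exact: lt_le_trans (jet_const_ge1 R).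
split.
  exists (6 * jet_const R); split=> [|f hf sf cf]; first by rewrite mulr_gt0.
  split; first by apply: char_sol_solution => //; exact: (char_sol_C1 hf sf cf).1.
  move=> t x v t0 rp v0; have tz : time_dom (t, (x, v)) by split.
  have w1 := (jets_le (inl 0) tz v0).1.
  apply: (ereal_bound (Phi_kappa_dom tz)) (char_sol_abs1 hf sf cf tz v0).
    by rewrite mulr_ge0 // ltW.
  exact: le_trans w1.
exists (56 * jet_const R ^+ 2); split=> [|f hf sf cf cf'].
  by rewrite mulr_gt0 // exprn_gt0.
split.
  by apply: char_sol_solution => //; [exact: (char_sol_C2 hf sf cf cf').1|exact: Ck_onW].
move=> t x v t0 rp v0; have tz : time_dom (t, (x, v)) by split.
have -> : enorm v ^+ 2 / `|dot v (xb x v)| ^+ 4 * jap v ^+ 4 *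
    (1 + enorm v * t) ^+ 2 = weight t x v ^+ 2.
  by rewrite /weight -[4%N]/(2 * 2)%N !exprM; rewrite !exprMn exprVn.
apply: (ereal_bound (Phi_kappa_dom tz)) (char_sol_abs2 hf sf cf cf' tz v0).
  by rewrite mulr_ge0 // sqr_ge0.
exact: sqr_ge0.
Qed.
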